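(* Let $M$ be a manifold with an order $r$ weighting along a closed submanifold $N\subseteq M$, and let $$Q=\{\mathsf{u}\in T_rM\mid \forall f\in C^\infty(M)_{(i)},\ j<i\le r\ \Rightarrow\ f^{(j)}(\mathsf{u})=0\}.$$ (a) The subset $Q\subseteq T_rM$ is a graded subbundle $Q\to N$ of dimension $k_0+\dots+k_r$. In fact, $Q$ is $\Lambda_r$-invariant. (b) The linear approximation of $Q$ is $$Q_{\mathrm{lin}}=\widetilde F_{-1}\oplus\cdots\oplus\widetilde F_{-r}$$ as a graded subbundle of $(T_rM)_{\mathrm{lin}}=TM^{\oplus r}$ (with $\widetilde F_{-i}$ in degree $-i$). In particular, $Q_{\mathrm{lin}}^{-r}=TM|_N$. (c) The weighting is recovered from $Q$ as follows: for $i\le r$, $$C^\infty(M)_{(i)}=\{f\in C^\infty(M)\mid \forall j<i:\ f^{(j)}\text{ vanishes on }Q\}.$$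
   Context: Weightings. A weight sequence of order $r$ is a sequence of integers $0\le w_1\le\dots\le w_n\le r$. Put $k_i=\#\{a: w_a\le i\}$, so $k_r=n$. For a chart $U$ with coordinates $x_1,\dots,x_n$, let $C^\infty(U)_{(i)}$ be the ideal generated by monomials $x^s=x_1^{s_1}\cdots x_n^{s_n}$ with $s\cdot w=\sum_a s_aw_a\ge i$. An order $r$ weighting on an $n$-dimensional manifold $M$ is a filtration $C^\infty_M=C^\infty_{M,(0)}\supseteq C^\infty_{M,(1)}\supseteq\cdots$ of the structure sheaf by ideal sheaves such that every point has an open neighborhood $U$ with coordinates $x_a$ (weighted coordinates) in which the filtration of $C^\infty(U)$ is given by this local model for a weight sequence of order $r$ (which may depend on the connected component of $N$; formulas are read componentwise). The ideal $C^\infty_{M,(1)}$ is the vanishing ideal $\mathcal I$ of a closed submanifold $N$, and one speaks of a weighting along $N$; in weighted coordinates, $N\cap U=\{x_a=0,\ a>k_0\}$. Global sections are denoted $C^\infty(M)_{(i)}$. Filtration of the normal bundle. The weighting determines a filtration $\nu(M,N)=TM|_N/TN=F_{-r}\supseteq\cdots\supseteq F_{-1}\supseteq F_0=0$ by subbundles such that, under the identification of $\mathcal I/\mathcal I^2$ with sections of $\nu(M,N)^*$ (via $f\mapsto df|_N$), the image of $C^\infty_{M,(i)}$ is the sheaf of sections of $\mathrm{ann}(F_{-i+1})$. Let $\widetilde F_{-i}\subseteq TM|_N$ be the pre-image of $F_{-i}$. Graded bundles. A graded bundle is a manifold $E$ with a smooth action $t\mapsto\kappa_t$ of the multiplicative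 monoid $(\mathbb{R},\cdot)$; it is a fiber bundle over the closed submanifold $\kappa_0(E)$. A graded subbundle is an $(\mathbb{R},\cdot)$-invariant submanifold. The linear approximation of $E\to N$ is $E_{\mathrm{lin}}=\nu(E,N)=\bigoplus_{i\ge1}E_{\mathrm{lin}}^{-i}$, where $E_{\mathrm{lin}}^{-i}$ is the subbundle on which the map $\nu(\kappa_t)$ induced by $\kappa_t$ is multiplication by $t^i$. Higher tangent bundles. Let $\mathbb{A}_r=\mathbb{R}[\epsilon]/(\epsilon^{r+1})$ and $T_rM=\mathrm{Hom}_{\mathrm{alg}}(C^\infty(M),\mathbb{A}_r)$ (equivalently, $r$-jets at $0$ of curves). Elements are $\mathsf{u}=\sum_{i=0}^r\mathsf{u}_i\epsilon^i$, with $\mathsf{u}_i:C^\infty(M)\to\mathbb{R}$ linear. It is a graded bundle over $M$ with $\kappa_t(\sum\mathsf{u}_j\epsilon^j)=\sum t^j\mathsf{u}_j\epsilon^j$. This extends to an action of the monoid $\Lambda_r=\mathrm{Hom}_{\mathrm{alg}}(\mathbb{A}_r,\mathbb{A}_r)$ by $\Psi\cdot\mathsf{u}=\Psi\circ\mathsf{u}$. For $f\in C^\infty(M)$, $f^{(i)}\in C^\infty(T_rM)$ is $f^{(i)}(\mathsf{u})=\mathsf{u}_i(f)$, $0\le i\le r$ (zero for $i<0$). For a vector field $X$ on $M$ and $0\le i\le r$, $X^{(-i)}$ is the unique vector field on $T_rM$ with $X^{(-i)}f^{(\ell)}=(Xf)^{(\ell-i)}$ for all $f,\ell$. The maps $X\mapsto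 X^{(-i)}|_M$, $i=0,\dots,r$, are $C^\infty(M)$-linear and give the identification $T(T_rM)|_M=TM\oplus(T_rM)_{\mathrm{lin}}=TM^{\oplus(r+1)}$, hence $(T_rM)_{\mathrm{lin}}=TM^{\oplus r}$ with summands in degrees $-1,\dots,-r$. *)

(* Defs.v *)
From HB Require Import structures.
From mathcomp Require Import all_boot all_order all_algebra.
From mathcomp Require Import all_classical all_reals all_analysis.

Set Implicit Arguments.
Unset Strict Implicit.
Unset Printing Implicit Defensive.

Import Order.TTheory GRing.Theory Num.Theory.
Import numFieldNormedType.Exports.
Local Open Scope classical_set_scope.
Local Open Scope ring_scope.

(* For U open. Continuity is asked at every level, although it follows from
   the existence and continuity of all directional derivatives. *)
Fixpoint Ck (R : realType) (d k : nat) (U : set 'rV[R]_d)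
    (f : 'rV[R]_d -> R) : Prop :=
  (forall x, U x -> {for x, continuous f}) /\
  (if k is k'.+1 then
     (forall x v, U x -> derivable f x v) /\ (forall v, Ck k' U ('D_v f))
   else True).

Definition smooth_rV (R : realType) (d : nat) (U : set 'rV[R]_d)
    (f : 'rV[R]_d -> R) : Prop := forall k, Ck k U f.

(* A homeomorphism from an open subset of X onto an open subset of R^d; the
   values of [chart_map] outside [chart_dom] are irrelevant. *)
Record chart (R : realType) (X : topologicalType) (d : nat) := Chart {
  chart_dom : set X;
  chart_map :> X -> 'rV[R]_d;
  chart_dom_open : open chart_dom;
  chart_inj : {in chart_dom &, injective chart_map};
  chart_cont : forall x, chart_dom x -> {for x, continuous chart_map};
  chart_open : forall V : set X,
    open V -> V `<=` chart_dom -> open (chart_map @` V)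
}.

(* A space with a set of charts, on which nothing is imposed yet. *)
Record charted_space (R : realType) (d : nat) := ChartedSpace {
  cs_sort :> topologicalType;
  atlas : set (chart R cs_sort d)
}.

(* f, restricted to U, is a smooth function of the coordinates c. *)
Definition smooth_in_chart (R : realType) (X : topologicalType) (d : nat)
    (c : chart R X d) (U : set X) (f : X -> R) : Prop :=
  exists2 h : 'rV[R]_d -> R,
    smooth_rV (c @` (chart_dom c `&` U)) h &
    forall x, chart_dom c x -> U x -> f x = h (c x).

Definition compatible_charts (R : realType) (X : topologicalType) (d : nat)
    (c c' : chart R X d) : Prop :=
  forall j : 'I_d,
    smooth_in_chart c (chart_dom c') (fun x => c' x ord0 j) /\
    smooth_in_chart c' (chart_dom c) (fun x => c x ord0 j).

Definition is_manifold (R : realType) (d : nat) (X : charted_space R d) : Prop :=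
  [/\ hausdorff_space X,
      @second_countable X,
      forall x : X, exists2 c, atlas c & chart_dom c x
    & forall c c' : chart R X d, atlas c -> atlas c' -> compatible_charts c c'].

(* The charts of the maximal atlas: local coordinate systems on X. *)
Definition smooth_chart (R : realType) (d : nat) (X : charted_space R d)
    (c : chart R X d) : Prop :=
  forall c', atlas c' -> compatible_charts c c'.

(* Elements of C^oo(U) are represented by functions on X, of which only the
   restriction to the open set U matters. *)
Definition smooth_on (R : realType) (d : nat) (X : charted_space R d)
    (U : set X) (f : X -> R) : Prop :=
  forall c, atlas c -> smooth_in_chart c U f.

(* Near x, S is given in suitable coordinates by the vanishing of all
   coordinates but the first k. *)
Definition submanifold_at (R : realType) (d : nat) (X : charted_space R d)
    (S : set X) (x : X) (k : nat) : Prop :=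
  (k <= d)%N /\
  exists c : chart R X d,
    [/\ smooth_chart c, chart_dom c x &
        forall y, chart_dom c y ->
          (S y <-> forall j : 'I_d, (k <= j)%N -> c y ord0 j = 0)].

Definition is_submanifold (R : realType) (d : nat) (X : charted_space R d)
    (S : set X) : Prop :=
  forall x, S x -> exists k, submanifold_at S x k.

Section SmoothClosure.
Variables (R : realType).

Lemma CkW d k (U : set 'rV[R]_d) f : Ck k.+1 U f -> Ck k U f.
Proof.
elim: k f => [f [fc _]//|k IH f [fc [df Df]]].
by split=> //; split=> // v; apply/IH/Df.
Qed.

Lemma near_eq_continuous (T : topologicalType) (f g : T -> R) (x : T) :
  (\near x, f x = g x) -> {for x, continuous f} -> {for x, continuous g}.
Proof.
move=> fg; rewrite /prop_for /continuous_at (nbhs_singleton fg).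
by apply: cvg_trans; exact: near_eq_cvg.
Qed.

Lemma Ck_ext d k (U : set 'rV[R]_d) f g : open U ->
  (forall x, U x -> f x = g x) -> Ck k U f -> Ck k U g.
Proof.
move=> Uo.
have near_eqU (f' g' : 'rV[R]_d -> R) x : (forall y, U y -> f' y = g' y) -> U x ->
    \near x, f' x = g' x.
  move=> fg Ux; apply: (@filterS _ (nbhs x) _ U) => [y /fg//|].
  exact: open_nbhs_nbhs.
elim: k f g => [|k IH] f g fg; have near_fg x := @near_eqU f g x fg.
  case=> fc _; split=> // x Ux; have := fc x Ux.
  exact: (near_eq_continuous (near_fg x Ux)).
case=> fc [fd fD].
split.
  move=> x Ux; have := fc x Ux.
  exact: (near_eq_continuous (near_fg x Ux)).
split=> [x v Ux|v]; first exact: near_eq_derivable (near_fg x Ux) (fd x v Ux).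
by apply: IH (fD v) => x Ux; exact: near_eq_derive (near_fg x Ux).
Qed.

Lemma Ck_cst d k (U : set 'rV[R]_d) (a : R) : open U -> Ck k U (cst a).
Proof.
move=> Uo; elim: k a => [|k IH] a.
  by split=> // x _; exact: cst_continuous.
split; first by move=> x _; exact: cst_continuous.
split=> [x v _|v]; first exact: derivable_cst.
by apply: Ck_ext (IH 0) => // x _; rewrite derive_cst.
Qed.

Lemma CkD d k (U : set 'rV[R]_d) f g : open U ->
  Ck k U f -> Ck k U g -> Ck k U (f + g).
Proof.
move=> Uo; elim: k f g => [|k IH] f g.
  case=> fc _ [gc _]; split=> // x Ux.
  exact: (continuousD (fc x Ux) (gc x Ux)).
case=> fc [fd fD] [gc [gd gD]]; split.
  move=> x Ux; exact: (continuousD (fc x Ux) (gc x Ux)).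
split=> [x v Ux|v]; first by apply: derivableD; [apply: fd|apply: gd].
apply: Ck_ext (IH _ _ (fD v) (gD v)) => // x Ux.
by rewrite deriveD; [|apply: fd|apply: gd].
Qed.

Lemma CkM d k (U : set 'rV[R]_d) f g : open U ->
  Ck k U f -> Ck k U g -> Ck k U (f * g).
Proof.
move=> Uo; elim: k f g => [|k IH] f g.
  case=> fc _ [gc _]; split=> // x Ux.
  exact: (continuousM (fc x Ux) (gc x Ux)).
move=> Ckf Ckg; have [Ckf' Ckg'] := (CkW Ckf, CkW Ckg).
case: Ckf Ckg => fc [fd fD] [gc [gd gD]]; split.
  move=> x Ux; exact: (continuousM (fc x Ux) (gc x Ux)).
split=> [x v Ux|v]; first by apply: derivableM; [apply: fd|apply: gd].
apply: (@Ck_ext _ _ _ (f * 'D_v g + g * 'D_v f)) => // [x Ux|].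
  by rewrite deriveM; [|apply: fd|apply: gd].
by apply: CkD => //; apply: IH => //; [exact: gD|exact: fD].
Qed.

Variables (d : nat) (X : charted_space R d).

Lemma open_chart_img (c : chart R X d) (U : set X) : open U ->
  open (c @` (chart_dom c `&` U)).
Proof.
move=> Uo; apply: chart_open; last by move=> x [].
by apply: openI => //; exact: chart_dom_open.
Qed.

Lemma smooth_on_cst (U : set X) (a : R) : open U -> smooth_on U (cst a).
Proof.
move=> Uo c _; exists (cst a) => // k.
by apply: Ck_cst; exact: open_chart_img.
Qed.

Lemma smooth_onD (U : set X) (f g : X -> R) : open U ->
  smooth_on U f -> smooth_on U g -> smooth_on U (f + g).
Proof.
move=> Uo sf sg c Ac; have [h hs fh] := sf c Ac; have [l ls gl] := sg c Ac.
exists (h + l) => [k|x cx Ux].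
  by apply: CkD; [exact: open_chart_img|exact: hs|exact: ls].
by rewrite [LHS]/(f x + g x) fh ?gl.
Qed.

Lemma smooth_onM (U : set X) (f g : X -> R) : open U ->
  smooth_on U f -> smooth_on U g -> smooth_on U (f * g).
Proof.
move=> Uo sf sg c Ac; have [h hs fh] := sf c Ac; have [l ls gl] := sg c Ac.
exists (h * l) => [k|x cx Ux].
  by apply: CkM; [exact: open_chart_img|exact: hs|exact: ls].
by rewrite [LHS]/(f x * g x) fh ?gl.
Qed.

Definition smooth_pred : {pred X -> R} := fun f => `[< smooth_on setT f >].

Fact smooth_subring_closed : subring_closed smooth_pred.
Proof.
have N1 : (-1 : X -> R) = cst (-1) by [].
split; first by apply/asboolP; apply: (smooth_on_cst 1); exact: openT.
- move=> f g /asboolP sf /asboolP sg; apply/asboolP.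
  rewrite -mulN1r; apply: smooth_onD => //; first exact: openT.
  by rewrite N1; apply: smooth_onM => //; [|apply: smooth_on_cst]; exact: openT.
- move=> f g /asboolP sf /asboolP sg; apply/asboolP.
  by apply: smooth_onM => //; exact: openT.
Qed.

Fact smooth_scaler_closed : GRing.scaler_closed smooth_pred.
Proof.
move=> a f /asboolP sf; apply/asboolP.
have -> : a *: f = cst a * f by [].
by apply: smooth_onM => //; [|apply: smooth_on_cst]; exact: openT.
Qed.

End SmoothClosure.

HB.instance Definition _ (R : realType) d (X : charted_space R d) :=
  GRing.isSubringClosed.Build (X -> R) (@smooth_pred R d X)
    (@smooth_subring_closed R d X).

HB.instance Definition _ (R : realType) d (X : charted_space R d) :=
  GRing.isScaleClosed.Build R (X -> R) (@smooth_pred R d X)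
    (@smooth_scaler_closed R d X).

Record Cinfty (R : realType) (d : nat) (X : charted_space R d) := MkCinfty {
  Cinfty_fun :> X -> R;
  Cinfty_smooth : Cinfty_fun \in @smooth_pred R d X
}.

HB.instance Definition _ (R : realType) d (X : charted_space R d) :=
  [isSub for @Cinfty_fun R d X].
HB.instance Definition _ (R : realType) d (X : charted_space R d) :=
  [Choice of Cinfty X by <:].
HB.instance Definition _ (R : realType) d (X : charted_space R d) :=
  GRing.SubChoice_isSubComPzRing.Build (X -> R) (@smooth_pred R d X) (Cinfty X)
    (@smooth_subring_closed R d X).
HB.instance Definition _ (R : realType) d (X : charted_space R d) :=
  [SubZmodule_isSubLmodule of Cinfty X by <:].

(* Point derivations of C^oo(X) at x. *)
Definition tangent_space (R : realType) (d : nat) (X : charted_space R d)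
    (x : X) : set (Cinfty X -> R) :=
  [set v | scalar v /\
           forall f g : Cinfty X, v (f * g) = f x * v g + g x * v f].

(* The image of T_x S in T_x X: the derivations at x which descend to the
   germs at x of smooth functions on S. *)
Definition tangent_subspace (R : realType) (d : nat) (X : charted_space R d)
    (S : set X) (x : X) : set (Cinfty X -> R) :=
  [set v | tangent_space x v /\
           forall f : Cinfty X,
             (exists U : set X, [/\ open U, U x &
                forall y, U y -> S y -> f y = 0]) -> v f = 0].

(* W is the image of V under the differential of phi : X -> X. *)
Definition pushforward (R : realType) (d : nat) (X : charted_space R d)
    (phi : X -> X) (V W : Cinfty X -> R) : Prop :=
  forall f g : Cinfty X, (forall x, g x = f (phi x)) -> W f = V g.

Definition weight_sequence (n r : nat) (w : 'I_n -> nat) : Prop :=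
  (forall a b : 'I_n, (a <= b)%N -> (w a <= w b)%N) /\
  (forall a, (w a <= r)%N).

Definition weight_count (n : nat) (w : 'I_n -> nat) (i : nat) : nat :=
  #|[set a : 'I_n | (w a <= i)%N]%SET|.

Definition monomial (R : realType) (n : nat) (s : 'I_n -> nat)
    (x : 'rV[R]_n) : R := \prod_(a < n) x ord0 a ^+ s a.

(* f belongs to the ideal of C^oo(U), U the domain of c, generated by the
   monomials c^s in the coordinates with s.w >= i. *)
Definition local_weight_ideal (R : realType) (n : nat) (M : charted_space R n)
    (c : chart R M n) (w : 'I_n -> nat) (i : nat) (f : M -> R) : Prop :=
  exists (m : nat) (g : 'I_m -> M -> R) (s : 'I_m -> 'I_n -> nat),
    (forall k, smooth_on (chart_dom c) (g k) /\
               (i <= \sum_(a < n) s k a * w a)%N) /\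
    (forall x, chart_dom c x ->
       f x = \sum_(k < m) g k x * monomial (s k) (c x)).

Definition weighted_chart_of (R : realType) (n : nat) (M : charted_space R n)
    (r : nat) (I : nat -> set M -> set (M -> R))
    (c : chart R M n) (w : 'I_n -> nat) : Prop :=
  [/\ smooth_chart c, weight_sequence r w &
      forall i f, I i (chart_dom c) f <-> local_weight_ideal c w i f].

(* [wfilt i U] is C^oo(U)_(i), for U open. *)
Record weighting (R : realType) (n : nat) (M : charted_space R n) (r : nat) :=
Weighting {
  wfilt : nat -> set M -> set (M -> R);
  wfilt_local : forall i U f g, open U -> (forall x, U x -> f x = g x) ->
    wfilt i U f -> wfilt i U g;
  wfilt_smooth : forall i U f, open U -> wfilt i U f -> smooth_on U f;
  wfilt_res : forall i U V f, open U -> open V -> V `<=` U ->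
    wfilt i U f -> wfilt i V f;
  wfilt_glue : forall i U f, open U ->
    (forall x, U x -> exists V, [/\ open V, V x, V `<=` U & wfilt i V f]) ->
    wfilt i U f;
  wfilt_zero : forall i U, open U -> wfilt i U 0;
  wfilt_add : forall i U f g, open U ->
    wfilt i U f -> wfilt i U g -> wfilt i U (f + g);
  wfilt_mul : forall i U f g, open U ->
    smooth_on U f -> wfilt i U g -> wfilt i U (f * g);
  wfilt_decr : forall i U, open U -> wfilt i.+1 U `<=` wfilt i U;
  wfilt_top : forall U f, open U -> smooth_on U f -> wfilt 0 U f;
  wfilt_model : forall x : M, exists c w,
    weighted_chart_of r wfilt c w /\ chart_dom c x
}.

Definition weighted_chart (R : realType) (n : nat) (M : charted_space R n)
    (r : nat) (W : weighting M r) (c : chart R M n) (w : 'I_n -> nat) : Prop :=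
  weighted_chart_of r (wfilt W) c w.

(* C^oo(M)_(1) is the vanishing ideal sheaf of the closed submanifold N. *)
Definition weighting_along (R : realType) (n : nat) (M : charted_space R n)
    (r : nat) (W : weighting M r) (N : set M) : Prop :=
  [/\ closed N, is_submanifold N &
      forall U f, open U ->
        (wfilt W 1 U f <-> smooth_on U f /\ forall x, U x -> N x -> f x = 0)].

(* The fibre at x in N of the pre-image in TM|_N of F_{-i}, where F_{-i} is the
   subbundle of nu(M,N) annihilated by the image of C^oo_{M,(i+1)} in
   I/I^2 = Gamma(nu(M,N)^* ). Germs at x of local sections are represented by
   global functions. *)
Definition Ftilde (R : realType) (n : nat) (M : charted_space R n)
    (r : nat) (W : weighting M r) (i : nat) (x : M) : set (Cinfty M -> R) :=
  [set v | tangent_space x v /\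
           forall f : Cinfty M,
             (exists U : set M, [/\ open U, U x & wfilt W i.+1 U f]) ->
             v f = 0].

Notation trunc R r := {poly %/ ('X^(r.+1) : {poly R})}.
Notation Lambda R r := {lrmorphism trunc R r -> trunc R r}.

Section ScaleEps.
Variables (R : realType) (r : nat).
Implicit Types (t : R) (p q : trunc R r).

(* The endomorphism eps |-> t eps. *)
Definition scale_eps t p : trunc R r :=
  in_qpoly 'X^(r.+1) ((p : {poly R}) \Po (t *: 'X)).

Lemma in_qpoly_comp_mod t (p : {poly R}) :
  in_qpoly 'X^(r.+1) ((in_qpoly 'X^(r.+1) p : {poly R}) \Po (t *: 'X)) =
  in_qpoly 'X^(r.+1) (p \Po (t *: 'X)).
Proof.
set h : {poly R} := 'X^(r.+1).
have hE : mk_monic h = h by rewrite mk_monic_Xn.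
have hm : h \is monic := monicXn R r.+1.
have h0 : in_qpoly h h = 0.
  by apply/val_inj; rewrite /= hE (Pdiv.RingMonic.rmodpp hm).
have hct : h \Po (t *: 'X) = t ^+ r.+1 *: h.
  by rewrite /h comp_Xn_poly exprZn.
rewrite [in RHS](Pdiv.RingMonic.rdivp_eq hm p) comp_polyD comp_polyM hct in_qpolyD.
by rewrite in_qpolyM in_qpolyZ h0 scaler0 mulr0 add0r /= hE.
Qed.

Fact scale_eps_linear t : linear (scale_eps t).
Proof.
move=> a p q; rewrite /scale_eps /= comp_polyD comp_polyZ.
by rewrite in_qpolyD in_qpolyZ.
Qed.

Fact scale_eps_monoid t : monoid_morphism (scale_eps t).
Proof.
split.
  have -> : scale_eps t 1 = in_qpoly 'X^(r.+1) (1%:P \Po (t *: 'X)) by [].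
  by rewrite comp_polyC; exact: in_qpoly1.
move=> p q; rewrite /scale_eps.
have -> : p * q = in_qpoly 'X^(r.+1) ((p : {poly R}) * (q : {poly R})) by [].
by rewrite in_qpoly_comp_mod comp_polyM in_qpolyM.
Qed.

HB.instance Definition _ t :=
  GRing.isLinear.Build R (trunc R r) (trunc R r) _ (scale_eps t)
    (scale_eps_linear t).
HB.instance Definition _ t :=
  GRing.isMonoidMorphism.Build (trunc R r) (trunc R r) (scale_eps t)
    (scale_eps_monoid t).

End ScaleEps.

(* T_r M = Hom_alg(C^oo(M), A_r). *)
Record higher_tangent (R : realType) (n : nat) (M : charted_space R n)
    (r : nat) := HigherTangent {
  ht_mor :> {rmorphism Cinfty M -> trunc R r};
  ht_scalable : scalable ht_mor
}.

HB.instance Definition _ (R : realType) n (M : charted_space R n) r :=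
  gen_eqMixin (higher_tangent M r).
HB.instance Definition _ (R : realType) n (M : charted_space R n) r :=
  gen_choiceMixin (higher_tangent M r).

(* f^(i)(u) = u_i(f) *)
Definition hcoef (R : realType) (n : nat) (M : charted_space R n) (r : nat)
    (f : Cinfty M) (i : nat) (u : higher_tangent M r) : R :=
  (u f : {poly R})`_i.

Definition hcoefs (R : realType) (n : nat) (M : charted_space R n) (r : nat)
    (u : higher_tangent M r) :
    prod_topology (fun _ : Cinfty M * 'I_r.+1 => (R : topologicalType)) :=
  fun fi => hcoef fi.1 fi.2 u.

(* The coarsest topology for which all f^(i) are continuous. *)
HB.instance Definition _ (R : realType) n (M : charted_space R n) r :=
  Topological.copy (higher_tangent M r) (initial_topology (@hcoefs R n M r)).

Definition base_point (R : realType) (n : nat) (M : charted_space R n)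
    (r : nat) (u : higher_tangent M r) (x : M) : Prop :=
  forall f : Cinfty M, hcoef f 0 u = f x.

(* The smooth structure of T_r M: local coordinates x_1, ..., x_n on U, chosen
   to be restrictions of global functions, give the coordinates x_a^(i) on the
   part of T_r M over U. *)
Definition T_charts (R : realType) (n : nat) (M : charted_space R n)
    (r : nat) : set (chart R (higher_tangent M r) (n * r.+1)) :=
  [set C | exists (c : chart R M n) (x : 'I_n -> Cinfty M),
     [/\ smooth_chart c,
         forall y a, chart_dom c y -> c y ord0 a = x a y,
         chart_dom C = [set u | exists2 y, chart_dom c y & base_point u y] &
         forall u, chart_dom C u ->
           C u = mxvec (\matrix_(a < n, i < r.+1) hcoef (x a) i u)]].

Definition T_ (R : realType) (n : nat) (M : charted_space R n) (r : nat) :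
  charted_space R (n * r.+1) := ChartedSpace (@T_charts R n M r).

Section Actions.
Variables (R : realType) (n : nat) (M : charted_space R n) (r : nat).

Fact Lambda_act_scalable (Psi : Lambda R r) (u : T_ M r) :
  scalable (Psi \o ht_mor u).
Proof. by move=> a f /=; rewrite ht_scalable linearZ. Qed.

Definition Lambda_act (Psi : Lambda R r) (u : T_ M r) : T_ M r :=
  HigherTangent (Lambda_act_scalable Psi u).

Definition kappa (t : R) (u : T_ M r) : T_ M r := Lambda_act (scale_eps t) u.

Definition zero_fun (x : M) (f : Cinfty M) : trunc R r := (f x)%:A.

Fact zero_fun_zmod x : zmod_morphism (zero_fun x).
Proof. by move=> f g; rewrite /zero_fun scalerBl. Qed.

Fact zero_fun_monoid x : monoid_morphism (zero_fun x).
Proof.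
split; first by rewrite /zero_fun scale1r.
by move=> f g; rewrite /zero_fun -scalerAl mul1r scalerA.
Qed.

HB.instance Definition _ x := GRing.isZmodMorphism.Build (Cinfty M) (trunc R r)
  (zero_fun x) (zero_fun_zmod x).
HB.instance Definition _ x := GRing.isMonoidMorphism.Build (Cinfty M)
  (trunc R r) (zero_fun x) (zero_fun_monoid x).

Fact zero_fun_scalable x : scalable (zero_fun x).
Proof. by move=> a f; rewrite /zero_fun scalerA. Qed.

(* The inclusion M -> T_r M as the zero section. *)
Definition zero_section (x : M) : T_ M r :=
  HigherTangent (zero_fun_scalable x).

(* V is the value at x (in the zero section) of X^(-i), for X a vector field
   with X_x = v: indeed (X f)^(l-i) vanishes on the zero section unless l = i,
   when it restricts to X f. The function g is f^(l) as an element of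
   C^oo(T_r M). *)
Definition is_lift (x : M) (v : Cinfty M -> R) (i : nat)
    (V : Cinfty (T_ M r) -> R) : Prop :=
  [/\ tangent_space x v,
      tangent_space (zero_section x) V &
      forall (f : Cinfty M) (l : nat) (g : Cinfty (T_ M r)), (l <= r)%N ->
        (forall u, g u = hcoef f l u) -> V g = if l == i then v f else 0].

(* V corresponds to (v_0, ..., v_r) under T(T_r M)|_M = TM^(r+1). *)
Definition has_components (x : M) (V : Cinfty (T_ M r) -> R)
    (v : 'I_r.+1 -> Cinfty M -> R) : Prop :=
  exists W : 'I_r.+1 -> Cinfty (T_ M r) -> R,
    (forall i, is_lift x (v i) i (W i)) /\ V = \sum_(i < r.+1) W i.

(* An (R, .)-invariant submanifold of T_r M with base N. *)
Definition graded_subbundle (S : set (T_ M r)) (N : set M) : Prop :=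
  [/\ is_submanifold S,
      forall t u, S u -> S (kappa t u) &
      kappa 0 @` S = zero_section @` N].

Definition Lambda_invariant (S : set (T_ M r)) : Prop :=
  forall (Psi : Lambda R r) u, S u -> S (Lambda_act Psi u).

(* The image in (T_r M)_lin|_x = (T_x M)^r of the tangent space of S at x;
   component i : 'I_r is in degree -(i+1). *)
Definition lin_fiber (S : set (T_ M r)) (x : M) :
    set ('I_r -> Cinfty M -> R) :=
  [set v | exists V (v0 : Cinfty M -> R),
     tangent_subspace S (zero_section x) V /\
     has_components x V
       (fun i => if unlift ord0 i is Some j then v j else v0)].

(* The fibre at x of S_lin^{-i}, as a subset of (T_r M)_lin^{-i}|_x = T_x M: the
   vectors v whose lift v^(-i) agrees, modulo vectors tangent to the zero
   section, with some V tangent to S such that nu(kappa_t) multiplies by t^i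
   the class of V modulo vectors tangent to kappa_0(S). *)
Definition lin_degree (S : set (T_ M r)) (i : nat) (x : M) :
    set (Cinfty M -> R) :=
  [set v | exists V L,
     [/\ tangent_subspace S (zero_section x) V,
         (forall t V', tangent_space (zero_section x) V' ->
            pushforward (kappa t) V V' ->
            tangent_subspace (kappa 0 @` S) (zero_section x)
              (fun f => V' f - t ^+ i * V f)),
         is_lift x v i L &
         tangent_subspace (range zero_section) (zero_section x)
           (fun f => V f - L f)]].

End Actions.

Definition Qset (R : realType) (n : nat) (M : charted_space R n) (r : nat)
    (W : weighting M r) : set (T_ M r) :=
  [set u | forall (f : Cinfty M) i j, (j < i)%N -> (i <= r)%N ->
             wfilt W i setT f -> hcoef f j u = 0].

(* Main.v *)
Require Import Defs.
From HB Require Import structures.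
From mathcomp Require Import all_boot all_order all_algebra.
From mathcomp Require Import all_classical all_reals all_analysis.
From mathcomp Require Import fingroup perm ring lra.

(* In weighted coordinates x_1, ..., x_n a hom u lies in Q iff x_a^(j)(u) = 0 for
   all a and j < w_a, since filtration degree is at most the order in eps of
   the image under u. So Q is a coordinate subspace in the charts x_a^(j) of
   T_r M, which gives (a) and, reading off tangent spaces along the zero section
   in the same coordinates, (b). That T_r M is covered by such charts rests on
   Milnor's exercise: every character of C^oo(M) is an evaluation.

   For (c), let h vanish to order i on the jets in Q and let w_b > 0. Setting
   x_b to 0 preserves this property, so the quotient g in
   h - h|_(x_b = 0) = x_b g satisfies the same condition with i - w_b: where the
   leading coefficient x_b^(w_b) does not vanish one can divide, and such jets
   are dense. Induction on i, applied to the coordinates of positive weight in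
   turn, puts h in the i-th ideal. *)

Set Implicit Arguments.
Unset Strict Implicit.
Unset Printing Implicit Defensive.

Import Order.TTheory GRing.Theory Num.Theory.
Import numFieldNormedType.Exports.
Local Open Scope classical_set_scope.
Local Open Scope ring_scope.

(** * Calculus on row vectors *)

(** Smoothness is a statement about iterated directional derivatives, so linearity in the direction,
    the chain rule and division by a coordinate are all derived from one-variable calculus along
    lines. Points of T_r M are homomorphisms on global functions; local coordinates therefore have
    to be cut off to global functions, and every local argument passes through bumps. The
    coefficient f^(i) is expressed in coordinates by iterating one derivation on jet space rather
    than by expanding f along a curve: smoothness is then immediate, and the Leibniz rule says that
    taking jets is multiplicative, which produces the points of T_r M with prescribed coordinates.
    In (c) the bound i <= r keeps all coefficients met in the division below the truncation. Points
    off N carry no jet of Q, so (c) needs a separate argument there. *)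

Section SmoothCalculus.
Variables (R : realType) (d : nat).
Implicit Types (U V : set 'rV[R]_d) (f g : 'rV[R]_d -> R) (x y v : 'rV[R]_d).

Lemma Ck_mono k U V f : V `<=` U -> Ck k U f -> Ck k V f.
Proof.
move=> VU; elim: k f => [|k IH] f [fc]; first by split=> // x /VU/fc.
move=> [fd fD]; split; first by move=> x /VU/fc.
by split=> [x v /VU/fd//|v]; exact: IH (fD v).
Qed.

Lemma Ck_local k U f :
  (forall x, U x -> exists2 V, V x & Ck k V f) -> Ck k U f.
Proof.
elim: k f => [|k IH] f H.
  by split=> // x /H[V Vx [+ _]]; exact.
split; first by move=> x /H[V Vx [+ _]]; exact.
split=> [x v /H[V Vx [_ [+ _]]]|v]; first exact.
by apply: IH => x /H[V Vx [_ [_ DV]]]; exists V => //; exact: DV.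
Qed.

Lemma smooth_mono U V f : V `<=` U -> smooth_rV U f -> smooth_rV V f.
Proof. by move=> VU sf k; exact: Ck_mono (sf k). Qed.

Lemma smooth_local U f :
  (forall x, U x -> exists2 V, V x & smooth_rV V f) -> smooth_rV U f.
Proof. by move=> H k; apply: Ck_local => x /H[V Vx sV]; exists V. Qed.

Lemma smooth_ext U f g : open U ->
  (forall x, U x -> f x = g x) -> smooth_rV U f -> smooth_rV U g.
Proof. by move=> Uo fg sf k; exact: Ck_ext (sf k). Qed.

Lemma smooth_cst U (a : R) : open U -> smooth_rV U (cst a).
Proof. by move=> Uo k; exact: Ck_cst. Qed.

Lemma smoothD U f g : open U ->
  smooth_rV U f -> smooth_rV U g -> smooth_rV U (fun x => f x + g x).
Proof. by move=> Uo sf sg k; exact: (CkD Uo (sf k) (sg k)). Qed.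

Lemma smoothM U f g : open U ->
  smooth_rV U f -> smooth_rV U g -> smooth_rV U (fun x => f x * g x).
Proof. by move=> Uo sf sg k; exact: (CkM Uo (sf k) (sg k)). Qed.

Lemma smoothZ U (a : R) f : open U ->
  smooth_rV U f -> smooth_rV U (fun x => a * f x).
Proof. by move=> Uo sf; apply: smoothM => //; exact: smooth_cst. Qed.

Lemma smoothN U f : open U -> smooth_rV U f -> smooth_rV U (fun x => - f x).
Proof.
move=> Uo sf; apply: (smooth_ext Uo _ (smoothZ (-1) Uo sf)) => x _.
by rewrite mulN1r.
Qed.

Lemma smoothB U f g : open U ->
  smooth_rV U f -> smooth_rV U g -> smooth_rV U (fun x => f x - g x).
Proof. by move=> Uo sf sg; apply: smoothD => //; exact: smoothN. Qed.

Lemma smoothX U f m : open U -> smooth_rV U f ->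
  smooth_rV U (fun x => f x ^+ m).
Proof.
move=> Uo sf; elim: m => [|m IH]; first exact: (smooth_cst 1).
apply: (smooth_ext Uo _ (smoothM Uo sf IH)) => x _.
by rewrite exprS.
Qed.

Lemma smooth_sum U (I : Type) (s : seq I) (P : pred I) (F : I -> 'rV[R]_d -> R) :
  open U -> (forall i, P i -> smooth_rV U (F i)) ->
  smooth_rV U (fun x => \sum_(i <- s | P i) F i x).
Proof.
move=> Uo sF; elim: s => [|i s IH].
  apply: (smooth_ext Uo _ (smooth_cst 0 Uo)) => x _; by rewrite big_nil.
case Pi : (P i).
  apply: (smooth_ext Uo _ (smoothD Uo (sF i Pi) IH)) => x _.
  by rewrite big_cons Pi.
by apply: (smooth_ext Uo _ IH) => x _; rewrite big_cons Pi.
Qed.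

Lemma smooth_D U f v : smooth_rV U f -> smooth_rV U ('D_v f).
Proof. by move=> sf k; case: (sf k.+1) => _ [_]; exact. Qed.

Lemma smooth_cont U f x : smooth_rV U f -> U x -> {for x, continuous f}.
Proof. by move=> sf Ux; case: (sf 0%N) => + _; apply. Qed.

Lemma smooth_derivable U f x v : smooth_rV U f -> U x -> derivable f x v.
Proof. by move=> sf Ux; case: (sf 1%N) => _ [+ _]; apply. Qed.

Lemma is_derive_coord (j : 'I_d) x v :
  is_derive x v (fun y : 'rV[R]_d => y ord0 j) (v ord0 j).
Proof.
have C : (fun h : R => h^-1 *: ((((fun y : 'rV[R]_d => y ord0 j) \o shift x) (h *: v)
    - x ord0 j : R))) @ 0^' --> v ord0 j.
  have H : (fun=> v ord0 j) @ (0 : R)^' --> v ord0 j by exact: cvg_cst.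
  apply: cvg_trans H.
  apply: near_eq_cvg; near=> h; rewrite /= !mxE addrK [RHS]mulrA mulVf ?mul1r//.
  by near: h; exact: nbhs_dnbhs_neq.
apply: DeriveDef; first by apply/cvg_ex; exists (v ord0 j).
exact/cvg_lim.
Unshelve. all: by end_near. Qed.

Lemma smooth_coord U (j : 'I_d) : open U -> smooth_rV U (fun x => x ord0 j).
Proof.
move=> Uo [|k]; first by split=> // x _; exact: coord_continuous.
split; first by move=> x _; exact: coord_continuous.
have D v x : 'D_v (fun x0 : 'rV[R]_d => x0 ord0 j) x = v ord0 j.
  by apply: derive_val; exact: is_derive_coord.
split=> [x v _|v]; first by case: (is_derive_coord j x v).
by apply: Ck_ext (Ck_cst k (v ord0 j) Uo) => // x _; rewrite D.
Qed.

(** The derivative of 1/f is -Df times two factors 1/f, so class C^k for 1/f, together with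
    smoothness of f, gives class C^(k+1). *)
Lemma smoothV U f : open U -> (forall x, U x -> f x != 0) ->
  smooth_rV U f -> smooth_rV U (fun x => (f x)^-1).
Proof.
move=> Uo f0 sf; elim=> [|k IH].
  by split=> // x Ux; exact: cvgV (f0 x Ux) (smooth_cont sf Ux).
split; first by move=> x Ux; exact: cvgV (f0 x Ux) (smooth_cont sf Ux).
split=> [x v Ux|v].
  by apply: derivableV; [exact: f0|exact: smooth_derivable sf Ux].
have sDf := smooth_D v sf.
apply: (@Ck_ext _ _ _ _ (cst (-1) * ('D_v f * ((fun x => (f x)^-1) *
   (fun x => (f x)^-1))))) => // [x Ux|].
  rewrite deriveV; [|exact: f0|exact: smooth_derivable sf Ux].
  have -> : forall a b : 'rV[R]_d -> R, (a * b) x = a x * b x by [].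
  rewrite /= -exprVn expr2 mulNr mul1r scaleNr.
  by congr (- _); rewrite [RHS]mulrC.
by apply: CkM (Ck_cst _ _ _) _ => //; apply: CkM (sDf k) _ => //; exact: CkM.
Qed.

(** The bridge to one variable: through it the mean value theorem and the fundamental theorem of
    calculus on R apply along lines. *)
Lemma is_derive_line f x v (t : R) : derivable f (t *: v + x) v ->
  is_derive t 1 (fun s : R => f (s *: v + x)) ('D_v f (t *: v + x)).
Proof.
have E : (fun h : R => h^-1 *: ((f \o shift (t *: v + x)) (h *: v) -
      f (t *: v + x))) = (fun h : R => h^-1 *:
      (((fun s : R => f (s *: v + x)) \o shift t) (h *: 1) - f (t *: v + x))).
  by apply/funext => h /=; rewrite addrA -scalerDl [h *: 1]mulr1.
move=> dv; apply: DeriveDef; first by rewrite /derivable -E.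
by rewrite /derive -E.
Qed.

End SmoothCalculus.

(** * Integrals over the unit interval *)

Section UnitIntegral.
Variable R : realType.
Implicit Types (phi psi : R -> R).

(** Two-sided continuity is asked at 0 and 1 too: the integrands below extend beyond the interval,
    and continuity of composites is then obtained pointwise. *)
Definition unit_cont phi :=
  forall s, 0 <= s <= 1 -> {for s, continuous phi}.

Definition unit_int phi : R := \int[lebesgue_measure]_(s in `[0, 1]) phi s.

Lemma unit_cont_within phi : unit_cont phi ->
  {within `[0, 1], continuous phi}.
Proof.
move=> cphi; apply: continuous_in_subspaceT => s /set_mem /=.
by rewrite in_itv /=; exact: cphi.
Qed.

Lemma unit_cont_integrable phi : unit_cont phi ->
  lebesgue_measure.-integrable `[0, 1] (EFin \o phi).
Proof.
move=> cphi; apply: continuous_compact_integrable; first exact: segment_compact.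
exact: unit_cont_within.
Qed.

Lemma unit_intB phi psi : unit_cont phi -> unit_cont psi ->
  unit_int (fun s => phi s - psi s) = unit_int phi - unit_int psi.
Proof.
by move=> cphi cpsi; apply: RintegralB => //; exact: unit_cont_integrable.
Qed.

Lemma unit_intZ phi (a : R) : unit_cont phi ->
  unit_int (fun s => a * phi s) = a * unit_int phi.
Proof.
by move=> cphi; apply: RintegralZl => //; exact: unit_cont_integrable.
Qed.

Lemma unit_int_le phi (e : R) : unit_cont phi ->
  (forall s, 0 <= s <= 1 -> `|phi s| <= e) -> `|unit_int phi| <= e.
Proof.
move=> cphi phie.
have ccst (a : R) : unit_cont (fun=> a) by move=> s _; exact: cst_continuous.
have cabs : unit_cont (fun s => `|phi s|).
  by move=> s s01; apply: cvg_norm; exact: cphi.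
apply: le_trans (le_normr_Rintegral _ (unit_cont_integrable cphi)) _ => //.
have -> : e = \int[lebesgue_measure]_(s in `[0, 1]) (fun=> e) s.
  have mu01 : fine (lebesgue_measure (`[(0:R), 1]%classic : set R)) = 1.
    by rewrite lebesgue_measure_itv /= lte_fin ltr01 oppr0 addr0.
  by rewrite Rintegral_cst // mu01 mulr1.
apply: le_Rintegral => //; try exact: unit_cont_integrable.
Qed.

Lemma unit_int_FTC phi (dphi : R -> R) :
  (forall s : R, 0 <= s <= 1 -> is_derive s 1 phi (dphi s)) -> unit_cont dphi ->
  unit_int dphi = phi 1 - phi 0.
Proof.
move=> D cd; have cphi : unit_cont phi.
  move=> s s01; apply: differentiable_continuous; apply/derivable1_diffP.
  by case: (D s s01).
rewrite /unit_int /Rintegral (@continuous_FTC2 _ dphi phi) //.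
- exact: unit_cont_within.
- split.
  + move=> x; rewrite in_itv /= => /andP[x0 x1].
    by have [] := D x; rewrite ?(ltW x0) ?(ltW x1).
  + by apply: cvg_at_right_filter; apply: cphi; rewrite lexx ler01.
  + by apply: cvg_at_left_filter; apply: cphi; rewrite lexx ler01.
- move=> x; rewrite in_itv /= => /andP[x0 x1].
  by rewrite derive1E; have [] := D x; rewrite ?(ltW x0) ?(ltW x1).
Qed.

End UnitIntegral.

(** * Mean values and derivatives along lines *)

Section Lines.
Variables (R : realType) (d : nat).
Implicit Types (U V : set 'rV[R]_d) (f g : 'rV[R]_d -> R) (x y v : 'rV[R]_d).

Lemma open_ball_sub U x : open U -> U x -> exists2 e, 0 < e & ball x e `<=` U.
Proof.
by move=> Uo Ux; apply/nbhs_ballP; exact: open_nbhs_nbhs.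
Qed.

Lemma mvt_line f x v (h : R) :
  (forall t : R, `|t| <= `|h| -> derivable f (t *: v + x) v) ->
  exists2 t : R, `|t| <= `|h| & f (h *: v + x) - f x = h * 'D_v f (t *: v + x).
Proof.
move=> df.
have D (t : R) : `|t| <= `|h| ->
    is_derive t 1 (fun s : R => f (s *: v + x)) ('D_v f (t *: v + x)).
  by move=> /df; exact: is_derive_line.
have C (t : R) : `|t| <= `|h| -> {for t, continuous (fun s : R => f (s *: v + x))}.
  move=> /D Dt; apply: differentiable_continuous; apply/derivable1_diffP.
  by case: Dt.
have [h0|h0] := leP 0 h.
  have H (t : R) : t \in `[0, h] -> `|t| <= `|h|.
    by rewrite in_itv /= => /andP[t0 th]; rewrite !ger0_norm.
  have [||c ch E] := @MVT_segment R (fun s : R => f (s *: v + x))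
      (fun t => 'D_v f (t *: v + x)) 0 h h0.
  - by move=> t th; apply/D/H; exact: subset_itv_oo_cc th.
  - by apply: continuous_in_subspaceT => t /set_mem th; exact/C/H.
  exists c; first exact: H.
  by move: E; rewrite scale0r add0r subr0 mulrC.
have H (t : R) : t \in `[h, 0] -> `|t| <= `|h|.
  rewrite in_itv /= => /andP[ht t0].
  by rewrite !ler0_norm ?lerN2 // ltW.
have [||c ch E] := @MVT_segment R (fun s : R => f (s *: v + x))
    (fun t => 'D_v f (t *: v + x)) h 0 (ltW h0).
- by move=> t th; apply/D/H; exact: subset_itv_oo_cc th.
- by apply: continuous_in_subspaceT => t /set_mem th; exact/C/H.
exists c; first exact: H.
move: E; rewrite scale0r add0r sub0r => /(congr1 -%R).
by rewrite opprB => ->; rewrite mulrN opprK mulrC.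
Qed.

Lemma ball_line x v (e : R) : 0 < e ->
  \forall h \near (0 : R), forall t, `|t| <= `|h| -> ball x e (t *: v + x).
Proof.
move=> e0.
have : (fun t : R => t *: v + x) @ (0 : R) --> x.
  have -> : x = 0 *: v + x by rewrite scale0r add0r.
  by apply: cvgD; [apply: cvgZr_tmp; exact: cvg_id|rewrite scale0r add0r; exact: cvg_cst].
move=> /(_ _ (nbhsx_ballx x e e0)) /nbhs_ballP[a /= a0 aH].
apply/nbhs_ballP; exists a => //= h.
rewrite -ball_normE /ball_ /= sub0r normrN => ha t th.
by apply: aH; rewrite -ball_normE /ball_ /= sub0r normrN; exact: le_lt_trans ha.
Qed.

(** The increment along v + a w is taken in two steps, along v and then along w. By the mean value
    theorem the second contributes a times the derivative of f along w at a point close to x, and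
    this derivative is continuous at x. *)
Lemma is_derive_lin U f x v w (a : R) : open U -> Ck 1 U f -> U x ->
  is_derive x (v + a *: w) f ('D_v f x + a * 'D_w f x).
Proof.
move=> Uo [fc [fd fD]] Ux.
have Dwc : {for x, continuous ('D_w f)} by case: (fD w) => + _; apply.
have [e1 e10 e1U] := open_ball_sub Uo Ux.
suff C : (fun h : R => h^-1 *: (f (h *: (v + a *: w) + x) - f x)) @ 0^'
    --> 'D_v f x + a * 'D_w f x.
  by apply: DeriveDef; [apply/cvg_ex; exists ('D_v f x + a * 'D_w f x)|exact/cvg_lim].
pose q1 (h : R) := h^-1 *: (f (h *: v + x) - f x).
pose q2 (h : R) := h^-1 *: (f ((h * a) *: w + (h *: v + x)) - f (h *: v + x)).
have -> : (fun h : R => h^-1 *: (f (h *: (v + a *: w) + x) - f x)) = (fun h => q1 h + q2 h).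
  apply/funext => h; rewrite /q1 /q2 -scalerDr; congr (_ *: _).
  rewrite [RHS]addrC -addrA addKr; congr (f _ - _).
  by rewrite scalerDr scalerA addrA [_ + h *: v]addrC.
apply: cvgD; first exact: fd.
apply/cvgrPdist_le => eps eps0.
have eps1 : 0 < eps / (`|a| + 1) by rewrite divr_gt0 // ltr_wpDl.
have /nbhs_ballP[b /= b0 bH] : \forall y \near x, `|'D_w f x - 'D_w f y| <= eps / (`|a| + 1).
  by move/cvgrPdist_le : Dwc; exact.
(* Two successive steps, each shorter than c, stay in the ball where f is C^1 and in the ball where
   its derivative along w varies little. *)
pose c := Num.min b e1 / 2.
have c0 : 0 < c by rewrite divr_gt0 // lt_min b0.
have ccb : c + c <= b by rewrite -splitr ge_min lexx.
have cce : c + c <= e1 by rewrite -splitr ge_min lexx orbT.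
have N1 := @ball_line x v c c0.
have N2 := @ball_line 0 w c c0.
have N3 : \forall h \near (0 : R)^', forall t : R,
    `|t| <= `|h * a| -> ball 0 c (t *: w + 0).
  have C : (fun h : R => h * a) @ (0 : R) --> 0 * a.
    by apply: cvgM; [exact: cvg_id|exact: cvg_cst].
  rewrite mul0r in C.
  have C' : (fun h : R => h * a) @ (0 : R)^' --> (0 : R).
    exact: cvg_within_filter C.
  exact: (C' _ N2).
near=> h.
have h0 : h != 0 by near: h; exact: nbhs_dnbhs_neq.
have B1 : ball x c (h *: v + x).
  by near: h; apply: cvg_within; apply: filterS N1 => h /(_ h); exact.
have B2 (t : R) : `|t| <= `|h * a| -> ball x (c + c) (t *: w + (h *: v + x)).
  move=> th; apply: ball_triangle B1 _.
  have : ball 0 c (t *: w + 0) by move: t th; near: h; exact: N3.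
  by rewrite addr0 -!ball_normE /ball_ /= sub0r opprD addrCA subrr addr0 normrN.
have [t th E] := @mvt_line f (h *: v + x) w (h * a) (fun t th => fd _ w (e1U _ (le_ball cce (B2 t th)))).
have -> : q2 h = a * 'D_w f (t *: w + (h *: v + x)).
  by rewrite /q2 E /GRing.scale /= -mulrA mulKf.
rewrite -mulrBr normrM.
have /bH H := le_ball ccb (B2 t th).
apply: (@le_trans _ _ (`|a| * (eps / (`|a| + 1)))); first by rewrite ler_wpM2l.
rewrite mulrCA ler_piMr ?(ltW eps0) // ler_pdivrMr ?mul1r ?lerDl //.
Unshelve. all: by end_near. Qed.

Lemma deriveD_dir U f x v w (a : R) : open U -> Ck 1 U f -> U x ->
  'D_(v + a *: w) f x = 'D_v f x + a * 'D_w f x.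
Proof. by move=> Uo sf Ux; case: (is_derive_lin v w a Uo sf Ux). Qed.

Lemma derive_sum_dir U f x v : open U -> Ck 1 U f -> U x ->
  'D_v f x = \sum_(j < d) v ord0 j * 'D_(delta_mx ord0 j) f x.
Proof.
move=> Uo sf Ux; rewrite [in LHS](row_sum_delta v).
elim: (index_enum _) => [|j s IH]; first by rewrite !big_nil derive0.
by rewrite !big_cons addrC (deriveD_dir _ _ _ Uo sf Ux) IH addrC.
Qed.

End Lines.

(** * Division by a coordinate *)

Section Division.
Variables (R : realType) (d : nat).
Implicit Types (f F : 'rV[R]_d -> R) (x y v : 'rV[R]_d).

Lemma ball_rVP (p y : 'rV[R]_d) (e : R) :
  ball p e y <-> 0 < e /\ forall j, `|p ord0 j - y ord0 j| < e.
Proof.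
split=> [[e0 py]|[e0 py]]; split=> // j; first exact: (py ord0 j).
by move=> k; rewrite (ord1 j); exact: py.
Qed.

Lemma cvg_comp_for (T : Type) (FF : set_system T) (FFF : Filter FF)
    (g : T -> 'rV[R]_d) x F :
  {for x, continuous F} -> g @ FF --> x -> (fun t => F (g t)) @ FF --> F x.
Proof. by move=> Fx gx; exact: (cvg_comp g F gx Fx). Qed.

Lemma continuous_for_le F y :
  (forall eps : R, 0 < eps -> \forall z \near y, `|F y - F z| <= eps) ->
  {for y, continuous F}.
Proof. exact: (@cvgrPdist_le R R^o _ (nbhs y) _ F (F y)).2. Qed.

Variables (p : 'rV[R]_d) (e : R) (b : 'I_d).
Let B := ball p e.

(** The straight-line retraction onto the hyperplane where the b-th coordinate is that of p, from
    the identity at s = 0 to the projection at s = 1. *)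
Definition retr (s : R) y : 'rV[R]_d :=
  y - (s * (y ord0 b - p ord0 b)) *: delta_mx ord0 b.

Lemma retrE s y j : retr s y ord0 j =
  if j == b then y ord0 b - s * (y ord0 b - p ord0 b) else y ord0 j.
Proof.
rewrite !mxE eqxx /=; case: eqP => [->|_]; first by rewrite mulr1.
by rewrite mulr0 subr0.
Qed.

Lemma retr0 y : retr 0 y = y.
Proof. by rewrite /retr mul0r scale0r subr0. Qed.

Lemma retr_ball (s : R) y : 0 <= s <= 1 -> B y -> B (retr s y).
Proof.
move=> /andP[s0 s1] /ball_rVP[e0 py]; apply/ball_rVP; split=> // j.
rewrite retrE; case: eqP => // ->.
have -> : p ord0 b - (y ord0 b - s * (y ord0 b - p ord0 b)) =
  (1 - s) * (p ord0 b - y ord0 b) by ring.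
rewrite normrM; apply: le_lt_trans (py b); rewrite ler_piMl // ger0_norm; lra.
Qed.

Lemma retr_line (s h : R) y v :
  retr s (h *: v + y) = h *: (v - (s * v ord0 b) *: delta_mx ord0 b) + retr s y.
Proof.
by apply/rowP => j; rewrite !mxE; ring.
Qed.

Lemma retr_continuous (s : R) y :
  (fun z : R * 'rV[R]_d => retr z.1 z.2) @ (s, y) --> retr s y.
Proof.
have C1 : (fun z : R * 'rV[R]_d => z.2) @ (s, y) --> y by exact: cvg_snd.
have C0 : (fun z : R * 'rV[R]_d => z.1) @ (s, y) --> s by exact: cvg_fst.
have C2 : (fun z : R * 'rV[R]_d => z.2 ord0 b) @ (s, y) --> y ord0 b.
  apply: (@continuous_cvg _ _ _ _ _ snd (fun w : 'rV[R]_d => w ord0 b)) C1.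
  exact: coord_continuous.
apply: cvgB => //; apply: cvgZ; last exact: cvg_cst.
by apply: cvgM => //; apply: cvgB => //; exact: cvg_cst.
Qed.

(** Uniformity in s, from compactness of [0,1]: this is what allows limits to be taken under the
    integral sign. *)
Lemma retr_near F y (eps : R) : (forall x, B x -> {for x, continuous F}) ->
  B y -> 0 < eps ->
  \forall z \near y, forall s, 0 <= s <= 1 ->
    `|F (retr s z) - F (retr s y)| <= eps.
Proof.
move=> Fc By eps0.
have K : compact (`[0, 1]%classic : set R) by exact: segment_compact.
move/compact_near_coveringP : K => /(_ 'rV[R]_d (nbhs y)
  (fun z s => `|F (retr s z) - F (retr s y)| <= eps) _).
move=> HK; apply: (filterS _ (HK _)) => [z Hz s s01|s].
  by apply: Hz; rewrite /= in_itv.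
rewrite /= in_itv /= => s01.
  have Fs := Fc _ (retr_ball s01 By).
  have e20 : 0 < eps / 2 by rewrite divr_gt0.
  have C1 : (fun z : R * 'rV[R]_d => F (retr z.1 z.2)) @ (s, y) --> F (retr s y).
    by apply: cvg_comp_for Fs _; exact: retr_continuous.
  have C2 : (fun z : R * 'rV[R]_d => F (retr z.1 y)) @ (s, y) --> F (retr s y).
    apply: cvg_comp_for Fs _.
    apply: cvgB; first exact: cvg_cst.
    apply: cvgZ; last exact: cvg_cst.
    by apply: cvgM; [exact: cvg_fst|exact: cvg_cst].
  have /cvgrPdist_le /(_ _ e20) N1 := C1.
  have /cvgrPdist_le /(_ _ e20) N2 := C2.
  apply: (filterS _ (filterI N1 N2)) => -[z1 z2] /= [H1 H2].
  rewrite (splitr eps) -(subrKA (F (retr s y))).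
  apply: le_trans (ler_normD _ _) _; apply: lerD => //.
  by rewrite distrC.
Qed.

(** For k = 0 and F a partial derivative this is the Hadamard quotient. The powers of s appear
    because [retr s] scales the b-th component of a direction by 1 - s; with them the family is
    closed under differentiation. *)
Definition retr_int (k : nat) F y : R :=
  unit_int (fun s => s ^+ k * F (retr s y)).

Lemma retr_int_cont0 k F y : (forall x, B x -> {for x, continuous F}) -> B y ->
  unit_cont (fun s => s ^+ k * F (retr s y)).
Proof.
move=> Fc By s s01; apply: cvgM; first exact: exprn_continuous.
apply: cvg_comp_for (Fc _ (retr_ball s01 By)) _.
apply: cvgB; first exact: cvg_cst.
apply: cvgZ; last exact: cvg_cst.
by apply: cvgM; [exact: cvg_id|exact: cvg_cst].
Qed.

Lemma ler_pexpM (s x : R) k (eps : R) : 0 <= s <= 1 -> `|x| <= eps ->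
  `|s ^+ k * x| <= eps.
Proof.
move=> /andP[s0 s1] xe; rewrite normrM normrX ger0_norm //.
apply: le_trans xe; rewrite ler_piMl // exprn_ile1 //.
Qed.

Lemma retr_int_continuous k F y : (forall x, B x -> {for x, continuous F}) ->
  B y -> {for y, continuous (retr_int k F)}.
Proof.
move=> Fc By; apply: continuous_for_le => eps eps0.
have H := retr_near Fc By eps0.
have HB : \forall z \near y, B z.
  by apply: open_nbhs_nbhs; split=> //; exact: ball_open.
apply: (filterS _ (filterI HB H)) => z [Bz Hz].
rewrite /retr_int -unit_intB; try exact: retr_int_cont0.
apply: unit_int_le => [s s01|s s01].
  by apply: cvgB; exact: retr_int_cont0.
by rewrite -mulrBr ler_pexpM // distrC; exact: Hz.
Qed.

(** Differentiation under the integral sign. For each s the mean value theorem rewrites the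
    difference quotient as a derivative at a nearby point, and [retr_near] bounds its distance to
    the limit uniformly in s. *)
Lemma is_derive_retr_int k F y v : Ck 1 B F -> B y ->
  is_derive y v (retr_int k F)
    (retr_int k ('D_v F) y -
     v ord0 b * retr_int k.+1 ('D_(delta_mx ord0 b) F) y).
Proof.
move=> F1 By; case: (F1) => Fc [Fd FD].
have Dc w x : B x -> {for x, continuous ('D_w F)} by case: (FD w) => + _; apply.
have Bo : open B by exact: ball_open.
pose L := retr_int k ('D_v F) y -
     v ord0 b * retr_int k.+1 ('D_(delta_mx ord0 b) F) y.
suff C : (fun h : R => h^-1 *: (retr_int k F (h *: v + y) - retr_int k F y)) @ 0^'
    --> L.
  by apply: DeriveDef; [apply/cvg_ex; exists L|exact/cvg_lim].
apply/cvgrPdist_le => eps eps0.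
(* Half of eps goes to each of the two derivatives; the one along b carries the factor v_b, and
   adding 1 keeps c positive when v_b = 0. *)
pose c := `|v ord0 b| + 1.
have c0 : 0 < c by rewrite ltr_wpDl.
have e2 : 0 < eps / 2 by rewrite divr_gt0.
have e3 : 0 < eps / 2 / c by rewrite divr_gt0.
have /nbhs_ballP[a1 /= a10 H1] := retr_near (Dc v) By e2.
have /nbhs_ballP[a2 /= a20 H2] := retr_near (Dc (delta_mx ord0 b)) By e3.
have [a3 a30 H3] := open_ball_sub Bo By.
have N1 := ball_line y v a10.
have N2 := ball_line y v a20.
have N3 := ball_line y v a30.
have N : \forall h \near (0 : R)^', h != 0 /\ forall t : R, `|t| <= `|h| ->
    [/\ ball y a1 (t *: v + y), ball y a2 (t *: v + y) & ball y a3 (t *: v + y)].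
  near=> h; split; first by near: h; exact: nbhs_dnbhs_neq.
  move=> t th; split; move: t th; near: h; exact: cvg_within.
apply: filterS N => h [h0 Nh].
have By' : B (h *: v + y) by apply: H3; have [] := Nh h.
set z := h *: v + y in By' *.
have cD w j : unit_cont (fun s => s ^+ j * 'D_w F (retr s y)).
  exact: retr_int_cont0 (Dc w) By.
have cF j u : B u -> unit_cont (fun s => s ^+ j * F (retr s u)).
  by move=> Bu; apply: retr_int_cont0.
have cB (f g : R -> R) : unit_cont f -> unit_cont g -> unit_cont (fun s => f s - g s).
  by move=> cf cg s s01; apply: cvgB; [exact: cf|exact: cg].
have cZ (f : R -> R) a : unit_cont f -> unit_cont (fun s => a * f s).
  by move=> cf s s01; apply: cvgM; [exact: cvg_cst|exact: cf].
have cFy := cF k _ By; have cFz := cF k _ By'.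
rewrite /L /retr_int /GRing.scale /= -unit_intB //.
rewrite -!unit_intZ //; last exact: cB.
rewrite -!unit_intB //; try by repeat first [exact: cD|exact: cFy|exact: cFz|
  apply: (cB)|apply: (cZ)].
apply: unit_int_le => [|s s01].
  apply: (cB); first by apply: (cB); [exact: cD|apply: (cZ); exact: cD].
  by apply: (cZ); exact: (cB).
rewrite -mulrBr /z retr_line.
set vs := v - _.
have Dl (t : R) : `|t| <= `|h| -> B (t *: vs + retr s y).
  by move=> th; rewrite -retr_line; apply: retr_ball => //; apply: H3; have [] := Nh t th.
have [t th ->] := @mvt_line _ _ F (retr s y) vs h (fun t th => Fd _ vs (Dl t th)).
have E u : B u -> 'D_vs F u = 'D_v F u - s * v ord0 b * 'D_(delta_mx ord0 b) F u.
  by move=> Bu; rewrite /vs -scaleNr (deriveD_dir _ _ _ Bo F1 Bu) mulNr.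
rewrite E; last exact: Dl.
have -> : t *: vs + retr s y = retr s (t *: v + y) by rewrite retr_line.
have [/H1 /(_ s s01) K1 /H2 /(_ s s01) K2 _] := Nh t th.
set X := 'D_v F (retr s y) in K1 *.
set X' := 'D_v F _ in K1 *.
set Y := 'D_(delta_mx ord0 b) F (retr s y) in K2 *.
set Y' := 'D_(delta_mx ord0 b) F _ in K2 *.
have -> : s ^+ k * X - v ord0 b * (s ^+ k.+1 * Y) -
  h^-1 * (s ^+ k * (h * (X' - s * v ord0 b * Y'))) =
  s ^+ k * ((X - X') - v ord0 b * (s ^+ 1 * (Y - Y'))).
  rewrite [h^-1 * _](_ : _ = s ^+ k * (X' - s * v ord0 b * Y')).
    by rewrite exprS expr1; ring.
  by rewrite mulrCA mulKf.
apply: ler_pexpM => //.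
apply: le_trans (ler_normB _ _) _; rewrite (splitr eps); apply: lerD.
  by rewrite distrC.
rewrite normrM; apply: (@le_trans _ _ (`|v ord0 b| * (eps / 2 / c))).
  by rewrite ler_wpM2l // ler_pexpM // distrC.
rewrite mulrCA ler_piMr ?(ltW e2) // ler_pdivrMr // mul1r lerDl //.
Unshelve. all: by end_near. Qed.

Lemma smooth_retr_int k F : smooth_rV B F -> smooth_rV B (retr_int k F).
Proof.
have Bo : open B by exact: ball_open.
move=> sF m; elim: m k F sF => [|m IH] k F sF.
  by split=> // x Bx; apply: retr_int_continuous => // z; exact: smooth_cont.
split; first by move=> x Bx; apply: retr_int_continuous => // z; exact: smooth_cont.
have D x v := @is_derive_retr_int k F x v (sF 1%N).
split=> [x v /D|v]; first by case/(_ v).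
have sDv := smooth_D v sF; have sDb := smooth_D (delta_mx ord0 b) sF.
apply: (@Ck_ext _ _ _ _ (retr_int k ('D_v F) +
  cst (- v ord0 b) * retr_int k.+1 ('D_(delta_mx ord0 b) F))) => // [x Bx|].
  have [_ ->] := D x v Bx; rewrite -mulNr.
  by [].
by apply: CkD => //; [exact: IH|apply: CkM => //; [exact: Ck_cst|exact: IH]].
Qed.

(** The fundamental theorem of calculus along s |-> [retr s y], whose velocity is -(y_b - p_b) times
    the b-th basis vector. *)
Lemma retr_intE F y : Ck 1 B F -> B y ->
  F y - F (retr 1 y) =
  (y ord0 b - p ord0 b) * retr_int 0 ('D_(delta_mx ord0 b) F) y.
Proof.
move=> F1 By; case: (F1) => Fc [Fd FD].
have Dc w x : B x -> {for x, continuous ('D_w F)} by case: (FD w) => + _; apply.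
have Bo : open B by exact: ball_open.
set c := y ord0 b - p ord0 b.
have cD : unit_cont (fun s => s ^+ 0 * 'D_(delta_mx ord0 b) F (retr s y)).
  exact: (@retr_int_cont0 0 _ y (Dc (delta_mx ord0 b)) By).
have E s : retr s y = s *: ((- c) *: delta_mx ord0 b) + y.
  by rewrite /retr scalerA mulrN scaleNr addrC.
have := @unit_int_FTC R (fun s => F (retr s y))
  (fun s => (- c) * (s ^+ 0 * 'D_(delta_mx ord0 b) F (retr s y))).
rewrite unit_intZ // -/(retr_int 0 _ y) retr0 => H.
apply: oppr_inj; rewrite opprB -mulNr; apply/esym; apply: H.
  move=> s s01; have Bs := retr_ball s01 By.
  have -> : (fun s => F (retr s y)) = (fun s => F (s *: ((- c) *: delta_mx ord0 b) + y)).
    by apply/funext => u; rewrite E.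
  have [] := @is_derive_line _ _ F y ((- c) *: delta_mx ord0 b) s.
    by rewrite -E; exact: Fd.
  move=> D1 D2; apply: DeriveDef => //; rewrite D2 -E expr0 mul1r.
  have := deriveD_dir 0 (delta_mx ord0 b) (- c) Bo F1 Bs.
  by rewrite add0r derive0 add0r.
by move=> s s01; apply: cvgM; [exact: cvg_cst|exact: cD].
Qed.

End Division.

Section RowContinuity.
Variables (R : realType) (d : nat).

Lemma cvg_rV (T : Type) (FF : set_system T) (FFF : Filter FF)
    (g : T -> 'rV[R]_d) (x : 'rV[R]_d) :
  (forall j, (fun t => g t ord0 j) @ FF --> x ord0 j) -> g @ FF --> x.
Proof.
move=> gx; apply/cvgrPdist_le => e e0.
have : forall j, \forall t \near FF, `|x ord0 j - g t ord0 j| <= e.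
  by move=> j; move/cvgrPdist_le : (gx j); exact.
move=> /filter_forall; apply: filterS => t Ht.
rewrite [leLHS]mx_normrE; apply/bigmax_leP; split; first exact: ltW.
by move=> [i j] _; rewrite (ord1 i) /= !mxE; exact: Ht.
Qed.

Lemma continuous_rV (X : topologicalType) (g : X -> 'rV[R]_d) (x : X) :
  (forall j, {for x, continuous (fun t => g t ord0 j)}) ->
  {for x, continuous g}.
Proof. by move=> gx; apply: cvg_rV => j; exact: gx. Qed.

End RowContinuity.

(** * Hadamard's lemma and the chain rule *)

Section Hadamard.
Variables (R : realType) (d : nat).
Implicit Types (f F : 'rV[R]_d -> R) (x y v p : 'rV[R]_d).

(* Setting one coordinate to its value at [p] preserves smoothness because, by
   the division formula, it only subtracts a smooth function. *)
Lemma smooth_retr1 p (e : R) b F : smooth_rV (ball p e) F ->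
  smooth_rV (ball p e) (fun y => F (retr p b 1 y)).
Proof.
move=> sF; have Bo : open (ball p e) := ball_open p e.
apply: (@smooth_ext _ _ _ (fun y => F y - (y ord0 b - p ord0 b) *
  retr_int p b 0 ('D_(delta_mx ord0 b) F) y)) => // [y By|].
  by rewrite -(retr_intE _ (sF 1%N) By) subKr.
apply: smoothB => //; apply: smoothM => //.
  by apply: smoothB => //; [exact: smooth_coord|exact: smooth_cst].
by apply: smooth_retr_int; exact: smooth_D.
Qed.

Definition retrs p (s : seq 'I_d) y := foldr (fun b => retr p b 1) y s.

Lemma retrsE p s y j :
  retrs p s y ord0 j = if j \in s then p ord0 j else y ord0 j.
Proof.
elim: s => [//|b s IH]; rewrite /= retrE inE mul1r subKr.
by case: eqP => [->|].
Qed.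

(** Telescoping over the list, one projection at a time; if a coordinate occurs repeatedly, its
    quotients add up. *)
Lemma hadamard_retrs p (e : R) s F : smooth_rV (ball p e) F ->
  exists2 g : 'I_d -> 'rV[R]_d -> R, forall j, smooth_rV (ball p e) (g j) &
  forall y, ball p e y -> F y - F (retrs p s y) =
    \sum_j (y ord0 j - p ord0 j) * g j y.
Proof.
have Bo : open (ball p e) := ball_open p e.
elim: s F => [|b s IH] F sF.
  exists (fun _ => cst 0) => [j|y _]; first exact: smooth_cst.
  by rewrite subrr big1 // => j _; rewrite mulr0.
have [g sg gE] := IH _ (smooth_retr1 b sF).
pose G := retr_int p b 0 ('D_(delta_mx ord0 b) F).
exists (fun j y => g j y + (j == b)%:R * G y) => [j|y By].
  apply: smoothD => //; apply: smoothZ => //.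
  by apply: smooth_retr_int; exact: smooth_D.
rewrite /= -(subrKA (F (retr p b 1 y))) gE // (retr_intE _ (sF 1%N) By).
rewrite addrC [RHS](eq_bigr (fun j => (y ord0 j - p ord0 j) * g j y +
  (y ord0 j - p ord0 j) * ((j == b)%:R * G y))); last by move=> j _; rewrite mulrDr.
rewrite big_split /=; congr (_ + _).
rewrite (bigD1 b) //= eqxx mul1r big1 ?addr0 // => j /negbTE ->.
by rewrite mul0r mulr0.
Qed.

Lemma hadamard p (e : R) F : smooth_rV (ball p e) F ->
  exists2 g : 'I_d -> 'rV[R]_d -> R, forall j, smooth_rV (ball p e) (g j) &
  forall y, ball p e y -> F y - F p = \sum_j (y ord0 j - p ord0 j) * g j y.
Proof.
move=> /(hadamard_retrs (enum 'I_d))[g sg gE]; exists g => // y /gE <-.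
congr (_ - F _); apply/rowP => j.
by rewrite retrsE mem_enum.
Qed.

(** Composed with phi, the Hadamard decomposition of F turns the difference quotient into a sum of
    difference quotients of the components of phi times factors continuous at q. Hence continuity of
    phi and derivability of its components along w suffice. *)
Lemma hadamard_derive m (phi : 'rV[R]_m -> 'rV[R]_d) (q w : 'rV[R]_m)
    (e : R) F (g : 'I_d -> 'rV[R]_d -> R) :
  0 < e ->
  (forall j, {for phi q, continuous (g j)}) ->
  (forall y, ball (phi q) e y ->
     F y - F (phi q) = \sum_j (y ord0 j - phi q ord0 j) * g j y) ->
  {for q, continuous phi} ->
  (forall j, derivable (fun x : 'rV[R]_m => phi x ord0 j) q w) ->
  is_derive q w (fun x : 'rV[R]_m => F (phi x))
    (\sum_j 'D_w (fun x : 'rV[R]_m => phi x ord0 j) q * g j (phi q)).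
Proof.
move=> e0 cg gE cphi dphi; set L := \sum_j _.
suff C : (fun h : R => h^-1 *: (F (phi (h *: w + q)) - F (phi q))) @ 0^' --> L.
  by apply: DeriveDef; [apply/cvg_ex; exists L|exact/cvg_lim].
have Cq : (fun h : R => h *: w + q) @ (0 : R)^' --> q.
  have C : (fun h : R => h *: w + q) @ (0 : R) --> 0 *: w + q.
    by apply: cvgD; [apply: cvgZ; [exact: cvg_id|exact: cvg_cst]|exact: cvg_cst].
  by rewrite scale0r add0r in C; exact: cvg_within_filter C.
have Cphi : (fun h : R => phi (h *: w + q)) @ (0 : R)^' --> phi q.
  exact: (cvg_comp _ phi Cq cphi).
have Bphi : \forall h \near (0 : R)^', ball (phi q) e (phi (h *: w + q)).
  exact: (Cphi _ (nbhsx_ballx (phi q) e e0)).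
have S : (fun h : R => \sum_j (h^-1 *: (phi (h *: w + q) ord0 j - phi q ord0 j)) *
    g j (phi (h *: w + q))) @ 0^' --> L.
  rewrite /L; elim: (index_enum _) => [|j s IH].
    have -> : (fun h : R => \sum_(j <- [::])
      (h^-1 *: (phi (h *: w + q) ord0 j - phi q ord0 j)) * g j (phi (h *: w + q)))
      = cst 0 by apply/funext => h; rewrite big_nil.
    by rewrite big_nil; exact: cvg_cst.
  rewrite big_cons.
  under eq_fun do rewrite big_cons.
  apply: cvgD => //; apply: cvgM; first exact: dphi.
  exact: cvg_comp_for (cg j) Cphi.
apply: cvg_trans S; apply: near_eq_cvg.
apply: filterS Bphi => h /gE ->; rewrite scaler_sumr; apply: eq_bigr => j _.
by rewrite scalerAl.
Qed.

End Hadamard.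

Section Composition.
Variables (R : realType).

(** The case phi = id of [hadamard_derive] identifies the Hadamard coefficients at phi q with the
    partial derivatives of F there. *)
Lemma chain_rule (m d : nat) (V : set 'rV[R]_d) (phi : 'rV[R]_m -> 'rV[R]_d)
    (F : 'rV[R]_d -> R) (q w : 'rV[R]_m) :
  open V -> V (phi q) -> smooth_rV V F -> {for q, continuous phi} ->
  (forall j, derivable (fun x : 'rV[R]_m => phi x ord0 j) q w) ->
  is_derive q w (fun x : 'rV[R]_m => F (phi x))
    (\sum_j 'D_w (fun x : 'rV[R]_m => phi x ord0 j) q * 'D_(delta_mx ord0 j) F (phi q)).
Proof.
move=> Vo Vq sF cphi dphi.
have [e e0 eV] := open_ball_sub Vo Vq.
have [g sg gE] := hadamard (smooth_mono eV sF).
have B0 : ball (phi q) e (phi q) by exact: ballxx.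
have cg j : {for phi q, continuous (g j)} by exact: smooth_cont (sg j) B0.
suff gD j : 'D_(delta_mx ord0 j) F (phi q) = g j (phi q).
  under eq_bigr do rewrite gD.
  exact: (hadamard_derive e0 cg gE).
have Di k : is_derive (phi q) (delta_mx ord0 j : 'rV[R]_d)
  (fun x : 'rV[R]_d => x ord0 k) ((delta_mx ord0 j : 'rV[R]_d) ord0 k).
  exact: is_derive_coord.
have [_ ->] := @hadamard_derive _ _ _ id (phi q) (delta_mx ord0 j) e F g e0 cg gE
  (fun _ => id) (fun k => let: DeriveDef D _ := Di k in D).
rewrite (bigD1 j) //= big1 ?addr0 => [|k kj]; last first.
  by have [_ ->] := Di k; rewrite mxE (negbTE kj) andbF mul0r.
by have [_ ->] := Di j; rewrite mxE !eqxx mul1r.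
Qed.

Lemma smooth_comp (m d : nat) (U : set 'rV[R]_m) (V : set 'rV[R]_d)
    (phi : 'rV[R]_m -> 'rV[R]_d) (F : 'rV[R]_d -> R) :
  open U -> open V -> (forall x, U x -> V (phi x)) ->
  (forall j, smooth_rV U (fun x => phi x ord0 j)) -> smooth_rV V F ->
  smooth_rV U (fun x => F (phi x)).
Proof.
move=> Uo Vo UV sphi sF.
have cphi x : U x -> {for x, continuous phi}.
  by move=> Ux; apply: continuous_rV => j; exact: smooth_cont (sphi j) Ux.
have cF x : U x -> {for x, continuous (fun x => F (phi x))}.
  by move=> Ux; apply: cvg_comp_for (smooth_cont sF (UV _ Ux)) (cphi x Ux).
move=> k; elim: k F sF cF => [|k IH] F sF cF; first by split.
split=> //.
have D x v : U x -> is_derive x v (fun x => F (phi x))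
    (\sum_j 'D_v (fun x => phi x ord0 j) x * 'D_(delta_mx ord0 j) F (phi x)).
  move=> Ux; apply: (chain_rule Vo (UV x Ux) sF (cphi x Ux)) => j.
  exact: smooth_derivable (sphi j) Ux.
split=> [x v /D|v]; first by case/(_ v).
apply: (@Ck_ext _ _ _ _ (fun x => \sum_j 'D_v (fun x => phi x ord0 j) x *
    'D_(delta_mx ord0 j) F (phi x))) => // [x Ux|].
  by have [_ ->] := D x v Ux.
have H j : Ck k U (fun x => 'D_(delta_mx ord0 j) F (phi x)).
  have sDF := smooth_D (delta_mx ord0 j) sF.
  apply: (IH _ sDF) => x Ux.
  by apply: cvg_comp_for (smooth_cont sDF (UV _ Ux)) (cphi x Ux).
elim: (index_enum _) => [|j s IHs].
  by apply: Ck_ext (Ck_cst k 0 Uo) => // x _; rewrite big_nil.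
apply: (@Ck_ext _ _ _ _ (('D_v (fun x => phi x ord0 j) *
   (fun x => 'D_(delta_mx ord0 j) F (phi x))) + (fun x => \sum_(j <- s)
   'D_v (fun x => phi x ord0 j) x * 'D_(delta_mx ord0 j) F (phi x)))) => //.
  by move=> x _; rewrite big_cons.
by apply: CkD => //; apply: CkM => //; exact: smooth_D.
Qed.

End Composition.

(** * Smooth bump functions on row vectors *)

Section SmoothStep.
Variable R : realType.

(* [theta k] is [x^-k exp(-1/x)] on the positive reals; the family is closed
   under differentiation, whence the smoothness of all its members. *)
Definition theta (k : nat) (x : R) : R :=
  if 0 < x then x^-1 ^+ k * expR (- x^-1) else 0.

Lemma theta_ge0 k x : 0 <= theta k x.
Proof.
rewrite /theta; case: ifP => // x0; apply: mulr_ge0; last exact: expR_ge0.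
by rewrite exprn_ge0 // invr_ge0 ltW.
Qed.

Lemma theta_gt0 k x : 0 < x -> 0 < theta k x.
Proof.
by move=> x0; rewrite /theta x0 mulr_gt0 ?expR_gt0 // exprn_gt0 // invr_gt0.
Qed.

Lemma theta_le0 k x : x <= 0 -> theta k x = 0.
Proof. by rewrite /theta ltNge => ->. Qed.

(** The Taylor bound exp z >= z^(k+1) / (k+1)! at z = 1/x. It serves at 0, where the difference
    quotient of [theta k] from the right is [theta k.+1]. *)
Lemma theta_bound k x : 0 < x -> theta k x <= k.+1`!%:R * x.
Proof.
move=> x0; rewrite /theta x0; have z0 : 0 < x^-1 by rewrite invr_gt0.
rewrite expRN ler_pdivrMr ?expR_gt0 //.
have := expR_ge1Dxn k (ltW z0) => H.
have f0 : (0 : R) < k.+1`!%:R by rewrite ltr0n fact_gt0.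
apply: (@le_trans _ _ (k.+1`!%:R * x * (x^-1 ^+ k.+1 / k.+1`!%:R))).
  rewrite [leRHS](_ : _ = x^-1 ^+ k) // exprS.
  set a := x^-1 ^+ k; set f := _%:R in f0 *.
  by field; rewrite !gt_eqF.
rewrite ler_wpM2l ?(ltW (mulr_gt0 f0 x0)) //.
by apply: le_trans H; rewrite lerDr ler01.
Qed.

Lemma is_derive_theta k (x : R) :
  is_derive x 1 (theta k) (- k%:R * theta k.+1 x + theta k.+2 x).
Proof.
have [x0|x0|x0] := ltgtP x 0.
- rewrite !theta_le0 ?(ltW x0) // mulr0 addr0.
  apply: (@near_eq_is_derive _ _ _ (cst (0 : R))).
  apply: filterS (lt_nbhsl x0) => y y0.
  by rewrite theta_le0 // ltW.
- apply: (@near_eq_is_derive R R R (fun x : R => x^-1 ^+ k * expR (- x^-1))).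
    by apply: filterS (lt_nbhsr x0) => y y0; rewrite /theta y0.
  have xn : x != 0 by rewrite gt_eqF.
  have DV : is_derive x 1 (fun y : R => y^-1) (- x ^- 2 *: 1).
    exact: (is_deriveV xn (is_derive_id x 1)).
  have DE : is_derive x 1 (fun y : R => expR (- y^-1)) (expR (- x^-1) * x ^- 2).
    have := @is_derive1_comp R expR (fun y : R => - y^-1) x (expR (- x^-1)) (x ^- 2).
    apply.
    by have := is_deriveN DV; rewrite scaleNr opprK [_ *: 1]mulr1.
  have DX := is_deriveX k DV.
  have EX y : ((fun y : R => y^-1) ^+ k) y = y^-1 ^+ k.
    by elim: k {DX} => [//|m IH]; rewrite !exprS -IH.
  have -> : (fun y : R => y^-1 ^+ k * expR (- y^-1)) =
    (fun y : R => y^-1) ^+ k * (fun y : R => expR (- y^-1)).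
    by apply/funext => y; rewrite -EX.
  have D := is_deriveM DX DE; apply: (is_derive_eq D).
  rewrite /theta x0 /GRing.scale /= mulr1.
  rewrite EX -exprVn; case: k {DX EX D} => [|k] /=.
    by rewrite expr0 oppr0 !mul0r mulr0 addr0 add0r mul1r mulrC.
  rewrite !exprS; ring.
- rewrite x0 !theta_le0 // mulr0 addr0.
  suff C : (fun h : R => h^-1 *: (theta k (h *: 1 + 0) - theta k 0)) @ (0 : R)^' --> (0 : R).
    by apply: DeriveDef; [apply/cvg_ex; exists 0|exact/cvg_lim].
  apply/cvgrPdist_le => e e0; near=> h.
  rewrite sub0r normrN [h *: 1]mulr1 addr0 [theta k 0]theta_le0 // subr0.
  have [h0|h0] := leP h 0; first by rewrite theta_le0 // scaler0 normr0 ltW.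
  rewrite /GRing.scale /= ger0_norm; last first.
    by rewrite mulr_ge0 ?theta_ge0 // invr_ge0 ltW.
  have -> : h^-1 * theta k h = theta k.+1 h by rewrite /theta h0 exprS mulrA.
  apply: le_trans (theta_bound k.+1 h0) _.
  rewrite -ler_pdivlMl ?ltr0n ?fact_gt0 //.
  have he : `|h| < (k.+2)`!%:R^-1 * e.
    near: h; apply: dnbhs0_lt.
    by rewrite mulr_gt0 // invr_gt0 ltr0n fact_gt0.
  by apply: le_trans (ltW he); exact: ler_norm.
Unshelve. all: by end_near. Qed.

(** By induction on the class for all k at once, since the derivative of [theta k] involves its two
    successors. *)
Lemma smooth_theta d (U : set 'rV[R]_d) k (h : 'rV[R]_d -> R) : open U ->
  smooth_rV U h -> smooth_rV U (fun x => theta k (h x)).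
Proof.
move=> Uo sh m; have cth j y : {for y, continuous (theta j)}.
  apply: differentiable_continuous; apply/derivable1_diffP.
  by case: (is_derive_theta j y).
have cont j x : U x -> {for x, continuous (fun x => theta j (h x))}.
  move=> Ux; exact: (continuous_comp (smooth_cont sh Ux) (cth j (h x))).
elim: m k => [|m IH] k; first by split=> // x; exact: cont.
split; first by move=> x; exact: cont.
have D x v : U x -> is_derive x v (fun x => theta k (h x))
  ((- k%:R * theta k.+1 (h x) + theta k.+2 (h x)) * 'D_v h x).
  move=> Ux; have [D1 D2] := @is_derive_line R d h x v 0
    (@smooth_derivable _ _ _ h (0 *: v + x) v sh (eq_ind_r U Ux (etrans (congr1 (+%R^~ x) (scale0r v)) (add0r x)))).
  have := @is_derive1_comp R (theta k) (fun s : R => h (s *: v + x)) 0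
    (- k%:R * theta k.+1 (h x) + theta k.+2 (h x)) ('D_v h x).
  rewrite /comp /= scale0r add0r in D2 *.
  case; first exact: is_derive_theta.
    exact: DeriveDef.
  move=> E1 E2; apply: DeriveDef; first by apply/derivable1P.
  rewrite -E2 /derive; congr (lim (_ @ 0^')).
  by apply/funext => t /=; rewrite addr0 scale0r add0r [t *: 1]mulr1.
split=> [x v /D|v]; first by case/(_ v).
apply: (@Ck_ext _ _ _ _ ((cst (- k%:R) * (fun x => theta k.+1 (h x)) +
  (fun x => theta k.+2 (h x))) * 'D_v h)) => // [x Ux|].
  by have [_ ->] := D x v Ux.
apply: CkM => //; last exact: smooth_D.
by apply: CkD => //; apply: CkM => //; exact: Ck_cst.
Qed.

Definition smooth_step (x : R) := theta 0 (2 - x) / (theta 0 (2 - x) + theta 0 (x - 1)).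

Lemma smooth_step_den x : 0 < theta 0 (2 - x) + theta 0 (x - 1).
Proof.
have [x2|x2] := ltP x 2.
  by rewrite ltr_wpDr ?theta_ge0 // theta_gt0 // subr_gt0.
rewrite ltr_wpDl ?theta_ge0 // theta_gt0 // subr_gt0.
by apply: lt_le_trans x2; rewrite ltr1n.
Qed.

Lemma smooth_step1 x : x <= 1 -> smooth_step x = 1.
Proof.
move=> x1; have := smooth_step_den x.
rewrite /smooth_step [theta 0 (x - 1)]theta_le0 ?subr_le0 // addr0 => t0.
by rewrite divff // gt_eqF.
Qed.

Lemma smooth_step0 x : 2 <= x -> smooth_step x = 0.
Proof. by move=> x2; rewrite /smooth_step theta_le0 ?subr_le0 // mul0r. Qed.

Lemma smooth_step_ge0 x : 0 <= smooth_step x.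
Proof. by rewrite divr_ge0 ?theta_ge0 // ltW // smooth_step_den. Qed.

Lemma smooth_step_le1 x : smooth_step x <= 1.
Proof. by rewrite ler_pdivrMr ?smooth_step_den // mul1r lerDl theta_ge0. Qed.

Lemma rV_bump d (p : 'rV[R]_d) (e : R) : 0 < e ->
  exists chi : 'rV[R]_d -> R, exists V : set 'rV[R]_d, exists K : set 'rV[R]_d,
  [/\ smooth_rV setT chi, forall y, 0 <= chi y <= 1,
      [/\ open V, V p & forall y, V y -> chi y = 1],
      [/\ compact K, K `<=` ball p e & V `<=` K] &
      forall y, ~ K y -> chi y = 0].
Proof.
(* A coordinate at distance e/2 from p already contributes c (e/2)^2 = 2, the value where
   [smooth_step] reaches 0; so the bump vanishes off the closed box of half-side e/2. *)
move=> e0; pose c := 8 / e ^+ 2.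
have c0 : 0 < c by rewrite divr_gt0 // exprn_gt0.
pose N (y : 'rV[R]_d) : R := c * \sum_j (y ord0 j - p ord0 j) ^+ 2.
have sN : smooth_rV setT N.
  apply: smoothZ; first exact: openT.
  apply: smooth_sum => [|j _]; first exact: openT.
  apply: smoothX; first exact: openT.
  apply: smoothB; try exact: openT.
    by apply: smooth_coord; exact: openT.
  by apply: smooth_cst; exact: openT.
pose K := [set y : 'rV[R]_d | forall j, `[p ord0 j - e / 2, p ord0 j + e / 2]%classic (y ord0 j)].
have KP y : K y <-> forall j, `|y ord0 j - p ord0 j| <= e / 2.
  by split=> H j; have := H j; rewrite /= in_itv /= ler_distl.
have KN y : ~ K y -> 2 <= N y.
  move=> /KP /existsNP[j /negP]; rewrite -ltNge => Hj.
  rewrite -ler_pdivrMl // (bigD1 j) //=; apply: ler_wpDr.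
    by apply: sumr_ge0 => i _; exact: sqr_ge0.
  rewrite -real_normK ?num_real //.
  have -> : c^-1 * 2 = (e / 2) ^+ 2.
    by rewrite /c; field; rewrite gt_eqF.
  by rewrite ler_pXn2r ?nnegrE ?(ltW Hj) // divr_ge0 // ltW.
exists (fun y => smooth_step (N y)), [set y | N y < 1], K; split.
- have oT : open [set: 'rV[R]_d] by exact: openT.
  have s1 : smooth_rV setT (fun y => theta 0 (2 - N y)).
    by apply: smooth_theta => //; apply: smoothB => //; exact: smooth_cst.
  have s2 : smooth_rV setT (fun y => theta 0 (N y - 1)).
    by apply: smooth_theta => //; apply: smoothB => //; exact: smooth_cst.
  apply: smoothM => //; apply: smoothV => // [y _|].
    by rewrite gt_eqF // smooth_step_den.
  exact: smoothD.
- by move=> y; rewrite smooth_step_ge0 smooth_step_le1.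
- split.
  + apply: (@open_comp _ _ N [set x | x < 1]); last exact: open_lt.
    by move=> y _; exact: smooth_cont sN I.
  + rewrite /= /N big1 ?mulr0 // => j _.
    by rewrite subrr expr0n.
  + by move=> y /ltW /smooth_step1.
- split.
  + apply: (@rV_compact R d (fun j => `[p ord0 j - e / 2, p ord0 j + e / 2]%classic)).
    by move=> j; exact: segment_compact.
  + move=> y /KP Ky; apply/ball_rVP; split=> // j.
    rewrite distrC; apply: le_lt_trans (Ky j) _.
    by rewrite ltr_pdivrMr // ltr_pMr // ltr1n.
  + move=> y /= N1; apply: contrapT => /KN N2.
    by lra.
- by move=> y /KN /smooth_step0.
Qed.

End SmoothStep.

(** * Charts and smooth functions *)

Section ChartedSpaces.
Variables (R : realType) (d : nat).

Definition cinv (T : Type) (dom : set T) (c : T -> 'rV[R]_d) (x0 : T)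
    (y : 'rV[R]_d) : T :=
  if pselect (exists p, dom p /\ c p = y) is left e then projT1 (cid e) else x0.

(** f read in the coordinates c; the default 0 off the image of the chart lies outside every set on
    which smoothness is claimed. *)
Definition cpull (X : topologicalType) (c : chart R X d) (f : X -> R)
    (y : 'rV[R]_d) : R :=
  if pselect (exists p, chart_dom c p /\ c p = y) is left e
  then f (projT1 (cid e)) else 0.

Section OneSpace.
Variable X : topologicalType.
Implicit Types (c : chart R X d) (U V : set X) (f g : X -> R) (x : X).

Lemma cinvK c x0 x : chart_dom c x -> cinv (chart_dom c) c x0 (c x) = x.
Proof.
move=> cx; rewrite /cinv; case: pselect => [e|[]]; last by exists x.
case: cid => p /= [cp E]; apply: (chart_inj (c:=c)) => //; exact: mem_set.
Qed.

Lemma cpullE c f x : chart_dom c x -> cpull c f (c x) = f x.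
Proof.
move=> cx; rewrite /cpull; case: pselect => [e|[]]; last by exists x.
case: cid => p /= [cp E]; congr f.
by apply: (chart_inj (c:=c)) => //; exact: mem_set.
Qed.

Lemma chart_img_open c : open (c @` chart_dom c).
Proof. by apply: chart_open => //; exact: chart_dom_open. Qed.

Lemma chart_img_openI c U : open U -> open (c @` (chart_dom c `&` U)).
Proof.
move=> Uo; apply: chart_open => [|x []//].
by apply: openI => //; exact: chart_dom_open.
Qed.

Lemma chart_preimage_open c (W : set 'rV[R]_d) : open W ->
  open (chart_dom c `&` c @^-1` W).
Proof.
move=> Wo; rewrite openE => x [cx Wx]; apply: filterI.
  by apply: open_nbhs_nbhs; split=> //; exact: chart_dom_open.
by apply: (chart_cont cx); apply: open_nbhs_nbhs.
Qed.

Lemma cinv_continuous c x0 x : chart_dom c x ->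
  {for c x, continuous (cinv (chart_dom c) c x0)}.
Proof.
move=> cx; rewrite /prop_for /continuous_at cinvK // => A.
rewrite nbhsE => -[W [Wo Wx] WA].
have Io : open (c @` (chart_dom c `&` W)) by exact: chart_img_openI.
apply: (@filterS _ (nbhs (c x)) _ (c @` (chart_dom c `&` W))).
  by move=> _ [z [cz Wz] <-]; apply: WA; rewrite cinvK.
by apply: open_nbhs_nbhs; split=> //; exists x.
Qed.

Lemma smooth_in_chartP c U f : open U ->
  smooth_in_chart c U f <->
  smooth_rV (c @` (chart_dom c `&` U)) (cpull c f).
Proof.
move=> Uo; split=> [[h sh hE]|sf]; last first.
  by exists (cpull c f) => // x cx _; rewrite cpullE.
apply: smooth_ext sh => [|_ [x [cx Ux] <-]]; first exact: chart_img_openI.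
by rewrite cpullE ?hE.
Qed.

Lemma smooth_in_chart_mono c U V f : V `<=` U ->
  smooth_in_chart c U f -> smooth_in_chart c V f.
Proof.
move=> VU [h sh hE]; exists h => [|x cx /VU]; last exact: hE.
by apply: smooth_mono sh => _ [x [cx /VU Ux] <-]; exists x.
Qed.

Lemma smooth_in_chart_ext c U f g : (forall x, U x -> f x = g x) ->
  smooth_in_chart c U f -> smooth_in_chart c U g.
Proof. by move=> fg [h sh hE]; exists h => // x cx Ux; rewrite -fg ?hE. Qed.

Lemma smooth_in_chart_local c U f : open U ->
  (forall x, chart_dom c x -> U x -> exists V,
     [/\ open V, V x & smooth_in_chart c V f]) -> smooth_in_chart c U f.
Proof.
move=> Uo H; apply/smooth_in_chartP => //; apply: smooth_local => _ [x [cx Ux] <-].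
have [V [Vo Vx /smooth_in_chartP sf]] := H x cx Ux.
exists (c @` (chart_dom c `&` V)); first by exists x.
exact: sf.
Qed.

Lemma smooth_in_chart_coord c U j : open U ->
  smooth_in_chart c U (fun x => c x ord0 j).
Proof.
move=> Uo; exists (fun y => y ord0 j) => //.
by apply: smooth_coord; exact: chart_img_openI.
Qed.

Fact chart_restr_inj c U : {in chart_dom c `&` U &, injective c}.
Proof.
move=> x y /set_mem[cx _] /set_mem[cy _]; apply: chart_inj; exact: mem_set.
Qed.

Fact chart_restr_cont c U x : (chart_dom c `&` U) x -> {for x, continuous c}.
Proof. by case=> cx _; exact: chart_cont. Qed.

Fact chart_restr_open c U V : open V -> V `<=` chart_dom c `&` U ->
  open (c @` V).
Proof. by move=> Vo VU; apply: chart_open => // x /VU[]. Qed.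

Definition chart_restr c U (Uo : open U) : chart R X d :=
  Chart (openI (@chart_dom_open _ _ _ c) Uo) (@chart_restr_inj c U)
    (@chart_restr_cont c U) (@chart_restr_open c U).

End OneSpace.

(** Composition with the transition map, which is smooth on the image under c' of the overlap. *)
Lemma smooth_change (X : topologicalType) (c c' : chart R X d) (U : set X)
    (f : X -> R) : open U ->
  (forall j, smooth_in_chart c' (chart_dom c) (fun x => c x ord0 j)) ->
  smooth_in_chart c U f -> smooth_in_chart c' (U `&` chart_dom c) f.
Proof.
move=> Uo cc [h sh hE].
have UVo : open (U `&` chart_dom c) by apply: openI => //; exact: chart_dom_open.
pose phi y : 'rV[R]_d := \row_j cpull c' (fun x => c x ord0 j) y.
have phiE x : chart_dom c' x -> phi (c' x) = c x.
  by move=> cx; apply/rowP => j; rewrite mxE cpullE.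
exists (fun y => h (phi y)); last by move=> x cx' [Ux cx]; rewrite phiE // hE.
apply: (@smooth_comp _ _ _ _ (c @` (chart_dom c `&` U))) sh.
- exact: chart_img_openI.
- exact: chart_img_openI.
- by move=> _ [x [cx' [Ux cx]] <-]; rewrite phiE //; exists x.
- move=> j; apply: (@smooth_ext _ _ _ (cpull c' (fun x => c x ord0 j))).
  + exact: chart_img_openI.
  + by move=> y _; rewrite mxE.
  + apply/(smooth_in_chartP c' _ UVo).
    apply: smooth_in_chart_mono (cc j); exact: subIsetr.
Qed.

Section SmoothFunctions.
Variable X : charted_space R d.
Implicit Types (c : chart R X d) (U V : set X) (f g : X -> R) (x : X).

Lemma smooth_on_mono U V f : V `<=` U -> smooth_on U f -> smooth_on V f.
Proof. by move=> VU sf c Ac; exact: smooth_in_chart_mono (sf c Ac). Qed.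

Lemma smooth_on_ext U f g : (forall x, U x -> f x = g x) ->
  smooth_on U f -> smooth_on U g.
Proof. by move=> fg sf c Ac; exact: smooth_in_chart_ext (sf c Ac). Qed.

Lemma smooth_on_local U f : open U ->
  (forall x, U x -> exists V, [/\ open V, V x & smooth_on V f]) ->
  smooth_on U f.
Proof.
move=> Uo H c Ac; apply: smooth_in_chart_local => // x cx /H[V [Vo Vx sf]].
by exists V; split=> //; exact: sf.
Qed.

Lemma smooth_on_sum U (I : Type) (s : seq I) (F : I -> X -> R) : open U ->
  (forall i, smooth_on U (F i)) -> smooth_on U (fun x => \sum_(i <- s) F i x).
Proof.
move=> Uo sF; elim: s => [|i s IH].
  apply: (smooth_on_ext _ (smooth_on_cst 0 Uo)) => x _; by rewrite big_nil.
apply: (smooth_on_ext _ (smooth_onD Uo (sF i) IH)) => x _.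
by rewrite big_cons.
Qed.

Lemma smooth_on_prod U (I : Type) (s : seq I) (F : I -> X -> R) : open U ->
  (forall i, smooth_on U (F i)) -> smooth_on U (fun x => \prod_(i <- s) F i x).
Proof.
move=> Uo sF; elim: s => [|i s IH].
  apply: (smooth_on_ext _ (smooth_on_cst 1 Uo)) => x _; by rewrite big_nil.
apply: (smooth_on_ext _ (smooth_onM Uo (sF i) IH)) => x _.
by rewrite big_cons.
Qed.

Lemma smooth_onX U f m : open U -> smooth_on U f ->
  smooth_on U (fun x => f x ^+ m).
Proof.
move=> Uo sf; elim: m => [|m IH]; first exact: (smooth_on_cst 1 Uo).
by apply: (smooth_on_ext _ (smooth_onM Uo sf IH)) => x _; rewrite exprS.
Qed.

Lemma smooth_onV U f : open U -> (forall x, U x -> f x != 0) ->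
  smooth_on U f -> smooth_on U (fun x => (f x)^-1).
Proof.
move=> Uo f0 sf c Ac; have [h sh hE] := sf c Ac.
exists (fun y => (h y)^-1); last by move=> x cx Ux; rewrite hE.
apply: smoothV => //; first exact: chart_img_openI.
by move=> _ [x [cx Ux] <-]; rewrite -hE ?f0.
Qed.

Definition mkC f (sf : smooth_on setT f) : Cinfty X := MkCinfty (asboolT sf).

Lemma Cinfty_smooth_on (f : Cinfty X) U : smooth_on U f.
Proof.
by apply: (@smooth_on_mono setT) => //; apply/asboolP; exact: Cinfty_smooth f.
Qed.

Lemma CinftyP (f g : Cinfty X) : (forall x, f x = g x) -> f = g.
Proof. by move=> fg; apply/val_inj/funext. Qed.

Lemma CinftyD (f g : Cinfty X) x : (f + g) x = f x + g x. Proof. by []. Qed.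
Lemma CinftyN (f : Cinfty X) x : (- f) x = - f x. Proof. by []. Qed.
Lemma CinftyM (f g : Cinfty X) x : (f * g) x = f x * g x. Proof. by []. Qed.
Lemma CinftyZ a (f : Cinfty X) x : (a *: f) x = a * f x. Proof. by []. Qed.
Lemma Cinfty0 x : (0 : Cinfty X) x = 0. Proof. by []. Qed.
Lemma Cinfty1 x : (1 : Cinfty X) x = 1. Proof. by []. Qed.

Definition CinftyE := (CinftyD, CinftyN, CinftyM, CinftyZ, Cinfty0, Cinfty1).

Lemma Cinfty_sum (I : Type) (s : seq I) (P : pred I) (F : I -> Cinfty X) x :
  (\sum_(i <- s | P i) F i) x = \sum_(i <- s | P i) F i x.
Proof. by elim/big_rec2: _ => // i a b _ <-. Qed.

Lemma Cinfty_exp (f : Cinfty X) m x : (f ^+ m) x = f x ^+ m.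
Proof. by elim: m => [//|m IH]; rewrite !exprS CinftyM IH. Qed.

Lemma Cinfty_prod (I : Type) (s : seq I) (P : pred I) (F : I -> Cinfty X) x :
  (\prod_(i <- s | P i) F i) x = \prod_(i <- s | P i) F i x.
Proof. by elim/big_rec2: _ => // i a b _ <-. Qed.

Lemma smooth_chart_on c U f : smooth_chart c -> open U -> U `<=` chart_dom c ->
  smooth_in_chart c U f -> smooth_on U f.
Proof.
move=> sc Uo Uc sf c' Ac'.
have := smooth_change Uo (fun j => (sc c' Ac' j).2) sf.
by apply: smooth_in_chart_mono => x Ux; split=> //; exact: Uc.
Qed.

Lemma smooth_coord_on c j : smooth_chart c ->
  smooth_on (chart_dom c) (fun x => c x ord0 j).
Proof.
move=> sc; apply: (smooth_chart_on sc) => //; first exact: chart_dom_open.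
by apply: smooth_in_chart_coord; exact: chart_dom_open.
Qed.

Lemma smooth_chart_restr c U (Uo : open U) :
  smooth_chart c -> smooth_chart (chart_restr c Uo).
Proof.
move=> sc c' Ac' j; have [[h sh hE] s2] := sc c' Ac' j; split; last first.
  by apply: smooth_in_chart_mono s2 => x [].
exists h; last by move=> x [cx _]; exact: hE.
by apply: smooth_mono sh => _ [x [[cx Ux] cx'] <-]; exists x.
Qed.

(* [is_manifold] without second countability, which T_r M also satisfies but
   which is not needed there. *)
Definition good_atlas := [/\ hausdorff_space X,
  (forall x : X, exists2 c, atlas c & chart_dom c x) &
  (forall c c' : chart R X d, atlas c -> atlas c' -> compatible_charts c c')].

Hypothesis hX : good_atlas.

Lemma smooth_on_chart c U f : smooth_chart c -> open U ->
  smooth_on U f -> smooth_in_chart c U f.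
Proof.
move=> sc Uo sf; apply: smooth_in_chart_local => // x cx Ux.
have [_ /(_ x)[c' Ac' c'x] _] := hX.
exists (U `&` chart_dom c'); split=> //.
  by apply: openI => //; exact: chart_dom_open.
exact: (smooth_change Uo (fun j => (sc c' Ac' j).1) (sf c' Ac')).
Qed.

Lemma smooth_cpull c (f : Cinfty X) : smooth_chart c ->
  smooth_rV (c @` chart_dom c) (cpull c f).
Proof.
move=> sc.
have /(smooth_in_chartP c _ openT) := smooth_on_chart sc openT (Cinfty_smooth_on f _).
by rewrite setIT.
Qed.

(** A bump on a coordinate ball is extended by zero. The set K off which it vanishes is compact,
    hence closed because X is Hausdorff, and this makes the extension smooth at the points off the
    chart. *)
Lemma bump x U : open U -> U x ->
  exists chi : Cinfty X, exists V : set X, exists K : set X,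
  [/\ (forall y, 0 <= chi y <= 1),
      [/\ open V, V x, V `<=` K & forall y, V y -> chi y = 1],
      [/\ compact K, closed K & K `<=` U] &
      forall y, ~ K y -> chi y = 0].
Proof.
move=> Uo Ux; have [hH /(_ x)[c Ac cx] hc] := hX.
have sc : smooth_chart c by move=> c'; exact: hc.
have Io : open (c @` (chart_dom c `&` U)) by exact: chart_img_openI.
have [e e0 eI] : exists2 e, 0 < e & ball (c x) e `<=` c @` (chart_dom c `&` U).
  by apply: open_ball_sub Io _; exists x.
have [chi0 [V0 [K0 [sch ch01 [V0o V0x V01] [K0c K0e VK0] K00]]]] := rV_bump (c x) e0.
pose ci := cinv (chart_dom c) c x.
pose K := ci @` K0.
have KP y : K y <-> chart_dom c y /\ K0 (c y).
  split=> [[z K0z <-]|[cy K0y]]; last by exists (c y) => //; rewrite /ci cinvK.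
  by have [w [cw Uw] E] := eI _ (K0e _ K0z); rewrite -E /ci cinvK // E.
have Kc : compact K.
  apply: continuous_compact => //; apply: continuous_in_subspaceT => z /set_mem.
  move=> /K0e/eI [w [cw _] <-]; exact: cinv_continuous.
have Kcl : closed K by exact: compact_closed.
pose chi y := if `[< chart_dom c y >] then chi0 (c y) else 0.
have chiE y : chart_dom c y -> chi y = chi0 (c y).
  by move=> cy; rewrite /chi asboolT.
have chi0K y : ~ K y -> chi y = 0.
  move=> nK; rewrite /chi; case: asboolP => // cy; apply: K00 => Ky.
  by apply: nK; apply/KP.
have sch1 : smooth_on setT chi.
  apply: smooth_on_local => [|y _]; first exact: openT.
  have [cy|ncy] := pselect (chart_dom c y).
    exists (chart_dom c); split=> //; first exact: chart_dom_open.
    apply: (smooth_chart_on sc) => //; first exact: chart_dom_open.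
    by exists chi0; [exact: smooth_mono sch|move=> z /chiE].
  exists (~` K); split; first exact: closed_openC.
    by move=> /KP[].
  apply: (smooth_on_ext _ (smooth_on_cst 0 (closed_openC Kcl))) => z.
  by move=> /chi0K.
exists (mkC sch1), (chart_dom c `&` c @^-1` V0), K; split.
- by move=> y /=; rewrite /chi; case: asboolP => // _; rewrite lexx ler01.
- split=> //; first exact: chart_preimage_open.
    by move=> y [cy Vy]; apply/KP; split=> //; exact: VK0.
  by move=> y [cy Vy] /=; rewrite chiE // V01.
- split=> // y /KP[cy K0y]; have [w [cw Uw] E] := eI _ (K0e _ K0y).
  by have <- : w = y by apply: (chart_inj (c:=c)) => //; exact: mem_set.
- exact: chi0K.
Qed.

Lemma smooth_cutoff (chi : Cinfty X) K U f : open U -> closed K -> K `<=` U ->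
  (forall y, ~ K y -> chi y = 0) -> smooth_on U f ->
  smooth_on setT (fun y => chi y * f y).
Proof.
move=> Uo Kc KU chi0 sf; apply: smooth_on_local => [|y _]; first exact: openT.
have [Ky|nKy] := pselect (K y).
  exists U; split=> //; first exact: KU.
  by apply: smooth_onM => //; exact: Cinfty_smooth_on.
exists (~` K); split=> //; first exact: closed_openC.
apply: (smooth_on_ext _ (smooth_on_cst 0 (closed_openC Kc))) => z nKz.
by rewrite chi0 // mul0r.
Qed.

(** Germs at x extend to global functions after a cut-off. One bump serves the whole family, so all
    members agree with their extensions on a common neighbourhood. *)
Lemma extension (I : Type) x U (f : I -> X -> R) : open U -> U x ->
  (forall i, smooth_on U (f i)) ->
  exists F : I -> Cinfty X, exists V,
  [/\ open V, V x, V `<=` U & forall i y, V y -> F i y = f i y].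
Proof.
move=> Uo Ux sf; have [chi [V [K [_ [Vo Vx VK V1] [_ Kc KU] chi0]]]] := bump Uo Ux.
exists (fun i => mkC (smooth_cutoff Uo Kc KU chi0 (sf i))), V; split=> //.
  by move=> y /VK/KU.
by move=> i y Vy /=; rewrite V1 // mul1r.
Qed.

Lemma separating_bump (S : set X) x : closed S -> ~ S x ->
  exists chi : Cinfty X, chi x = 1 /\ forall y, S y -> chi y = 0.
Proof.
move=> Sc nSx.
have [chi [V [K [_ [_ Vx _ V1] [_ _ KS] chi0]]]] := bump (closed_openC Sc) nSx.
exists chi; split; first exact: V1.
by move=> y Sy; apply: chi0 => /KS.
Qed.

Lemma manifold_hadamard c x (f : Cinfty X) : smooth_chart c -> chart_dom c x ->
  exists (g : 'I_d -> Cinfty X) (V : set X),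
  [/\ open V, V x, V `<=` chart_dom c &
      forall y, V y -> f y = f x + \sum_j (c y ord0 j - c x ord0 j) * g j y].
Proof.
move=> sc cx; have sh := smooth_cpull f sc; have Io : open (c @` chart_dom c) by exact: chart_img_open.
have [e e0 eI] : exists2 e, 0 < e & ball (c x) e `<=` c @` chart_dom c.
  by apply: open_ball_sub Io _; exists x.
have [g sg gE] := hadamard (smooth_mono eI sh).
have Uo := chart_preimage_open c (ball_open (c x) e).
have Ux : (chart_dom c `&` c @^-1` ball (c x) e) x.
  by split=> //; exact: ballxx.
have [|G [V [Vo Vx VU GE]]] := @extension _ x _ (fun j y => g j (c y)) Uo Ux.
  move=> j; apply: (smooth_chart_on sc) => //.
  exists (g j) => //; apply: smooth_mono (sg j).
  by move=> _ [y [_ [_ By]] <-].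
exists G, V; split=> // [y /VU[]//|y Vy].
have [cy By] := VU _ Vy.
under eq_bigr do rewrite GE //.
by rewrite -gE // !cpullE // addrC subrK.
Qed.

End SmoothFunctions.
End ChartedSpaces.

(** * Tangent vectors *)

Section TangentVectors.
Variables (R : realType) (d : nat) (X : charted_space R d).
Hypothesis hX : good_atlas X.
Implicit Types (c : chart R X d) (U V : set X) (f g : Cinfty X) (x : X).
Implicit Types (v : Cinfty X -> R).

Lemma tangentD x v f g : tangent_space x v -> v (f + g) = v f + v g.
Proof. by case=> lv _; have := lv 1 f g; rewrite scale1r mul1r. Qed.

Lemma tangentM x v f g : tangent_space x v -> v (f * g) = f x * v g + g x * v f.
Proof. by case. Qed.

Lemma tangent0 x v : tangent_space x v -> v 0 = 0.
Proof.
by move=> tv; have := tangentD 0 0 tv; rewrite addr0 => /(congr1 (+%R^~ (- v 0))); rewrite addrK subrr => <-.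
Qed.

Lemma tangentZ x v a f : tangent_space x v -> v (a *: f) = a * v f.
Proof.
by move=> tv; case: (tv) => lv _; have := lv a f 0; rewrite !addr0 (tangent0 tv) addr0.
Qed.

Lemma tangentN x v f : tangent_space x v -> v (- f) = - v f.
Proof. by move=> tv; rewrite -scaleN1r (tangentZ _ _ tv) mulN1r. Qed.

Lemma tangentB x v f g : tangent_space x v -> v (f - g) = v f - v g.
Proof. by move=> tv; rewrite (tangentD _ _ tv) (tangentN _ tv). Qed.

Lemma tangent1 x v : tangent_space x v -> v 1 = 0.
Proof.
move=> tv; have := tangentM 1 1 tv; rewrite mulr1 !CinftyE !mul1r.
by move/(congr1 (+%R^~ (- v 1))); rewrite addrK subrr => <-.
Qed.

Lemma tangent_sum x v (I : Type) (s : seq I) (F : I -> Cinfty X) :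
  tangent_space x v -> v (\sum_(i <- s) F i) = \sum_(i <- s) v (F i).
Proof.
move=> tv; elim: s => [|i s IH]; first by rewrite !big_nil (tangent0 tv).
by rewrite !big_cons (tangentD _ _ tv) IH.
Qed.

(** For a bump chi at x vanishing off a subset of U, the Leibniz rule applied to chi (f - g) = 0
    gives v (f - g) = 0. *)
Lemma tangent_local x v f g U : tangent_space x v -> open U -> U x ->
  (forall y, U y -> f y = g y) -> v f = v g.
Proof.
move=> tv Uo Ux fg.
have [chi [V [K [_ [_ Vx _ V1] [_ _ KU] chi0]]]] := bump hX Uo Ux.
have E : chi * (f - g) = 0.
  apply: CinftyP => y; rewrite !CinftyE.
  have [Ky|/chi0 ->] := pselect (K y); last by rewrite mul0r.
  by rewrite fg ?subrr ?mulr0 //; exact: KU.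
have := tangentM chi (f - g) tv.
rewrite E (tangent0 tv) (tangentB _ _ tv) !CinftyE (V1 _ Vx) mul1r.
rewrite fg // subrr mul0r addr0 => /esym/eqP.
by rewrite subr_eq0 => /eqP.
Qed.

Lemma tangent_space_comb x (I : finType) (a : I -> R) (v : I -> Cinfty X -> R) :
  (forall i, tangent_space x (v i)) ->
  tangent_space x (fun f => \sum_i a i * v i f).
Proof.
move=> tv; split=> [b f g|f g].
  rewrite /= [RHS](_ : _ = b * (\sum_i a i * v i f) + \sum_i a i * v i g) //.
  rewrite mulr_sumr -big_split; apply: eq_bigr => i _ /=.
  by rewrite (tangentD _ _ (tv i)) (tangentZ _ _ (tv i)); ring.
rewrite !mulr_sumr -big_split; apply: eq_bigr => i _ /=.
by rewrite (tangentM _ _ (tv i)); ring.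
Qed.

Lemma tangent_spaceB x v (w : Cinfty X -> R) a : tangent_space x v ->
  tangent_space x w -> tangent_space x (fun f => v f - a * w f).
Proof.
move=> tv tw; split=> [b f g|f g].
  rewrite /= [RHS](_ : _ = b * (v f - a * w f) + (v g - a * w g)) //.
  by rewrite !(tangentD _ _ tv, tangentD _ _ tw, tangentZ _ _ tv, tangentZ _ _ tw); ring.
by rewrite (tangentM _ _ tv) (tangentM _ _ tw); ring.
Qed.

Definition pderiv c x (j : 'I_d) f : R :=
  'D_(delta_mx ord0 j) (cpull c f) (c x).

Lemma tangent_pderiv c x j : smooth_chart c -> chart_dom c x ->
  tangent_space x (pderiv c x j).
Proof.
move=> sc cx.
have Icx : (c @` chart_dom c) (c x) by exists x.
have D f : derivable (cpull c f) (c x) (delta_mx ord0 j).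
  exact: smooth_derivable (smooth_cpull hX f sc) Icx.
have near_img (P : 'rV[R]_d -> Prop) :
    (forall y, chart_dom c y -> P (c y)) -> \forall y \near c x, P y.
  move=> H; apply: (@filterS _ (nbhs (c x)) _ (c @` chart_dom c)).
    by move=> _ [y cy <-]; exact: H.
  by apply: open_nbhs_nbhs; split=> //; exact: chart_img_open.
split=> [a f g|f g].
  rewrite /pderiv [RHS](_ : _ = a * pderiv c x j f + pderiv c x j g) //.
  rewrite (_ : 'D__ _ _ = 'D_(delta_mx ord0 j) (a \*: cpull c f + cpull c g) (c x)).
    by rewrite deriveD ?deriveZ //; exact: derivableZ.
  apply: near_eq_derive; apply: near_img => y cy.
  by rewrite /= cpullE // [RHS]/(_ + _) /= !cpullE.
rewrite /pderiv (_ : 'D__ _ _ = 'D_(delta_mx ord0 j) (cpull c f * cpull c g) (c x)).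
  by rewrite deriveM // !cpullE.
apply: near_eq_derive; apply: near_img => y cy.
by rewrite [RHS]/(_ * _) /= !cpullE.
Qed.

Lemma pderiv_coord c x V j k (Xk : Cinfty X) : open V -> V x ->
  V `<=` chart_dom c -> (forall y, V y -> Xk y = c y ord0 k) ->
  pderiv c x j Xk = (k == j)%:R.
Proof.
move=> Vo Vx Vc XE; rewrite /pderiv.
rewrite (@near_eq_derive _ _ _ _ (fun y : 'rV[R]_d => y ord0 k)).
  by have [_ ->] := @is_derive_coord R d k (c x) (delta_mx ord0 j); rewrite mxE.
apply: (@filterS _ (nbhs (c x)) _ (c @` (chart_dom c `&` V))).
  by move=> _ [y [cy Vy] <-]; rewrite cpullE // XE.
by apply: open_nbhs_nbhs; split; [exact: chart_img_openI|exists x => //; split=> //; exact: Vc].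
Qed.

Lemma local_coordinates c x : smooth_chart c -> chart_dom c x ->
  exists (Xc : 'I_d -> Cinfty X) V, [/\ open V, V x, V `<=` chart_dom c &
    forall j y, V y -> Xc j y = c y ord0 j].
Proof.
move=> sc cx; apply: (extension hX) => //; first exact: chart_dom_open.
by move=> j; exact: smooth_coord_on.
Qed.

(** Hadamard's formula gives w f = sum_j w(x_j) g_j(x) for every derivation w at x; taking for w the
    partial derivatives themselves identifies g_j(x). *)
Lemma tangent_expand c x v V (Xc : 'I_d -> Cinfty X) f :
  smooth_chart c -> open V -> V x -> V `<=` chart_dom c ->
  (forall j y, V y -> Xc j y = c y ord0 j) -> tangent_space x v ->
  v f = \sum_j v (Xc j) * pderiv c x j f.
Proof.
move=> sc Vo Vx Vc XE tv; have cx := Vc _ Vx.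
have [g [W [Wo Wx Wc fE]]] := manifold_hadamard hX f sc cx.
have E w : tangent_space x w -> w f = \sum_j w (Xc j) * g j x.
  move=> tw; pose F := f x *: (1 : Cinfty X) + \sum_j (Xc j - c x ord0 j *: (1 : Cinfty X)) * g j.
  have -> : w f = w F.
    apply: (tangent_local tw (openI Vo Wo)) => // y [Vy Wy].
    rewrite fE // !CinftyE mulr1 Cinfty_sum; congr (_ + _).
    by apply: eq_bigr => j _; rewrite !CinftyE mulr1 XE.
  rewrite /F (tangentD _ _ tw) (tangentZ _ _ tw) (tangent1 tw) mulr0 add0r.
  rewrite (tangent_sum _ _ tw); apply: eq_bigr => j _.
  rewrite (tangentM _ _ tw) (tangentB _ _ tw) (tangentZ _ _ tw) (tangent1 tw).
  by rewrite !CinftyE XE // mulr1 subrr mul0r add0r mulr0 subr0 mulrC.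
rewrite (E _ tv); apply: eq_bigr => k _; congr (_ * _).
rewrite (E _ (tangent_pderiv k sc cx)) (bigD1 k) //=.
rewrite (pderiv_coord k Vo Vx Vc (XE k)) eqxx mul1r big1 ?addr0 // => j jk.
by rewrite (pderiv_coord k Vo Vx Vc (XE j)) (negbTE jk) mul0r.
Qed.

Lemma pderiv_comb_coord c x V (Xc : 'I_d -> Cinfty X) (a : 'I_d -> R) k :
  open V -> V x -> V `<=` chart_dom c ->
  (forall j y, V y -> Xc j y = c y ord0 j) ->
  \sum_j a j * pderiv c x j (Xc k) = a k.
Proof.
move=> Vo Vx Vc XE.
rewrite (bigD1 k) //= (pderiv_coord k Vo Vx Vc (XE k)) eqxx mulr1.
rewrite big1 ?addr0 // => j jk.
by rewrite (pderiv_coord j Vo Vx Vc (XE k)) eq_sym (negbTE jk) mulr0.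
Qed.

(** The derivations along the free coordinates kill functions vanishing on S, because the coordinate
    lines through x in these directions stay in S near x. *)
Lemma tangent_subspace_coord c x V (Xc : 'I_d -> Cinfty X) (S : set X)
    (P : pred 'I_d) v :
  smooth_chart c -> open V -> V x -> V `<=` chart_dom c ->
  (forall j y, V y -> Xc j y = c y ord0 j) -> S x ->
  (forall y, V y -> (S y <-> forall j, P j -> c y ord0 j = 0)) ->
  tangent_subspace S x v <->
  tangent_space x v /\ forall j, P j -> v (Xc j) = 0.
Proof.
move=> sc Vo Vx Vc XE Sx SP; have cx := Vc _ Vx; split=> -[tv H].
  split=> // j Pj; apply: H; exists V; split=> // y Vy /SP H.
  by rewrite XE // H.
split=> // f [U [Uo Ux fU]].
rewrite (tangent_expand f sc Vo Vx Vc XE tv) big1 // => j _.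
have [/H ->|nPj] := boolP (P j); first by rewrite mul0r.
suff -> : pderiv c x j f = 0 by rewrite mulr0.
have Io : open (c @` (chart_dom c `&` (U `&` V))).
  by apply: chart_img_openI; exact: openI.
have [e e0 eI] : exists2 e, 0 < e & ball (c x) e `<=` c @` (chart_dom c `&` (U `&` V)).
  by apply: open_ball_sub Io _; exists x.
have N := ball_line (c x) (delta_mx ord0 j) e0.
rewrite /pderiv /derive; apply/cvg_lim => //.
apply: cvg_trans (_ : (fun=> 0) @ 0^' --> 0); last exact: cvg_cst.
apply: near_eq_cvg; apply: cvg_within.
apply: filterS N => h /(_ h (lexx _)) /= /eI [y [cy [Uy Vy]] E].
rewrite -E !cpullE // (fU x Ux Sx) fU ?subr0 ?scaler0 //.
apply/SP => // i Pi; rewrite E !mxE.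
have /SP -> // := Sx; rewrite addr0.
have -> : (i == j) = false by apply: contraNF nPj => /eqP <-.
by rewrite andbF mulr0.
Qed.

End TangentVectors.

(** * Characters of the algebra of smooth functions *)

Section Characters.
Variables (R : realType) (d : nat) (X : charted_space R d).
Hypothesis mX : is_manifold X.

Lemma manifold_good_atlas : good_atlas X.
Proof. by case: mX. Qed.
Let hX := manifold_good_atlas.

Lemma Cinfty_continuous (f : Cinfty X) : continuous (f : X -> R).
Proof.
move=> x; have [_ /(_ x)[c Ac cx] hc] := hX.
have sc : smooth_chart c by move=> c'; exact: hc.
have Icx : (c @` chart_dom c) (c x) by exists x.
have Cf := smooth_cont (smooth_cpull hX f sc) Icx.
have C : {for x, continuous (fun y => cpull c f (c y))}.
  exact: (continuous_comp (chart_cont cx) Cf).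
apply: near_eq_continuous C; apply: (@filterS _ (nbhs x) _ (chart_dom c)).
  by move=> y; exact: cpullE.
by apply: open_nbhs_nbhs; split=> //; exact: chart_dom_open.
Qed.

(** Second countability: each point has a bump equal to 1 on a basic open set around it, and one
    bump is kept per basic set, indexed by the number of that set. Indices without such a bump get
    the zero function. *)
Lemma countable_bumps : exists (rho : nat -> Cinfty X) (K : nat -> set X),
  [/\ forall k y, 0 <= rho k y <= 1, forall k, compact (K k),
      forall k y, ~ K k y -> rho k y = 0 &
      forall x, exists k (V : set X),
        [/\ open V, V x & forall y, V y -> rho k y = 1]].
Proof.
have [_ [B /countable_injP[num numI] [Bo Bb]] _ _] := mX.
pose P k (p : Cinfty X * set X) := exists A : set X, [/\ B A, num A = k,
  (forall y, A y -> p.1 y = 1), (forall y, 0 <= p.1 y <= 1) &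
  compact p.2 /\ forall y, ~ p.2 y -> p.1 y = 0].
have H k : exists p : Cinfty X * set X, ((exists q, P k q) -> P k p) /\
    [/\ forall y, 0 <= p.1 y <= 1, compact p.2 & forall y, ~ p.2 y -> p.1 y = 0].
  have [[p Pp]|nP] := pselect (exists q, P k q).
    by exists p; split=> //; case: Pp => A [_ _ _ ? []].
  exists (0, set0); split=> //; split=> //=; first by move=> y; rewrite lexx ler01.
  exact: compact0.
have [p Hp] := choice H.
exists (fun k => (p k).1), (fun k => (p k).2); split.
- by move=> k; case: (Hp k) => _ [].
- by move=> k; case: (Hp k) => _ [].
- by move=> k; case: (Hp k) => _ [].
move=> x; have [chi [V [K [ch01 [Vo Vx VK V1] [Kc _ _] chi0]]]] := bump hX openT (I : setT x).
have [A [BA Ax] AV] := Bb x V (open_nbhs_nbhs (conj Vo Vx)).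
exists (num A), A; split=> //; first exact: Bo.
have [|A' [BA' E A1 _ _]] := (Hp (num A)).1.
  by exists (chi, K), A; split=> //= y /AV; exact: V1.
have AA' : A' = A by apply: numI => //; exact: mem_set.
by rewrite AA' in A1.
Qed.

(** F is the sum over j of the products of 1 - rho_i, i <= j. Where some rho_k is 1 all terms from k
    on vanish, so the sum is locally finite; where rho_0, ..., rho_m vanish the terms up to m are 1,
    so F >= m+1. Hence F <= a <= m forces a point into one of K_0, ..., K_m. *)
Lemma proper_function : exists F : Cinfty X, forall a : R,
  exists2 K, compact K & forall y, F y <= a -> K y.
Proof.
have [rho [K [r01 Kc r0 r1]]] := countable_bumps.
pose T j y : R := \prod_(i < j.+1) (1 - rho i y).
have T0 k j y : rho k y = 1 -> (k <= j)%N -> T j y = 0.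
  move=> rk kj; rewrite /T (bigD1 (inord k)) //= inordK ?ltnS // rk subrr.
  by rewrite mul0r.
have ex y : exists k, rho k y == 1.
  by have [k [V [_ Vy V1]]] := r1 y; exists k; rewrite V1.
pose N y := ex_minn (ex y).
pose F y := \sum_(j < N y) T j y.
have FE k y : rho k y = 1 -> F y = \sum_(j < k) T j y.
  move=> rk; have Nk : (N y <= k)%N.
    by rewrite /N; case: ex_minnP => m _; apply; apply/eqP.
  have Ny : rho (N y) y = 1 by rewrite /N; case: ex_minnP => m /eqP.
  rewrite -!(big_mkord xpredT (fun j => T j y)) (big_cat_nat (leq0n _) Nk) //=.
  rewrite [X in _ = _ + X]big_nat_cond [X in _ = _ + X]big1 ?addr0 //.
    by rewrite big_mkord.
  by move=> j /andP[/andP[Nj _] _]; exact: T0 Ny Nj.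
have sT j V : open V -> smooth_on V (T j).
  move=> Vo; apply: smooth_on_prod => // i.
  exact: (@Cinfty_smooth_on _ _ _ (1 - rho i) V).
have sF : smooth_on setT F.
  apply: smooth_on_local => [|x _]; first exact: openT.
  have [k [V [Vo Vx V1]]] := r1 x; exists V; split=> //.
  apply: (@smooth_on_ext _ _ _ _ (fun y => \sum_(j < k) T j y)).
    by move=> y /V1 /FE.
  by apply: smooth_on_sum => // j; exact: sT.
exists (mkC sF) => a; pose m := Num.bound `|a|.
have am : a <= m%:R.
  apply: le_trans (ler_norm a) _; apply/ltW/archi_boundP; exact: normr_ge0.
exists (\big[setU/set0]_(i < m.+1) K i).
  elim/big_ind: _ => [|A B|i _]; last exact: Kc.
    exact: compact0.
  exact: compactU.
move=> y /= Fy; apply: contrapT => nK.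
have rz i : (i < m.+1)%N -> rho i y = 0.
  move=> im; apply: r0 => Ki; apply: nK; rewrite -bigcup_mkord.
  by exists i.
have mN : (m < N y)%N.
  rewrite ltnNge; apply/negP => Nm.
  have := rz _ Nm; rewrite (_ : rho (N y) y = 1); last first.
    by rewrite /N; case: ex_minnP => k /eqP.
  by move/eqP; rewrite oner_eq0.
have : m.+1%:R <= F y.
  rewrite /F -(big_mkord xpredT (fun j => T j y)) (big_cat_nat (leq0n _) mN) //=.
  rewrite big_mkord (eq_bigr (fun=> 1)); last first.
    move=> j _; rewrite /T big1 // => i _; rewrite rz ?subr0 //.
    by rewrite (leq_trans (ltn_ord i)).
  rewrite sumr_const card_ord lerDl; apply: sumr_ge0 => j _.
  by apply: prodr_ge0 => i _; rewrite subr_ge0; case/andP: (r01 i y).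
move=> H; have := le_trans H (le_trans Fy am).
by rewrite ler_nat ltnn.
Qed.

(* If every point x had a function f_x with phi f_x <> f_x x, then, F being
   proper, the sum of (F - phi F)^2 and of finitely many (f_x - phi f_x)^2 would
   be invertible and in the kernel of phi. *)
Lemma character_eval (phi : Cinfty X -> R) :
  (forall f g, phi (f + g) = phi f + phi g) ->
  (forall f g, phi (f * g) = phi f * phi g) ->
  (forall a f, phi (a *: f) = a * phi f) -> phi 1 = 1 ->
  exists x, forall f, phi f = f x.
Proof.
move=> pD pM pZ p1; apply: contrapT => /forallNP H.
have /choice[f fP] : forall x, exists f, phi f != f x.
  by move=> x; have /existsNP[f /eqP nf] := H x; exists f.
have [F Fp] := proper_function.
have [K Kc KF] := Fp (phi F).
pose sq (g : Cinfty X) := (g - phi g *: (1 : Cinfty X)) ^+ 2.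
have psq g : phi (sq g) = 0.
  rewrite /sq expr2 pM -scaleNr pD pZ p1 mulr1.
  by rewrite subrr mul0r.
have sqE g y : sq g y = (g y - phi g) ^+ 2.
  by rewrite Cinfty_exp !CinftyE mulr1.
(* Lists filtered by inclusion: compactness of K in its near-covering form, applied to this filter,
   yields a finite list D such that at each y in K some f_x with x in D differs from phi f_x. *)
pose fin : set_system (seq X) :=
  [set A : set (seq X) | exists s0 : seq X,
    forall s : seq X, {subset s0 <= s} -> A s].
have finF : Filter fin.
  split; first by exists [::].
    move=> A B [s1 H1] [s2 H2]; exists (s1 ++ s2) => s sub.
    by split; [apply: H1|apply: H2] => x xs; apply: sub; rewrite mem_cat xs ?orbT.
  by move=> A B AB [s0 HA]; exists s0 => s /HA /AB.
move/compact_near_coveringP : (Kc) => /(_ _ fin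
  (fun s y => exists2 x, x \in s & f x y != phi (f x)) finF).
case=> [y Ky|D HD].
  exists ([set z | f y z != phi (f y)], [set s : seq X | y \in s]); last first.
    by move=> [z s] /= [fz ys]; exists y.
  split; last by exists [:: y] => s; apply; rewrite inE.
  apply: open_nbhs_nbhs; split; last by rewrite /= eq_sym.
  apply: (@open_comp _ _ (f y : X -> R) [set t | t != phi (f y)]);
    last exact: open_neq.
  by move=> z _; exact: Cinfty_continuous.
have KD := HD D (fun _ => id).
pose g := sq F + \sum_(x <- D) sq (f x).
have pg : phi g = 0.
  rewrite pD psq add0r; elim: (D) => [|x s IH].
    by rewrite big_nil; have := pZ 0 0; rewrite scale0r mul0r.
  by rewrite big_cons pD psq IH addr0.
have g0 y : g y != 0.
  have -> : g y = sq F y + \sum_(x <- D) sq (f x) y by rewrite CinftyD Cinfty_sum.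
  rewrite sqE paddr_eq0 ?sqr_ge0 //; last first.
    by apply: sumr_ge0 => x _; rewrite sqE sqr_ge0.
  apply/negP => /andP[]; rewrite sqrf_eq0 subr_eq0 => /eqP Fy.
  have /KD[x xD fx] : K y by apply: KF; rewrite Fy.
  rewrite psumr_eq0; last by move=> z _; rewrite sqE sqr_ge0.
  move=> /allP /(_ x xD); rewrite implyTb sqE sqrf_eq0 subr_eq0.
  by rewrite (negbTE fx).
have sg := @smooth_onV _ _ _ setT _ openT (fun y _ => g0 y) (Cinfty_smooth_on g _).
have : phi (g * mkC sg) = 1.
  rewrite -p1; congr phi; apply: CinftyP => y.
  have -> : (g * mkC sg) y = g y * (g y)^-1 by [].
  by rewrite divff.
by rewrite pM pg mul0r => /esym/eqP; rewrite oner_eq0.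
Qed.

End Characters.

(** * Jets and higher tangent bundles *)

Section Truncated.
Variables (R : realType) (r : nat).
Implicit Types (p q : trunc R r).

Lemma trunc_size p : (size (p : {poly R}) <= r.+1)%N.
Proof.
have E : (size (mk_monic ('X^(r.+1) : {poly R}))).-1 = r.+1.
  by rewrite mk_monic_Xn size_polyXn.
by rewrite -[X in (_ <= X)%N]E; exact: size_npoly.
Qed.

Lemma in_trunc_coef (P : {poly R}) i : (i <= r)%N ->
  ((in_qpoly 'X^(r.+1) P : trunc R r) : {poly R})`_i = P`_i.
Proof.
move=> ir; have hm : ('X^(r.+1) : {poly R}) \is monic := monicXn R r.+1.
rewrite /= mk_monic_Xn [in RHS](Pdiv.RingMonic.rdivp_eq hm P) coefD coefMXn.
by rewrite ltnS ir add0r.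
Qed.

Lemma trunc_ext p q :
  (forall i, (i <= r)%N -> (p : {poly R})`_i = (q : {poly R})`_i) -> p = q.
Proof.
move=> pq; apply/val_inj/polyP => i; have [/pq//|ri] := leqP i r.
by rewrite !nth_default //; apply: leq_trans (trunc_size _) _.
Qed.

Lemma truncM_coef p q i : (i <= r)%N ->
  ((p * q : trunc R r) : {poly R})`_i =
  \sum_(j < i.+1) (p : {poly R})`_j * (q : {poly R})`_(i - j).
Proof.
move=> ir; have -> : p * q = in_qpoly 'X^(r.+1) ((p : {poly R}) * (q : {poly R})) by [].
by rewrite in_trunc_coef // coefM.
Qed.

Lemma truncD_coef p q i :
  ((p + q : trunc R r) : {poly R})`_i = (p : {poly R})`_i + (q : {poly R})`_i.
Proof. by rewrite coefD. Qed.

Lemma truncN_coef p i : ((- p : trunc R r) : {poly R})`_i = - (p : {poly R})`_i.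
Proof. by rewrite coefN. Qed.

Lemma truncZ_coef (a : R) p i :
  ((a *: p : trunc R r) : {poly R})`_i = a * (p : {poly R})`_i.
Proof. by rewrite coefZ. Qed.

Lemma trunc1_coef i : (i <= r)%N ->
  ((1 : trunc R r) : {poly R})`_i = (i == 0%N)%:R.
Proof.
move=> ir; have -> : (1 : trunc R r) = in_qpoly 'X^(r.+1) 1 by rewrite in_qpoly1.
by rewrite in_trunc_coef // coef1.
Qed.

Lemma trunc0_coef i : ((0 : trunc R r) : {poly R})`_i = 0.
Proof. by rewrite coef0. Qed.

End Truncated.

(** * Jets in coordinates *)

Section Jets.
Variables (R : realType) (n r : nat).
Notation jet_space := 'rV[R]_(n * r.+1).
Implicit Types (xi : jet_space) (f g h : 'rV[R]_n -> R) (B : set 'rV[R]_n).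

Definition jet_base xi : 'rV[R]_n := \row_a xi ord0 (mxvec_index a ord0).

(** The field d/d eps on truncated curves. Its component at i = r would involve a coefficient of
    eps^(r+1) and is set to 0, which does not affect [jetc j] for j <= r. *)
Definition jet_shift xi : jet_space := mxvec (\matrix_(a < n, i < r.+1)
  if (i < r)%N then i.+1%:R * xi ord0 (mxvec_index a (inord i.+1)) else 0).

(* The derivation with x_a^(i) |-> (i+1) x_a^(i+1); its j-th iterate on h is
   j! times the coefficient of eps^j in h (sum_i xi_i eps^i). *)
Definition total_derive (F : jet_space -> R) xi : R := 'D_(jet_shift xi) F xi.

Fixpoint jetc (j : nat) h : jet_space -> R :=
  if j is j'.+1 then fun xi => j%:R^-1 * total_derive (jetc j' h) xi
  else fun xi => h (jet_base xi).

Lemma jet_base_open B : open B -> open (jet_base @^-1` B).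
Proof.
move=> Bo; apply: open_comp => // xi _; apply: continuous_rV => a.
apply: (@near_eq_continuous R _ (fun t : jet_space => t ord0 (mxvec_index a ord0))).
  apply: (@filterS _ (nbhs xi) _ setT) => [t _|]; last exact: filterT.
  by rewrite mxE.
exact: coord_continuous.
Qed.

Lemma smooth_total_derive (U : set jet_space) (F : jet_space -> R) : open U ->
  smooth_rV U F -> smooth_rV U (total_derive F).
Proof.
move=> Uo sF; apply: (@smooth_ext _ _ _ (fun xi => \sum_k
   jet_shift xi ord0 k * 'D_(delta_mx ord0 k) F xi)) => // [xi Uxi|].
  by rewrite /total_derive (derive_sum_dir _ Uo (sF 1%N) Uxi).
apply: smooth_sum => // k _; apply: smoothM => //; last exact: smooth_D.
case/mxvec_indexP: k => a i.
apply: (@smooth_ext _ _ _ (fun xi => if (i < r)%N then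
  i.+1%:R * xi ord0 (mxvec_index a (inord i.+1)) else 0)) => // [xi _|].
  by rewrite mxvecE mxE.
case: (i < r)%N; last exact: smooth_cst.
by apply: smoothZ => //; exact: smooth_coord.
Qed.

Lemma smooth_jetc B h j : open B -> smooth_rV B h ->
  smooth_rV (jet_base @^-1` B) (jetc j h).
Proof.
move=> Bo sh; have TBo := jet_base_open Bo; elim: j => [|j IH] /=.
  apply: (smooth_comp TBo Bo _ _ sh) => // a.
  apply: (@smooth_ext _ _ _ (fun xi => xi ord0 (mxvec_index a ord0))) => //.
    by move=> xi _; rewrite mxE.
  exact: smooth_coord.
by apply: smoothZ => //; exact: smooth_total_derive.
Qed.

Lemma jetc_local B f g j xi : open B -> (forall y, B y -> f y = g y) ->
  B (jet_base xi) -> jetc j f xi = jetc j g xi.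
Proof.
move=> Bo fg; elim: j xi => [|j IH] xi Bxi /=; first exact: fg.
congr (_ * _); apply: near_eq_derive.
apply: (@filterS _ (nbhs xi) _ (jet_base @^-1` B)) => [z|]; first exact: IH.
by apply: open_nbhs_nbhs; split=> //; exact: jet_base_open.
Qed.

Lemma jetc_cst (a : R) j xi : jetc j (cst a) xi = if j == 0%N then a else 0.
Proof.
case: j => [//|j] /=; rewrite /total_derive.
have -> : jetc j (cst a) = cst (if j == 0%N then a else 0).
  elim: j => [//|j IH] /=; apply/funext => z.
  by rewrite /total_derive IH derive_cst mulr0.
by rewrite derive_cst mulr0.
Qed.

Lemma jetc_coord (a : 'I_n) j : (j <= r)%N ->
  jetc j (fun y => y ord0 a) = fun xi => xi ord0 (mxvec_index a (inord j)).
Proof.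
elim: j => [|j IH] jr; apply/funext => xi /=.
  by rewrite mxE; congr (xi _ (mxvec_index a _)); apply/val_inj; rewrite /= inordK.
rewrite /total_derive (IH (ltnW jr)).
have [_ ->] := @is_derive_coord R _ (mxvec_index a (inord j)) xi (jet_shift xi).
have E : (inord j : 'I_r.+1) = j :> nat by rewrite inordK // ltnS ltnW.
by rewrite mxvecE mxE E jr mulKf // pnatr_eq0.
Qed.

Lemma jetcD B f g j xi : open B -> smooth_rV B f -> smooth_rV B g ->
  B (jet_base xi) ->
  jetc j (fun y => f y + g y) xi = jetc j f xi + jetc j g xi.
Proof.
move=> Bo sf sg; have TBo := jet_base_open Bo.
elim: j xi => [//|j IH] xi Bxi /=; rewrite -mulrDr; congr (_ * _).
rewrite /total_derive (@near_eq_derive _ _ _ _ (jetc j f + jetc j g)).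
  by rewrite deriveD //; apply: (@smooth_derivable _ _ (jet_base @^-1` B)) => //;
    exact: smooth_jetc.
apply: (@filterS _ (nbhs xi) _ (jet_base @^-1` B)) => [z|]; first exact: IH.
exact: open_nbhs_nbhs.
Qed.

(** The Leibniz rule of the derivation, in which division by j! has absorbed the binomial
    coefficients; the induction step rests on i + (j+1-i) = j+1. *)
Lemma jetcM B f g j xi : open B -> smooth_rV B f -> smooth_rV B g ->
  B (jet_base xi) ->
  jetc j (fun y => f y * g y) xi =
  \sum_(i < j.+1) jetc i f xi * jetc (j - i) g xi.
Proof.
move=> Bo sf sg; have TBo := jet_base_open Bo.
have D h i z v : smooth_rV B h -> B (jet_base z) -> derivable (jetc i h) z v.
  move=> sh Bz; apply: (@smooth_derivable _ _ (jet_base @^-1` B)) => //.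
  exact: smooth_jetc.
have S h i z : total_derive (jetc i h) z = i.+1%:R * jetc i.+1 h z.
  by rewrite /= mulVKf // pnatr_eq0.
elim: j xi => [|j IH] xi Bxi; first by rewrite big_ord1.
rewrite [LHS]/= {1}/total_derive (@near_eq_derive _ _ _ _
  (\sum_(i < j.+1) (jetc i f * jetc (j - i) g))); last first.
  apply: (@filterS _ (nbhs xi) _ (jet_base @^-1` B)) => [z Bz|].
    by rewrite IH // fct_sumE.
  exact: open_nbhs_nbhs.
rewrite derive_sum; last by move=> i; apply: derivableM; exact: D.
apply: (canLR (mulKf _)); first by rewrite pnatr_eq0.
rewrite (eq_bigr (fun i : 'I_j.+1 =>
    i.+1%:R * (jetc i.+1 f xi * jetc (j.+1 - i.+1) g xi) +
    (j.+1 - i)%:R * (jetc i f xi * jetc (j.+1 - i) g xi))); last first.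
  move=> i _; rewrite deriveM; [|exact: D|exact: D].
  rewrite -/(total_derive (jetc (j - i) g) xi) -/(total_derive (jetc i f) xi).
  rewrite !S /GRing.scale /= subSS subSn ?leq_ord //.
  by rewrite addrC; congr (_ + _); [rewrite mulrC mulrA|rewrite mulrCA].
rewrite big_split /= mulr_sumr.
have -> : \sum_(i < j.+1) i.+1%:R * (jetc i.+1 f xi * jetc (j.+1 - i.+1) g xi) =
   \sum_(i < j.+2) i%:R * (jetc i f xi * jetc (j.+1 - i) g xi).
  by rewrite [RHS]big_ord_recl mul0r add0r; apply: eq_bigr => i _; rewrite lift0.
have -> : \sum_(i < j.+1) (j.+1 - i)%:R * (jetc i f xi * jetc (j.+1 - i) g xi) =
   \sum_(i < j.+2) (j.+1 - i)%:R * (jetc i f xi * jetc (j.+1 - i) g xi).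
  by rewrite [RHS]big_ord_recr /= subnn mul0r addr0.
rewrite -big_split; apply: eq_bigr => i _ /=.
by rewrite -mulrDl -natrD subnKC // -ltnS.
Qed.

Definition jet_kill (b : 'I_n) xi : jet_space := mxvec (\matrix_(a < n, i < r.+1)
  if a == b then 0 else xi ord0 (mxvec_index a i)).

Lemma jet_kill_shift b xi : jet_shift (jet_kill b xi) = jet_kill b (jet_shift xi).
Proof.
congr mxvec; apply/matrixP => a i; rewrite !mxE !mxvecE !mxE.
by case: eqP => _; rewrite ?mulr0 ?if_same.
Qed.

Lemma jet_kill_line b (t : R) v xi :
  jet_kill b (t *: v + xi) = t *: jet_kill b v + jet_kill b xi.
Proof.
apply/rowP => k; case/mxvec_indexP: k => a i.
by rewrite !mxE !mxvecE !mxE; case: eqP => _; rewrite ?mulr0 ?addr0 // !mxE.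
Qed.

(** Killing the b-th row is linear and commutes with [jet_shift], so it passes through every
    application of the derivation; at order 0 it is the projection onto x_b = p_b = 0. *)
Lemma jetc_kill b h j xi (p : 'rV[R]_n) : p ord0 b = 0 ->
  jetc j (fun y => h (retr p b 1 y)) xi = jetc j h (jet_kill b xi).
Proof.
move=> pb; elim: j xi => [|j IH] xi /=.
  congr h; apply/rowP => a; rewrite retrE !mxE mxvecE mxE pb subr0 mul1r subrr.
  by case: eqP.
congr (_ * _); rewrite /total_derive jet_kill_shift /derive.
congr (lim (_ @ 0^')); apply/funext => t /=.
by rewrite !IH jet_kill_line.
Qed.

Definition jet_trunc h xi : trunc R r :=
  in_qpoly 'X^(r.+1) (\poly_(j < r.+1) jetc j h xi).

Lemma jet_truncE h xi i : (i <= r)%N ->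
  (jet_trunc h xi : {poly R})`_i = jetc i h xi.
Proof. by move=> ir; rewrite in_trunc_coef // coef_poly ltnS ir. Qed.

End Jets.

(** * Points of the higher tangent bundle *)

Section HigherTangent.
Variables (R : realType) (n : nat) (M : charted_space R n) (r : nat).
Hypothesis hM : is_manifold M.
Let gM : good_atlas M := manifold_good_atlas hM.
Implicit Types (f g : Cinfty M) (u v : T_ M r) (c : chart R M n) (x y : M).

Lemma hcoefD f g i u : hcoef (f + g) i u = hcoef f i u + hcoef g i u.
Proof. by rewrite /hcoef rmorphD truncD_coef. Qed.

Lemma hcoefN f i u : hcoef (- f) i u = - hcoef f i u.
Proof. by rewrite /hcoef rmorphN truncN_coef. Qed.

Lemma hcoefZ a f i u : hcoef (a *: f) i u = a * hcoef f i u.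
Proof. by rewrite /hcoef ht_scalable truncZ_coef. Qed.

Lemma hcoefM f g i u : (i <= r)%N -> hcoef (f * g) i u =
  \sum_(j < i.+1) hcoef f j u * hcoef g (i - j) u.
Proof. by move=> ir; rewrite /hcoef rmorphM truncM_coef. Qed.

Lemma hcoef1 i u : (i <= r)%N -> hcoef 1 i u = (i == 0%N)%:R.
Proof. by move=> ir; rewrite /hcoef rmorph1 trunc1_coef. Qed.

Lemma hcoef0 i u : hcoef 0 i u = 0.
Proof. by rewrite /hcoef rmorph0 trunc0_coef. Qed.

Lemma hcoef_sum (I : Type) (s : seq I) (F : I -> Cinfty M) i u :
  hcoef (\sum_(k <- s) F k) i u = \sum_(k <- s) hcoef (F k) i u.
Proof.
elim: s => [|k s IH]; first by rewrite !big_nil hcoef0.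
by rewrite !big_cons hcoefD IH.
Qed.

Lemma base_point_ex u : exists x, base_point u x.
Proof.
have [||||x xE] := @character_eval _ _ _ hM (fun f => hcoef f 0 u).
- by move=> f g; exact: hcoefD.
- by move=> f g; rewrite hcoefM // big_ord1.
- by move=> a f; exact: hcoefZ.
- by rewrite hcoef1.
- by exists x.
Qed.

Lemma base_point_unique u x y : base_point u x -> base_point u y -> x = y.
Proof.
move=> ux uy; apply: contrapT => xy.
have cy : closed [set y].
  by apply: accessible_closed_set1; apply: hausdorff_accessible; case: gM.
have [chi [chix chiy]] := separating_bump gM cy xy.
have := ux chi; rewrite uy chix chiy // => /eqP.
by rewrite eq_sym oner_eq0.
Qed.

(** An element with non-zero constant term is a unit of the truncated polynomial ring, so it can be
    divided out modulo eps^k. *)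
Lemma trunc_mul_eq0 (p q : trunc R r) k : (k <= r.+1)%N ->
  (p : {poly R})`_0 != 0 ->
  (forall i, (i < k)%N -> ((p * q : trunc R r) : {poly R})`_i = 0) ->
  forall i, (i < k)%N -> (q : {poly R})`_i = 0.
Proof.
move=> kr p0 pq; elim/ltn_ind => i IH ik.
have := pq i ik; rewrite truncM_coef; last by rewrite -ltnS (leq_trans ik).
rewrite big_ord_recl subn0 big1 ?addr0 => [|j _]; last first.
  rewrite [X in _ * X]IH ?mulr0 //; last first.
    by apply: leq_ltn_trans ik; exact: leq_subr.
  by rewrite lift0 ltn_subrL /=; apply: leq_ltn_trans (ltn_ord j).
by move/eqP; rewrite mulf_eq0 (negbTE p0) /= => /eqP.
Qed.

(** A bump chi at x satisfies chi (f - g) = 0, while u(chi) has constant term chi(x) = 1 and can be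
    cancelled. *)
Lemma ht_local f g u x (U : set M) : base_point u x -> open U -> U x ->
  (forall y, U y -> f y = g y) -> ht_mor u f = ht_mor u g.
Proof.
move=> ux Uo Ux fg.
have [chi [V [K [_ [_ Vx _ V1] [_ _ KU] chi0]]]] := bump gM Uo Ux.
have E : chi * (f - g) = 0.
  apply: CinftyP => y; rewrite !CinftyE.
  have [Ky|/chi0 ->] := pselect (K y); last by rewrite mul0r.
  by rewrite fg ?subrr ?mulr0 //; exact: KU.
have H : forall i, (i < r.+1)%N -> (ht_mor u (f - g) : {poly R})`_i = 0.
  apply: (@trunc_mul_eq0 (ht_mor u chi)) => // [|i ir].
    by have := ux chi; rewrite /hcoef => ->; rewrite V1 // oner_eq0.
  by rewrite -rmorphM E rmorph0 trunc0_coef.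
apply: trunc_ext => i ir; apply/eqP; rewrite -subr_eq0 -truncN_coef -truncD_coef.
by rewrite -rmorphB H.
Qed.

Lemma hcoef_local f g u x (U : set M) i : base_point u x -> open U -> U x ->
  (forall y, U y -> f y = g y) -> hcoef f i u = hcoef g i u.
Proof. by move=> ux Uo Ux fg; rewrite /hcoef (ht_local ux Uo Ux fg). Qed.

Lemma ht_ext u v : (forall f i, (i <= r)%N -> hcoef f i u = hcoef f i v) -> u = v.
Proof.
move=> uv; have : forall f, ht_mor u f = ht_mor v f.
  by move=> f; apply: trunc_ext => i ir; exact: uv.
(* Equality of the underlying maps suffices: the remaining fields are proofs, identified by proof
   irrelevance. *)
case: u v {uv} => [[u cu] su] [[v cv] sv] /= /funext E; subst v.
case: cu su => -[a1] [a2] su; case: cv sv => -[b1] [b2] sv.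
have ab1 : a1 = b1 by exact: Prop_irrelevance.
have ab2 : a2 = b2 by exact: Prop_irrelevance.
by subst; congr HigherTangent; exact: Prop_irrelevance.
Qed.

(* Each Hadamard step multiplies by functions vanishing at the base point, so
   agreement modulo eps^m improves to agreement modulo eps^(m+1). *)
Lemma ht_coord_ext u v c x V (Xc : 'I_n -> Cinfty M) :
  smooth_chart c -> open V -> V x -> V `<=` chart_dom c ->
  (forall j y, V y -> Xc j y = c y ord0 j) ->
  base_point u x -> base_point v x ->
  (forall a i, (i <= r)%N -> hcoef (Xc a) i u = hcoef (Xc a) i v) -> u = v.
Proof.
move=> sc Vo Vx Vc XE ux vx uv; apply: ht_ext.
suff H m : forall f i, (i < m)%N -> (i <= r)%N -> hcoef f i u = hcoef f i v.
  by move=> f i; exact: (H i.+1).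
elim: m => [//|m IH] f i im ir.
have [g [W [Wo Wx Wc fE]]] := manifold_hadamard gM f sc (Vc _ Vx).
pose F := f x *: (1 : Cinfty M) +
   \sum_j (Xc j - c x ord0 j *: (1 : Cinfty M)) * g j.
have E (w : T_ M r) : base_point w x -> hcoef f i w = hcoef F i w.
  move=> wx; apply: (hcoef_local _ wx (openI Vo Wo)) => // y [Vy Wy].
  rewrite fE // !CinftyE mulr1 Cinfty_sum; congr (_ + _).
  by apply: eq_bigr => j _; rewrite !CinftyE mulr1 XE.
rewrite (E _ ux) (E _ vx) !hcoefD !hcoefZ !hcoef1 // !hcoef_sum; congr (_ + _).
apply: eq_bigr => j _; rewrite !hcoefM //; apply: eq_bigr => k _.
have ki : (k <= i)%N by rewrite -ltnS.
have kr : (k <= r)%N by apply: leq_trans ki _.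
rewrite !hcoefD !hcoefN !hcoefZ !hcoef1 // uv //.
case: (posnP k) => [->|k0].
  by rewrite !vx mulr1 XE // subrr !mul0r.
congr (_ * _); apply: IH; last by rewrite (leq_trans (leq_subr _ _)).
by rewrite ltn_subLR // (leq_trans im) // -add1n leq_add2r.
Qed.

Lemma hcoef_continuous f (i : 'I_r.+1) : continuous (hcoef f i : T_ M r -> R).
Proof.
move=> u; have H := @initial_continuous _ _ (@hcoefs R n M r) u.
exact: (cvg_comp _ _ H (@proj_continuous _ (fun=> R) (f, i) (hcoefs u))).
Qed.

Lemma cvg_higher_tangent (T : Type) (FF : set_system T) (FFF : Filter FF)
    (s : T -> T_ M r) u :
  (forall f (i : 'I_r.+1), (fun t => hcoef f i (s t)) @ FF --> hcoef f i u) ->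
  s @ FF --> u.
Proof.
move=> H; have C : (fun t => hcoefs (s t)) @ FF --> hcoefs u.
  apply/cvg_sup => -[f i] A [_ [[V Vo <-] Vu] VA].
  have : FF ((fun t => hcoef f i (s t)) @^-1` V).
    by apply: (H f i); apply: open_nbhs_nbhs.
  change (FF ((fun t => hcoef f i (s t)) @^-1` V) ->
    FF ((fun t => hcoefs (s t)) @^-1` A)).
  by apply: filterS => t Vt; exact: (VA (hcoefs (s t)) Vt).
move=> A [_ [[V Vo <-] Vu] VA].
have : FF ((fun t => hcoefs (s t)) @^-1` V).
  by apply: C; apply: open_nbhs_nbhs.
change (FF ((fun t => hcoefs (s t)) @^-1` V) -> FF (s @^-1` A)).
by apply: filterS => t Vt; exact: (VA (s t) Vt).
Qed.

(** Taking the jet of f at xi is linear, unital and, by [jetcM], multiplicative. The homomorphism so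
    defined supplies the points of T_r M with prescribed coordinates. *)
Lemma jet_point c (xi : 'rV[R]_(n * r.+1)) : smooth_chart c ->
  (c @` chart_dom c) (jet_base xi) ->
  exists u : T_ M r, forall f i, (i <= r)%N -> hcoef f i u = jetc i (cpull c f) xi.
Proof.
move=> sc Bxi; have Io : open (c @` chart_dom c) by exact: chart_img_open.
have sp f := smooth_cpull gM f sc.
pose phi f := jet_trunc (cpull c f) xi.
have phiE f i : (i <= r)%N -> (phi f : {poly R})`_i = jetc i (cpull c f) xi.
  exact: jet_truncE.
have pl (f : Cinfty M) (g1 : 'rV[R]_n -> R) i :
    (forall y, chart_dom c y -> f y = g1 (c y)) ->
    jetc i (cpull c f) xi = jetc i g1 xi.
  move=> fg; apply: (jetc_local _ Io) => // _ [y cy <-].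
  by rewrite cpullE ?fg.
have pZ a f : phi (a *: f) = a *: phi f.
  apply: trunc_ext => i ir; rewrite truncZ_coef !phiE //.
  rewrite (@pl _ (fun z : 'rV[R]_n => cst a z * cpull c f z)); last first.
    by move=> y cy; rewrite !CinftyE cpullE.
  rewrite (jetcM _ Io) //; last exact: smooth_cst.
  rewrite big_ord_recl [X in X * _]jetc_cst subn0 big1 ?addr0 // => j _.
  by rewrite jetc_cst lift0 mul0r.
have pD f g : phi (f + g) = phi f + phi g.
  apply: trunc_ext => i ir; rewrite truncD_coef !phiE //.
  rewrite -(jetcD _ Io) //; apply: pl => y cy.
  by rewrite !CinftyE !cpullE.
have hz : zmod_morphism phi.
  by move=> f g; rewrite pD -scaleN1r pZ scaleN1r.
have hm : monoid_morphism phi.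
  split=> [|f g]; apply: trunc_ext => i ir.
    by rewrite phiE // trunc1_coef // (@pl _ (cst 1)) // jetc_cst; case: (i).
  rewrite truncM_coef // phiE // (@pl _ (fun z : 'rV[R]_n => cpull c f z * cpull c g z)).
    rewrite (jetcM _ Io) //; apply: eq_bigr => j _.
    have ji : (j <= i)%N by rewrite -ltnS.
    by rewrite !phiE // (leq_trans _ ir) // leq_subr.
  by move=> y cy; rewrite !CinftyE !cpullE.
pose mor : {rmorphism Cinfty M -> trunc R r} := HB.pack phi
  (GRing.isZmodMorphism.Build _ _ phi hz) (GRing.isMonoidMorphism.Build _ _ phi hm).
have sm : scalable mor by move=> a f; exact: pZ.
by exists (HigherTangent sm) => f i ir; exact: phiE.
Qed.

End HigherTangent.

(** * The charts of the higher tangent bundle *)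

Section HigherTangentCharts.
Variables (R : realType) (n : nat) (M : charted_space R n) (r : nat).
Hypothesis hM : is_manifold M.
Let gM : good_atlas M := manifold_good_atlas hM.
Implicit Types (f g : Cinfty M) (u v : T_ M r) (c : chart R M n) (x y : M).

Definition Tmap (Xc : 'I_n -> Cinfty M) u : 'rV[R]_(n * r.+1) :=
  mxvec (\matrix_(a < n, i < r.+1) hcoef (Xc a) i u).

Definition Tdom c : set (T_ M r) :=
  [set u | exists2 y, chart_dom c y & base_point u y].

Lemma TmapE Xc u a (i : 'I_r.+1) :
  Tmap Xc u ord0 (mxvec_index a i) = hcoef (Xc a) i u.
Proof. by rewrite mxvecE mxE. Qed.

(** For a bump chi vanishing off a subset of the chart, chi^(0) is the value of chi at the base
    point; where it does not vanish, the base point lies in the chart. *)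
Lemma Tdom_open c : open (Tdom c).
Proof.
rewrite openE => u [y cy uy].
have [chi [V [K [_ [_ Vy _ V1] [_ _ Kc] chi0]]]] :=
  bump gM (@chart_dom_open _ _ _ c) cy.
have Ho : open (hcoef chi (ord0 : 'I_r.+1) @^-1` [set t : R | t != 0] : set (T_ M r)).
  by apply: open_comp; [move=> w _; exact: hcoef_continuous|exact: open_neq].
apply: (@filterS _ (nbhs u) _ _ _ _ (open_nbhs_nbhs (conj Ho _))).
  move=> w /= cw; have [z wz] := base_point_ex hM w; exists z => //.
  apply: Kc; apply: contrapT => /chi0 H.
  by move: cw; rewrite wz H eqxx.
by rewrite /= uy V1 // oner_eq0.
Qed.

Section GoodChart.
Variables (c : chart R M n) (Xc : 'I_n -> Cinfty M).
Hypothesis sc : smooth_chart c.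
Hypothesis XcE : forall y a, chart_dom c y -> c y ord0 a = Xc a y.

Lemma jet_base_Tmap u y : chart_dom c y -> base_point u y ->
  jet_base (Tmap Xc u) = c y.
Proof. by move=> cy uy; apply/rowP => a; rewrite mxE TmapE uy XcE. Qed.

Lemma good_chart_ext u v y : chart_dom c y -> base_point u y ->
  base_point v y -> (forall a i, (i <= r)%N -> hcoef (Xc a) i u = hcoef (Xc a) i v) ->
  u = v.
Proof.
move=> cy uy vy; apply: (ht_coord_ext hM sc (@chart_dom_open _ _ _ c) cy) => //.
by move=> a z cz; rewrite XcE.
Qed.

Lemma jet_point_Tmap (xi : 'rV[R]_(n * r.+1)) :
  (c @` chart_dom c) (jet_base xi) -> exists u : T_ M r,
  [/\ Tdom c u, Tmap Xc u = xi &
      forall f i, (i <= r)%N -> hcoef f i u = jetc i (cpull c f) xi].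
Proof.
move=> Bxi; have [y cy yxi] := Bxi.
have [u uE] := jet_point hM sc Bxi; exists u; split=> //.
  by exists y => // f; rewrite uE //= -yxi cpullE.
have Io : open (c @` chart_dom c) by exact: chart_img_open.
apply/rowP => k; case/mxvec_indexP: k => a i.
rewrite TmapE uE ?leq_ord //.
rewrite (@jetc_local _ _ _ _ _ (fun z => z ord0 a) _ _ Io) //; last first.
  by move=> _ [z cz <-]; rewrite cpullE // XcE.
by rewrite jetc_coord ?leq_ord // inord_val.
Qed.

(** By uniqueness, u is the homomorphism that [jet_point_Tmap] builds from the coordinates of u.
    This exhibits f^(i) as a smooth function of these coordinates. *)
Lemma hcoef_jet f i u : Tdom c u -> (i <= r)%N ->
  hcoef f i u = jetc i (cpull c f) (Tmap Xc u).
Proof.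
move=> [y cy uy] ir.
have Bxi : (c @` chart_dom c) (jet_base (Tmap Xc u)).
  by exists y => //; rewrite (jet_base_Tmap cy uy).
have [v [[z cz vz] vu vE]] := jet_point_Tmap Bxi; rewrite -vE //.
have zy : z = y.
  apply: (chart_inj (c:=c)); [exact: mem_set|exact: mem_set|].
  by rewrite -(jet_base_Tmap cz vz) vu (jet_base_Tmap cy uy).
rewrite zy in vz; congr hcoef; apply: (good_chart_ext cy uy vz) => a j jr.
have := congr1 (fun w : 'rV[R]_(n * r.+1) => w ord0 (mxvec_index a (inord j))) vu.
by rewrite /= !TmapE inordK.
Qed.

Lemma Tmap_inj : {in Tdom c &, injective (Tmap Xc)}.
Proof.
move=> u v /set_mem Du /set_mem Dv uv.
by apply: ht_ext => f i ir; rewrite !hcoef_jet // uv.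
Qed.

Lemma Tmap_continuous u : Tdom c u -> {for u, continuous (Tmap Xc)}.
Proof.
move=> _; apply: continuous_rV => k; case/mxvec_indexP: k => a i.
apply: (@near_eq_continuous R _ (hcoef (Xc a) i)); last exact: hcoef_continuous.
by apply: (@filterS _ (nbhs u) _ setT) => [v _|]; [rewrite TmapE|exact: filterT].
Qed.

(** Points with given coordinates are chosen one by one. The resulting section s is continuous at xi
    since the coefficients of s z are the smooth functions [jetc i] of z, so the preimage of V under
    s is a neighbourhood of xi. *)
Lemma Tmap_open (V : set (T_ M r)) : open V -> V `<=` Tdom c ->
  open (Tmap Xc @` V).
Proof.
move=> Vo VD; have Io : open (c @` chart_dom c) by exact: chart_img_open.
rewrite openE => _ [u Vu <-]; have [y cy uy] := VD _ Vu.
set xi := Tmap Xc u; pose TB := (@jet_base R n r) @^-1` (c @` chart_dom c) : set 'rV[R]_(n * r.+1).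
have TBo : open TB by exact: jet_base_open.
have TBxi : TB xi by exists y => //; rewrite (jet_base_Tmap cy uy).
have : forall z, exists w : T_ M r, TB z -> Tmap Xc w = z /\
    forall f i, (i <= r)%N -> hcoef f i w = jetc i (cpull c f) z.
  move=> z; have [Bz|nBz] := pselect (TB z); last by exists u.
  by have [w [_ wz wE]] := jet_point_Tmap Bz; exists w.
case/choice=> s sE.
have NTB : nbhs xi TB by exact: open_nbhs_nbhs.
have C : s @ xi --> u.
  apply: (@cvg_higher_tangent R n M r _ (nbhs xi) _ s u) => f i.
  rewrite hcoef_jet ?leq_ord //; last exact: VD.
  have NE : \forall z \near xi, jetc i (cpull c f) z = hcoef f i (s z).
    by apply: filterS NTB => z Bz; rewrite (sE z Bz).2 // leq_ord.
  have CJ : {for xi, continuous (@jetc R n r i (cpull c f))}.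
    apply: (@smooth_cont _ _ TB _ _ _ TBxi).
    by apply: smooth_jetc => //; exact: smooth_cpull.
  exact: cvg_trans (near_eq_cvg NE) CJ.
have NV : nbhs xi (s @^-1` V) by apply: C; exact: open_nbhs_nbhs.
apply: filterS (filterI NTB NV) => z [Bz Vz].
by exists (s z) => //; rewrite (sE z Bz).1.
Qed.

Definition Tchart : chart R (higher_tangent M r) (n * r.+1) :=
  Chart (Tdom_open c) Tmap_inj Tmap_continuous Tmap_open.

Lemma Tchart_atlas : @atlas R _ (T_ M r) Tchart.
Proof. by exists c, Xc. Qed.

End GoodChart.

Lemma hcoef_smooth_in f i (C : chart R (T_ M r) (n * r.+1)) : atlas C ->
  (i <= r)%N -> smooth_in_chart C setT (hcoef f i).
Proof.
move=> [c [Xc [sc XcE CD CE]]] ir.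
exists (jetc i (cpull c f)) => [|u Cu _]; last first.
  by rewrite CE // (hcoef_jet sc XcE) // -[X in X u]CD.
have Io : open (c @` chart_dom c) by exact: chart_img_open.
have H := smooth_jetc r i Io (smooth_cpull gM f sc).
apply: (@smooth_mono _ _ _ _ _ _ H).
move=> _ [u [Cu _] <-]; move: (Cu); rewrite CD => -[y cy uy].
by exists y => //; rewrite CE // (jet_base_Tmap XcE cy uy).
Qed.

Lemma smooth_hcoef f i : (i <= r)%N ->
  smooth_on (X := T_ M r) setT (hcoef f i).
Proof. by move=> ir C AC; exact: hcoef_smooth_in. Qed.

Definition Chcoef f (i : 'I_r.+1) : Cinfty (T_ M r) :=
  mkC (smooth_hcoef f (leq_ord i)).

Lemma T_good_atlas : good_atlas (T_ M r).
Proof.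
split.
- move=> u v uv; apply: ht_ext => f i ir; apply: Rhausdorff => A B fA fB.
  have cf : continuous (hcoef f i : T_ M r -> R).
    have ir' : (i < r.+1)%N by [].
    by move=> w; exact: (@hcoef_continuous R n M r f (Ordinal ir') w).
  have [w [Aw Bw]] := uv _ _ (cf u _ fA) (cf v _ fB).
  by exists (hcoef f i w).
- move=> u; have [y uy] := base_point_ex hM u.
  have [_ /(_ y)[c Ac cy] hc] := gM.
  have sc : smooth_chart c by move=> c'; exact: hc.
  have [Xc [V [Vo Vy Vc XE]]] := local_coordinates gM sc cy.
  have sc' := smooth_chart_restr Vo sc.
  have XE' : forall z a, chart_dom (chart_restr c Vo) z ->
      chart_restr c Vo z ord0 a = Xc a z.
    by move=> z a [_ Vz]; rewrite XE.
  exists (Tchart sc' XE'); first exact: Tchart_atlas.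
  by exists y.
- move=> C C' AC AC' k; case/mxvec_indexP: k => a i; split.
    have [c [Xc [sc XcE CD CE]]] := AC'.
    apply: (@smooth_in_chart_ext _ _ _ _ _ (hcoef (Xc a) i)).
      by move=> u Cu; rewrite CE // mxvecE mxE.
    apply: (@smooth_in_chart_mono _ _ _ _ setT) => //.
    by apply: hcoef_smooth_in => //; exact: leq_ord.
  have [c [Xc [sc XcE CD CE]]] := AC.
  apply: (@smooth_in_chart_ext _ _ _ _ _ (hcoef (Xc a) i)).
    by move=> u Cu; rewrite CE // mxvecE mxE.
  apply: (@smooth_in_chart_mono _ _ _ _ setT) => //.
  by apply: hcoef_smooth_in => //; exact: leq_ord.
Qed.

End HigherTangentCharts.

(** * Weightings *)

Section EpsOrder.
Variables (R : realType) (r : nat).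
Implicit Types (p q : trunc R r).

Definition eps_ord k p := forall j, (j < k)%N -> (p : {poly R})`_j = 0.

Lemma eps_ord0 p : eps_ord 0 p. Proof. by []. Qed.

Lemma eps_ordM k l p q : eps_ord k p -> eps_ord l q -> eps_ord (k + l) (p * q).
Proof.
move=> pk ql j jkl; have [jr|rj] := leqP j r; last first.
  by rewrite nth_default // (leq_trans (trunc_size _)).
rewrite truncM_coef // big1 // => i _; have [ik|ki] := ltnP i k.
  by rewrite pk ?mul0r.
rewrite [X in _ * X]ql ?mulr0 // ltn_subLR; last by rewrite -ltnS.
by apply: leq_trans jkl _; rewrite leq_add2r.
Qed.

Lemma eps_ordX k m p : eps_ord k p -> eps_ord (m * k) (p ^+ m).
Proof.
move=> pk; elim: m => [|m IH]; first by rewrite mul0n; exact: eps_ord0.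
by rewrite exprS mulSn; exact: eps_ordM.
Qed.

Lemma eps_ord_prod (I : Type) (s : seq I) (k : I -> nat) (F : I -> trunc R r) :
  (forall i, eps_ord (k i) (F i)) ->
  eps_ord (\sum_(i <- s) k i) (\prod_(i <- s) F i).
Proof.
move=> kF; elim: s => [|i s IH]; first by rewrite big_nil; exact: eps_ord0.
by rewrite !big_cons; exact: eps_ordM.
Qed.

Lemma eps_ord_sum (I : Type) (s : seq I) k (F : I -> trunc R r) :
  (forall i, eps_ord k (F i)) -> eps_ord k (\sum_(i <- s) F i).
Proof.
move=> kF; elim: s => [|i s IH] j jk; first by rewrite big_nil trunc0_coef.
by rewrite big_cons truncD_coef kF // IH // addr0.
Qed.

Lemma eps_exp j :
  (in_qpoly 'X^(r.+1) 'X : trunc R r) ^+ j = in_qpoly 'X^(r.+1) 'X^j.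
Proof.
elim: j => [|j IH]; first by rewrite !expr0 in_qpoly1.
by rewrite (exprS (in_qpoly 'X^(r.+1) 'X : trunc R r) j) IH (exprS 'X j) in_qpolyM.
Qed.

Lemma eps_expand p : p = \sum_(j < r.+1) (p : {poly R})`_j *:
  (in_qpoly 'X^(r.+1) 'X : trunc R r) ^+ j.
Proof.
apply: trunc_ext => i ir.
have S (F : nat -> trunc R r) m : ((\sum_(j < m) F j : trunc R r) : {poly R})`_i =
    \sum_(j < m) (F j : {poly R})`_i.
  elim: m => [|m IH]; first by rewrite !big_ord0 trunc0_coef.
  by rewrite !big_ord_recr truncD_coef IH.
rewrite (S (fun j => (p : {poly R})`_j *: (in_qpoly 'X^(r.+1) 'X : trunc R r) ^+ j)).
rewrite (bigD1 (Ordinal (ir : (i < r.+1)%N))) //= truncZ_coef eps_exp in_trunc_coef //.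
rewrite coefXn eqxx mulr1 big1 ?addr0 // => j ji.
rewrite truncZ_coef eps_exp in_trunc_coef // coefXn.
by case: eqP => [ij|_]; [rewrite -val_eqE /= ij eqxx in ji|rewrite mulr0].
Qed.

(** Psi(eps) is nilpotent, so it has no constant term, and Psi sends eps^j to an element of order at
    least j. *)
Lemma eps_ord_Lambda (Psi : Lambda R r) k p : eps_ord k p -> eps_ord k (Psi p).
Proof.
move=> pk; set eps := (in_qpoly 'X^(r.+1) 'X : trunc R r).
have e1 : eps_ord 1 (Psi eps).
  have X0 m (q : trunc R r) : (q ^+ m : {poly R})`_0 = (q : {poly R})`_0 ^+ m.
    elim: m => [|m IH]; first by rewrite !expr0 trunc1_coef.
    have -> : q ^+ m.+1 = q * q ^+ m by exact: exprS.
    by rewrite truncM_coef // big_ord1 IH -exprS.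
  have E : Psi eps ^+ r.+1 = 0.
    rewrite -rmorphXn eps_exp -[RHS](rmorph0 Psi); congr (Psi _).
    apply: trunc_ext => i ir; rewrite in_trunc_coef // coefXn trunc0_coef.
    by rewrite ltn_eqF.
  move=> [|//] _; apply/eqP; have := X0 r.+1 (Psi eps); rewrite E trunc0_coef.
  by move/esym/eqP; rewrite expf_eq0.
rewrite [p]eps_expand linear_sum /=; apply: eps_ord_sum => j i ik.
rewrite linearZ rmorphXn truncZ_coef.
have [jk|kj] := ltnP j k; first by rewrite pk // mul0r.
have := eps_ordX (m := j) e1; rewrite muln1 => H.
by rewrite (H i (leq_trans ik kj)) mulr0.
Qed.

End EpsOrder.

(** * Weighted coordinates and the base N *)

Section Weights.
Variables (R : realType) (n : nat) (M : charted_space R n) (r : nat).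
Variables (N : set M) (W : weighting M r).
Hypothesis hM : is_manifold M.
Hypothesis hW : weighting_along W N.
Let gM : good_atlas M := manifold_good_atlas hM.
Implicit Types (f g : M -> R) (c : chart R M n) (w : 'I_n -> nat) (x y : M).
Implicit Types (U V K : set M).

Lemma wfilt_le i j U : open U -> (i <= j)%N -> wfilt W j U `<=` wfilt W i U.
Proof.
move=> Uo ij; rewrite -(subnK ij); elim: (j - i)%N => [//|m IH] f.
by rewrite addSn => /(wfilt_decr Uo); exact: IH.
Qed.

Lemma monomial0 w (s : 'I_n -> nat) (y : 'rV[R]_n) :
  (forall a, (0 < w a)%N -> y ord0 a = 0) -> (0 < \sum_a s a * w a)%N ->
  monomial s y = 0.
Proof.
move=> y0; rewrite lt0n sum_nat_eq0 => /forallPn[a]; rewrite implyTb.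
rewrite muln_eq0 negb_or -!lt0n => /andP[sa wa].
by rewrite /monomial (bigD1 a) //= y0 // expr0n -[(s a == 0)%N]negbK -lt0n sa mul0r.
Qed.

Lemma wfilt_monomial c w (s : 'I_n -> nat) : weighted_chart W c w ->
  wfilt W (\sum_a s a * w a) (chart_dom c) (fun x => monomial s (c x)).
Proof.
case=> sc _ H; apply/H; exists 1%N, (fun _ => cst 1), (fun _ => s); split.
  by move=> _; split=> //; apply: smooth_on_cst; exact: chart_dom_open.
by move=> x _; rewrite big_ord1 mul1r.
Qed.

Lemma monomial_delta (a : 'I_n) m (y : 'rV[R]_n) :
  monomial (fun b => (b == a) * m)%N y = y ord0 a ^+ m.
Proof.
rewrite /monomial (bigD1 a) //= eqxx mul1n big1 ?mulr1 // => b /negbTE ->.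
by rewrite mul0n expr0.
Qed.

Lemma sum_delta (a : 'I_n) m w :
  (\sum_b (b == a) * m * w b)%N = (m * w a)%N.
Proof.
rewrite (bigD1 a) //= eqxx mul1n big1 ?addn0 // => b /negbTE ->.
by rewrite !mul0n.
Qed.

Lemma wfilt_coordX c w a m : weighted_chart W c w ->
  wfilt W (m * w a) (chart_dom c) (fun x => c x ord0 a ^+ m).
Proof.
move=> /(wfilt_monomial (fun b => (b == a) * m)%N); rewrite sum_delta.
apply: wfilt_local; first exact: chart_dom_open.
by move=> x _; rewrite monomial_delta.
Qed.

Lemma wfilt_coord c w a : weighted_chart W c w ->
  wfilt W (w a) (chart_dom c) (fun x => c x ord0 a).
Proof. by move=> /(wfilt_coordX a 1); rewrite mul1n. Qed.

(** For the converse, a bump equal to 1 at a point off N and to 0 on N lies in the first ideal, so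
    on the chart it is a combination of monomials of positive weight; these vanish where all
    coordinates of positive weight do. *)
Lemma weighted_base c w x : weighted_chart W c w -> chart_dom c x ->
  N x <-> forall a, (0 < w a)%N -> c x ord0 a = 0.
Proof.
move=> wc cx; have co := @chart_dom_open _ _ _ c; case: hW => Nc _ NW.
split=> [Nx a wa|x0].
  have := wfilt_le co wa (wfilt_coord a wc).
  by case/(NW _ _ co) => _; exact.
apply: contrapT => nNx.
have [chi [chix chi0]] := separating_bump gM Nc nNx.
have : wfilt W 1 (chart_dom c) chi.
  by apply/(NW _ _ co); split=> [|y _]; [exact: Cinfty_smooth_on|exact: chi0].
case: wc => _ _ H /H [m [g [s [gs /(_ x cx)]]]].
rewrite chix big1 => [/eqP|k _]; first by rewrite oner_eq0.
by rewrite (monomial0 x0) ?mulr0 //; exact: (gs k).2.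
Qed.

Lemma wfilt_cutoff (chi : Cinfty M) K U i f : open U -> closed K -> K `<=` U ->
  (forall y, ~ K y -> chi y = 0) -> wfilt W i U f ->
  wfilt W i setT (fun y => chi y * f y).
Proof.
move=> Uo Kc KU chi0 fU; apply: wfilt_glue => [|y _]; first exact: openT.
have [Ky|nKy] := pselect (K y).
  exists U; split=> //; first exact: KU.
  by apply: wfilt_mul => //; exact: Cinfty_smooth_on.
have Kco : open (~` K) by exact: closed_openC.
exists (~` K); split=> //.
apply: (wfilt_local Kco _ (wfilt_zero W i Kco)) => z nKz.
by rewrite chi0 // mul0r.
Qed.

(** Global coordinate functions of the same filtration degree give charts of T_r M and membership
    tests for Q; an image that is a ball centred at c x is stable under the retractions [retr]. *)
Lemma good_weighted_chart c w x : weighted_chart W c w -> chart_dom c x ->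
  exists (c' : chart R M n) (Xc : 'I_n -> Cinfty M) (e : R),
  [/\ smooth_chart c' /\ (forall y a, chart_dom c' y -> c' y ord0 a = Xc a y),
      chart_dom c' x /\ chart_dom c' `<=` chart_dom c,
      (forall y, c' y = c y),
      0 < e /\ c' @` chart_dom c' = ball (c x) e &
      forall a, wfilt W (w a) setT (Xc a)].
Proof.
move=> wc cx; have co := @chart_dom_open _ _ _ c; have [sc _ _] := wc.
have [chi [V [K [_ [Vo Vx VK V1] [_ Kc Kd] chi0]]]] := bump gM co cx.
pose Xc a := mkC (smooth_cutoff co Kc Kd chi0 (smooth_coord_on a sc)).
have Io : open (c @` (chart_dom c `&` V)) by exact: chart_img_openI.
have [e e0 eI] : exists2 e, 0 < e & ball (c x) e `<=` c @` (chart_dom c `&` V).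
  by apply: open_ball_sub Io _; exists x.
have Uo := openI Vo (chart_preimage_open c (ball_open (c x) e)).
exists (chart_restr c Uo), Xc, e; split=> //.
- split; first exact: smooth_chart_restr.
  by move=> y a [_ [Vy _]] /=; rewrite V1 // mul1r.
- split; last by move=> y [].
  by split=> //; split=> //; split=> //; exact: ballxx.
- split=> //; apply/seteqP; split=> [_ [y [_ [_ [_ By]]] <-] //|z Bz].
  by have [y [cy Vy] yz] := eI _ Bz; exists y => //=; rewrite yz.
- by move=> a; apply: (wfilt_cutoff co Kc Kd chi0); exact: wfilt_coord.
Qed.

End Weights.

Section QCharacterization.
Variables (R : realType) (n : nat) (M : charted_space R n) (r : nat).
Variables (N : set M) (W : weighting M r).
Hypothesis hM : is_manifold M.
Hypothesis hW : weighting_along W N.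
Let gM : good_atlas M := manifold_good_atlas hM.
Variables (c c' : chart R M n) (w : 'I_n -> nat) (Xc : 'I_n -> Cinfty M).
Hypothesis wc : weighted_chart W c w.
Hypothesis c'c : chart_dom c' `<=` chart_dom c.
Hypothesis c'E : forall y, c' y = c y.
Hypothesis XcE : forall y a, chart_dom c' y -> c' y ord0 a = Xc a y.
Hypothesis Xcw : forall a, wfilt W (w a) setT (Xc a).

Lemma Qset_coord (u : T_ M r) : Tdom c' u ->
  Qset W u <-> forall a j, (j < w a)%N -> hcoef (Xc a) j u = 0.
Proof.
have [sc [_ wr] wI] := wc; move=> [y c'y uy]; split=> [Qu a j jw|H].
  exact: Qu (wr a) (Xcw a).
have c'o := @chart_dom_open _ _ _ c'; have co := @chart_dom_open _ _ _ c.
move=> f i j ji ir fi.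
have /wI [m [g [s [gs fE]]]] : wfilt W i (chart_dom c) f.
  by apply: (wfilt_res openT co _ fi).
have [|G [V [Vo Vy Vc GE]]] := @extension _ _ _ gM _ y _ g co (c'c c'y).
  by move=> k; case: (gs k).
pose F := \sum_(k < m) G k * \prod_(a < n) Xc a ^+ s k a.
have -> : hcoef f j u = hcoef F j u.
  apply: (hcoef_local hM _ uy (openI Vo c'o)) => // z [Vz c'z].
  rewrite fE; last exact: c'c.
  rewrite Cinfty_sum; apply: eq_bigr => k _; rewrite CinftyM GE //; congr (_ * _).
  rewrite Cinfty_prod; apply: eq_bigr => a _.
  by rewrite Cinfty_exp -c'E XcE.
rewrite hcoef_sum big1 // => k _; rewrite /hcoef rmorphM rmorph_prod.
have : eps_ord (0 + \sum_a s k a * w a) (ht_mor u (G k) * \prod_a ht_mor u (Xc a ^+ s k a)).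
  apply: eps_ordM; first exact: eps_ord0.
  by apply: eps_ord_prod => a; rewrite rmorphXn; apply: eps_ordX => l; exact: H.
by apply; rewrite add0n (leq_trans ji) //; case: (gs k).
Qed.

End QCharacterization.

(** * Submanifolds and tangent spaces along the zero section *)

Section PermutedChart.
Variables (R : realType) (d : nat) (X : charted_space R d).
Implicit Types (C : chart R X d) (s : 'S_d).

Lemma col_perm_continuous s : continuous (col_perm s : 'rV[R]_d -> 'rV[R]_d).
Proof.
move=> y; apply: continuous_rV => j.
apply: (@near_eq_continuous R _ (fun t : 'rV[R]_d => t ord0 (s j))).
  apply: (@filterS _ (nbhs y) _ setT) => [t _|]; last exact: filterT.
  by rewrite mxE.
exact: coord_continuous.
Qed.

Lemma col_permKV s (y : 'rV[R]_d) : col_perm (s^-1)%g (col_perm s y) = y.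
Proof. by apply/rowP => j; rewrite !mxE permKV. Qed.

Lemma col_permK s (y : 'rV[R]_d) : col_perm s (col_perm (s^-1)%g y) = y.
Proof. by apply/rowP => j; rewrite !mxE permK. Qed.

Fact chart_perm_inj C s :
  {in chart_dom C &, injective (fun x => col_perm s (C x))}.
Proof.
move=> x y Cx Cy /(congr1 (col_perm (s^-1)%g)); rewrite !col_permKV.
exact: chart_inj.
Qed.

Fact chart_perm_cont C s x : chart_dom C x ->
  {for x, continuous (fun x => col_perm s (C x))}.
Proof.
move=> Cx; exact: (continuous_comp (chart_cont Cx) (@col_perm_continuous s (C x))).
Qed.

Fact chart_perm_open C s (V : set X) : open V -> V `<=` chart_dom C ->
  open ((fun x => col_perm s (C x)) @` V).
Proof.
move=> Vo VC.
have -> : (fun x => col_perm s (C x)) @` V = col_perm (s^-1)%g @^-1` (C @` V).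
  apply/seteqP; split=> [_ [x Vx <-]|y [x Vx E]].
    by exists x => //; rewrite col_permKV.
  by exists x => //; rewrite E col_permK.
apply: open_comp; first by move=> y _; exact: col_perm_continuous.
exact: chart_open.
Qed.

Definition chart_perm C s : chart R X d :=
  Chart (@chart_dom_open _ _ _ C) (@chart_perm_inj C s) (@chart_perm_cont C s)
    (@chart_perm_open C s).

Lemma smooth_chart_perm C s : smooth_chart C -> smooth_chart (chart_perm C s).
Proof.
move=> sC C' AC' j; split; last first.
  have [_ [h sh hE]] := sC C' AC' (s j).
  by exists h => // x C'x Cx /=; rewrite mxE hE.
have [[h sh hE] _] := sC C' AC' j.
have C'o := @chart_dom_open _ _ _ C'.
exists (fun y => h (col_perm (s^-1)%g y)) => [|x Cx C'x] /=; last first.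
  by rewrite col_permKV hE.
apply: (smooth_comp _ _ _ _ sh).
- exact: (@chart_img_openI R d X (chart_perm C s)).
- exact: (@chart_img_openI R d X C).
- by move=> _ [x Cx <-] /=; exists x => //; rewrite col_permKV.
- move=> k; apply: (@smooth_ext _ _ _ (fun y => y ord0 ((s^-1)%g k))).
  + exact: (@chart_img_openI R d X (chart_perm C s)).
  + by move=> y _; rewrite mxE.
  + by apply: smooth_coord; exact: (@chart_img_openI R d X (chart_perm C s)).
Qed.

(** Submanifold charts have their free coordinates in front; the permutation lists the coordinates
    outside P and then those in P. *)
Lemma sorting_perm (P : pred 'I_d) :
  exists s : 'S_d, forall j, P (s j) = (#|[pred k | ~~ P k]| <= j)%N.
Proof.
pose L := enum [pred k | ~~ P k] ++ enum P.
have sL : size L == d.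
  rewrite size_cat -!cardE; apply/eqP.
  by rewrite addnC -[RHS]card_ord -(cardC P); congr (_ + _)%N; exact: eq_card.
have uL : uniq L.
  rewrite cat_uniq !enum_uniq andbT; apply/hasPn => k; rewrite mem_enum => Pk.
  by rewrite mem_enum inE negbK.
have inj : injective (tnth (Tuple sL)).
  by apply/tuple_uniqP.
exists (perm inj) => j; rewrite permE (tnth_nth j) /= nth_cat -cardE.
case: ltnP => jk.
  apply/negbTE; have : nth j (enum [pred k | ~~ P k]) j \in enum [pred k | ~~ P k].
    by apply: mem_nth; rewrite -cardE.
  by rewrite mem_enum inE.
have : nth j (enum P) (j - #|[pred k | ~~ P k]|) \in enum P.
  apply: mem_nth; rewrite -cardE ltn_subLR //.
  have := eqP sL; rewrite size_cat -!cardE => ->; exact: ltn_ord.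
by rewrite mem_enum.
Qed.

Lemma submanifold_at_coord C (S : set X) x (P : pred 'I_d) :
  smooth_chart C -> chart_dom C x ->
  (forall y, chart_dom C y -> S y <-> forall j, P j -> C y ord0 j = 0) ->
  submanifold_at S x #|[pred k | ~~ P k]|.
Proof.
move=> sC Cx SP; have [s sP] := sorting_perm P.
split; first by rewrite -[X in (_ <= X)%N]card_ord; exact: max_card.
exists (chart_perm C s); split=> //; first exact: smooth_chart_perm.
move=> y Cy; rewrite (SP y Cy); split=> [H j|H j Pj] /=.
  by rewrite -sP mxE; exact: H.
have := H ((s^-1)%g j); rewrite /= mxE permKV; apply.
by rewrite -sP permKV.
Qed.

End PermutedChart.

(** Both sides count the pairs (a, i) with w_a <= i, that is, the coordinates x_a^(i) left free on
    Q. *)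
Lemma card_weights (n r : nat) (w : 'I_n -> nat) :
  #|[pred k | ~~ mxvec (\matrix_(a < n, i < r.+1) (i < w a)%N) ord0 k]| =
  (\sum_(i < r.+1) weight_count w i)%N.
Proof.
rewrite -sum1_card.
have -> : (\sum_(i < r.+1) weight_count w i =
   \sum_(p : 'I_n * 'I_r.+1 | (w p.1 <= p.2)%N) 1)%N.
  rewrite -(pair_big_dep xpredT (fun a (i : 'I_r.+1) => (w a <= i)%N) (fun _ _ => 1%N)) /=.
  rewrite (exchange_big_dep xpredT) //=; apply: eq_bigr => i _.
  by rewrite /weight_count -sum1_card; apply: eq_bigl => a; rewrite inE.
rewrite (reindex (uncurry (@mxvec_index n r.+1))) /=; last first.
  have [g gK Kg] := curry_mxvec_bij n r.+1.
  by apply: onW_bij; exists g => -[a i]; [exact: (gK (a, i))|exact: Kg].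
apply: eq_bigl => -[a i] /=.
by rewrite inE mxvecE mxE -leqNgt.
Qed.

Section ZeroSectionTangents.
Variables (R : realType) (n : nat) (M : charted_space R n) (r : nat).
Hypothesis hM : is_manifold M.
Let gM : good_atlas M := manifold_good_atlas hM.
Let gT : good_atlas (T_ M r) := T_good_atlas r hM.
Variables (c : chart R M n) (Xc : 'I_n -> Cinfty M).
Hypothesis sc : smooth_chart c.
Hypothesis XcE : forall y a, chart_dom c y -> c y ord0 a = Xc a y.
Notation C := (Tchart r hM sc XcE : chart R (T_ M r) (n * r.+1)).
Notation zs := (@zero_section R n M r).
Notation TX := (fun k => mxvec (\matrix_(a < n, i < r.+1) Chcoef hM (Xc a) i) ord0 k).
Implicit Types (f g : Cinfty M) (u : T_ M r) (x y : M) (V L : Cinfty (T_ M r) -> R).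
Implicit Types (v : Cinfty M -> R).

Lemma smooth_Tchart : smooth_chart C.
Proof.
by move=> C'; case: gT => _ _; apply; exact: Tchart_atlas.
Qed.

Lemma TchartE u : Tdom c u -> forall k, C u ord0 k = TX k u.
Proof. by move=> cu k; case/mxvec_indexP: k => a i; rewrite /= !mxvecE !mxE. Qed.

Lemma hcoef_zero f i x : hcoef f i (zs x) = if i == 0%N then f x else 0.
Proof.
rewrite /hcoef; have -> : ht_mor (zs x) f = f x *: (1 : trunc R r) by [].
have [ir|ri] := leqP i r.
  by rewrite truncZ_coef trunc1_coef //; case: eqP; rewrite ?mulr1 ?mulr0.
rewrite nth_default; last by apply: leq_trans (trunc_size _) _.
by case: eqP => // i0; rewrite i0 in ri.
Qed.

Lemma base_zero x : base_point (zs x) x.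
Proof. by move=> f; rewrite hcoef_zero. Qed.

Lemma Tdom_zero x : chart_dom c x -> Tdom c (zs x).
Proof. by move=> cx; exists x => //; exact: base_zero. Qed.

Lemma range_zero_coord u : Tdom c u ->
  range zs u <-> forall a (i : 'I_r.+1), (0 < i)%N -> hcoef (Xc a) i u = 0.
Proof.
move=> [y cy uy]; split=> [[x _ <-] a i i0|H].
  by rewrite hcoef_zero gtn_eqF.
exists y => //; apply: (good_chart_ext hM sc XcE cy (base_zero y) uy) => a i ir.
rewrite hcoef_zero; case: eqP => [->|/eqP i0]; first by rewrite uy.
by rewrite (H a (Ordinal (ir : (i < r.+1)%N))) //= lt0n.
Qed.

Section AtPoint.
Variable x : M.
Hypothesis cx : chart_dom c x.

Lemma tangent_coord_subset (S : set (T_ M r)) (P : 'I_n -> 'I_r.+1 -> bool) V :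
  S (zs x) ->
  (forall u, Tdom c u -> S u <-> forall a i, P a i -> hcoef (Xc a) i u = 0) ->
  tangent_subspace S (zs x) V <->
  tangent_space (zs x) V /\ forall a i, P a i -> V (Chcoef hM (Xc a) i) = 0.
Proof.
move=> Sx SP; pose Q k := mxvec (\matrix_(a < n, i < r.+1) P a i) ord0 k.
rewrite (@tangent_subspace_coord _ _ _ gT C (zs x) (Tdom c) TX S Q V smooth_Tchart
  (Tdom_open r hM c) (Tdom_zero cx)) //.
- split=> -[tV H]; split=> //.
    by move=> a i Pai; have := H (mxvec_index a i); rewrite /Q !mxvecE !mxE; apply.
  by move=> k; case/mxvec_indexP: k => a i; rewrite /Q !mxvecE !mxE; exact: H.
- by move=> k u cu; rewrite TchartE.
- move=> u cu; rewrite (SP u cu); split=> [H k|H a i Pai].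
    by case/mxvec_indexP: k => a i; rewrite /Q /= !mxvecE !mxE; exact: H.
  by have := H (mxvec_index a i); rewrite /Q /= !mxvecE !mxE; apply.
Qed.

Lemma tangent_prescribed (b : 'I_n -> 'I_r.+1 -> R) : exists V,
  tangent_space (zs x) V /\ forall a i, V (Chcoef hM (Xc a) i) = b a i.
Proof.
pose lam k := mxvec (\matrix_(a < n, i < r.+1) b a i) ord0 k.
exists (fun F => \sum_k lam k * pderiv C (zs x) k F); split.
  apply: tangent_space_comb => k; apply: (tangent_pderiv gT) => //.
    exact: smooth_Tchart.
  exact: Tdom_zero.
move=> a i; have := @pderiv_comb_coord _ _ _ C (zs x) (Tdom c) TX lam
  (mxvec_index a i) (Tdom_open r hM c) (Tdom_zero cx).
rewrite !mxvecE !mxE /lam mxvecE mxE; apply => // k u cu.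
by rewrite TchartE.
Qed.

(* The value of a lift on any f^(l) follows from its values on the coordinates
   by the Hadamard formula of f at x. *)
Lemma lift_of_coord v i L : tangent_space x v -> (i <= r)%N ->
  tangent_space (zs x) L ->
  (forall a (j : 'I_r.+1),
     L (Chcoef hM (Xc a) j) = if (j : nat) == i then v (Xc a) else 0) ->
  is_lift x v i L.
Proof.
move=> tv ir tL LX; split=> // f l g lr gE.
have -> : g = Chcoef hM f (Ordinal (lr : (l < r.+1)%N)) by exact: CinftyP.
have [h [U [Uo Ux Uc fE]]] := manifold_hadamard gM f sc cx.
pose D a := Xc a - c x ord0 a *: (1 : Cinfty M).
pose lo (m : nat) : 'I_r.+1 := inord m.
have lol m : (m <= l)%N -> lo m = m :> nat.
  by move=> ml; rewrite inordK // ltnS (leq_trans ml).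
(* The l-th coefficient of Hadamard's formula f = f(x) + sum_a (x_a - x_a(x)) h_a, as a function on
   T_r M. *)
pose G : Cinfty (T_ M r) := f x *: Chcoef hM 1 (lo l) +
  \sum_a \sum_(j < l.+1) Chcoef hM (D a) (lo j) * Chcoef hM (h a) (lo (l - j)%N).
have -> : L (Chcoef hM f (Ordinal (lr : (l < r.+1)%N))) = L G.
  have Uo' := openI Uo (@chart_dom_open _ _ _ c).
  apply: (tangent_local gT tL (Tdom_open r hM (chart_restr c Uo))).
    by exists x => //; exact: base_zero.
  move=> u [y [cy Uy] uy].
  pose F := f x *: (1 : Cinfty M) + \sum_a D a * h a.
  have -> : Chcoef hM f (Ordinal (lr : (l < r.+1)%N)) u = hcoef F l u.
    apply: (hcoef_local hM _ uy Uo' (conj Uy cy)) => z [Uz cz].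
    rewrite fE // !CinftyE mulr1 Cinfty_sum; congr (_ + _).
    by apply: eq_bigr => a _; rewrite !CinftyE mulr1 XcE.
  rewrite CinftyD CinftyZ Cinfty_sum hcoefD hcoefZ hcoef_sum /= lol //.
  congr (_ + _); apply: eq_bigr => a _; rewrite Cinfty_sum hcoefM //.
  apply: eq_bigr => j _; rewrite CinftyM /= !lol ?leq_subr //.
  by rewrite -ltnS.
have cst_k (j : 'I_r.+1) : L (Chcoef hM 1 j) = 0.
  have -> : Chcoef hM 1 j = (j == 0%N :> nat)%:R *: (1 : Cinfty (T_ M r)).
    by apply: CinftyP => u; rewrite CinftyZ mulr1 /= hcoef1 // leq_ord.
  by rewrite (tangentZ _ _ tL) (tangent1 tL) mulr0.
have LD a (j : 'I_r.+1) : L (Chcoef hM (D a) j) =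
    if (j : nat) == i then v (Xc a) else 0.
  have -> : Chcoef hM (D a) j = Chcoef hM (Xc a) j - c x ord0 a *: Chcoef hM 1 j.
    by apply: CinftyP => u; rewrite /= hcoefD hcoefN hcoefZ.
  by rewrite (tangentB _ _ tL) (tangentZ _ _ tL) cst_k mulr0 subr0.
have D0 a (j : 'I_r.+1) : Chcoef hM (D a) j (zs x) = 0.
  rewrite /= hcoef_zero; case: eqP => // _.
  by rewrite !CinftyE mulr1 XcE // subrr.
rewrite /G (tangentD _ _ tL) (tangentZ _ _ tL) cst_k mulr0 add0r.
rewrite (tangent_sum _ _ tL).
have vE : v f = \sum_a h a x * v (Xc a).
  pose F := f x *: (1 : Cinfty M) + \sum_a D a * h a.
  have -> : v f = v F.
    apply: (tangent_local gM tv (openI Uo (@chart_dom_open _ _ _ c))) => //.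
    move=> z [Uz cz]; rewrite fE // !CinftyE mulr1 Cinfty_sum; congr (_ + _).
    by apply: eq_bigr => a _; rewrite !CinftyE mulr1 XcE.
  rewrite (tangentD _ _ tv) (tangentZ _ _ tv) (tangent1 tv) mulr0 add0r.
  rewrite (tangent_sum _ _ tv); apply: eq_bigr => a _.
  rewrite (tangentM _ _ tv) (tangentB _ _ tv) (tangentZ _ _ tv) (tangent1 tv).
  by rewrite !CinftyE mulr1 XcE // subrr mul0r add0r mulr0 subr0.
have -> : (if l == i then v f else 0) = \sum_a (if l == i then h a x * v (Xc a) else 0).
  by case: eqP => _; rewrite ?vE // big1.
(* At the zero section over x all coefficients of x_a - x_a(x) vanish, and those of h_a vanish above
   degree 0; in the Leibniz rule only the term with j = l survives. *)
apply: eq_bigr => a _; rewrite (tangent_sum _ _ tL) big_ord_recr /= big1 => [|j _].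
  rewrite add0r (tangentM _ _ tL) D0 mul0r add0r LD lol // subnn /= hcoef_zero.
  by rewrite lol // eqxx; case: eqP => _; rewrite ?mulr0.
rewrite (tangentM _ _ tL) D0 mul0r add0r /= hcoef_zero lol ?leq_subr //.
by rewrite subn_eq0 leqNgt ltn_ord mul0r.
Qed.

Lemma lift_coord v i L : is_lift x v i L -> forall a (j : 'I_r.+1),
  L (Chcoef hM (Xc a) j) = if (j : nat) == i then v (Xc a) else 0.
Proof. by case=> _ _ H a j; apply: H => //; exact: leq_ord. Qed.

Lemma lift_exists v i : tangent_space x v -> (i <= r)%N ->
  exists L, is_lift x v i L.
Proof.
move=> tv ir.
have [L [tL LX]] := tangent_prescribed (fun a j => if (j : nat) == i then v (Xc a) else 0).
by exists L; exact: lift_of_coord.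
Qed.

End AtPoint.
End ZeroSectionTangents.

(** * Divisibility of functions vanishing on jets *)

Section JetDivision.
Variables (R : realType) (n : nat) (M : charted_space R n) (r : nat).
Variable W : weighting M r.
Variables (c c' : chart R M n) (w : 'I_n -> nat).
Hypothesis wc : weighted_chart W c w.
Hypothesis sc' : smooth_chart c'.
Hypothesis c'c : chart_dom c' `<=` chart_dom c.
Hypothesis c'E : forall y, c' y = c y.
Variables (p : 'rV[R]_n) (e : R).
Hypothesis c'B : c' @` chart_dom c' = ball p e.
Hypothesis p0 : forall a, (0 < w a)%N -> p ord0 a = 0.
Notation B := (ball p e).
Notation jets := 'rV[R]_(n * r.+1).
Implicit Types (h g : 'rV[R]_n -> R) (xi : jets).

(* [h] times any monomial lies in the accordingly shifted step of the
   filtration; unlike membership in a single step, this is visibly preserved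
   by multiplication with coordinates. *)
Definition weighted_order i h := forall s : 'I_n -> nat,
  wfilt W (i + \sum_a s a * w a) (chart_dom c')
    (fun x => monomial s (c' x) * h (c' x)).

Let c'o : open (chart_dom c').
Proof. exact: chart_dom_open. Qed.

Let img_B x : chart_dom c' x -> B (c' x).
Proof. by move=> c'x; rewrite -c'B; exists x. Qed.

Lemma smooth_on_pull h : smooth_rV B h -> smooth_on (chart_dom c') (fun x => h (c' x)).
Proof.
move=> sh; apply: (smooth_chart_on sc') => //.
by exists h => //; apply: smooth_mono sh => _ [x [c'x _] <-]; exact: img_B.
Qed.

Lemma weighted_order_smooth h : smooth_rV B h -> weighted_order 0 h.
Proof.
move=> sh s; rewrite add0n.
have co := @chart_dom_open _ _ _ c.
have H := wfilt_res co c'o c'c (wfilt_monomial s wc).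
apply: (wfilt_local c'o _ (wfilt_mul c'o (smooth_on_pull sh) H)) => x c'x.
by rewrite [LHS]mulrC c'E.
Qed.

(** The factor x_b is absorbed into the monomial by raising its exponent of x_b by one. *)
Lemma weighted_order_mulX b i h : weighted_order i h ->
  weighted_order (i + w b) (fun y => y ord0 b * h y).
Proof.
move=> oh s; pose s' a := (s a + (a == b) * 1)%N.
have -> : (i + w b + \sum_a s a * w a = i + \sum_a s' a * w a)%N.
  rewrite -addnA; congr (_ + _)%N.
  under [RHS]eq_bigr do rewrite mulnDl.
  by rewrite big_split /= sum_delta mul1n addnC.
apply: (wfilt_local c'o _ (oh s')) => x c'x.
have -> : monomial s' (c' x) = monomial s (c' x) * c' x ord0 b.
  rewrite -[c' x ord0 b]expr1 -monomial_delta /monomial -big_split /=.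
  by apply: eq_bigr => a _; rewrite exprD.
by rewrite mulrA.
Qed.

Lemma weighted_orderD i h g : weighted_order i h -> weighted_order i g ->
  weighted_order i (fun y => h y + g y).
Proof.
move=> oh og s; apply: (wfilt_local c'o _ (wfilt_add c'o (oh s) (og s))) => x _.
by rewrite [RHS]mulrDr.
Qed.

Lemma weighted_order_le i j h : (i <= j)%N -> weighted_order j h ->
  weighted_order i h.
Proof.
by move=> ij oh s; apply: (wfilt_le c'o _ (oh s)); rewrite leq_add2r.
Qed.

Lemma weighted_order_ext i h g : (forall y, B y -> h y = g y) ->
  weighted_order i h -> weighted_order i g.
Proof.
move=> hg oh s; apply: (wfilt_local c'o _ (oh s)) => x c'x.
by rewrite hg //; exact: img_B.
Qed.

Lemma weighted_order0 i : weighted_order i (cst 0).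
Proof.
move=> s; apply: (wfilt_local c'o _ (wfilt_zero W _ c'o)) => x _.
by rewrite mulr0.
Qed.

Definition Q_jet xi := B (jet_base xi) /\
  forall b (j : 'I_r.+1), (j < w b)%N -> xi ord0 (mxvec_index b j) = 0.

Definition jet_vanishes i h := forall xi, Q_jet xi ->
  forall j, (j < i)%N -> jetc j h xi = 0.

Lemma Q_jet_kill b xi : (0 < w b)%N -> Q_jet xi -> Q_jet (jet_kill b xi).
Proof.
move=> wb [Bxi xi0]; split.
  have -> : jet_base (jet_kill b xi) = retr p b 1 (jet_base xi).
    apply/rowP => a; rewrite retrE !mxE mxvecE mxE p0 // mul1r subr0 subrr.
    by case: eqP.
  by apply: retr_ball => //; rewrite lexx ler01.
by move=> a j ja; rewrite mxvecE mxE xi0 // if_same.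
Qed.

Lemma jet_vanishes_retr b i h : (0 < w b)%N -> jet_vanishes i h ->
  jet_vanishes i (fun y => h (retr p b 1 y)).
Proof.
move=> wb Jh xi Qxi j ji; rewrite jetc_kill ?p0 //.
by apply: Jh => //; exact: Q_jet_kill.
Qed.

(* Where the leading coefficient of the coordinate does not vanish one can
   divide; the other points are limits of such points. *)
Lemma jet_vanishes_divX b i g : (0 < w b)%N -> (w b <= i <= r)%N ->
  smooth_rV B g -> jet_vanishes i (fun y => y ord0 b * g y) ->
  jet_vanishes (i - w b) g.
Proof.
move=> wb /andP[wi ir] sg Jg.
have Bo : open B := ball_open p e.
have wr : (w b <= r)%N := leq_trans wi ir.
pose k0 : 'I_(n * r.+1) := mxvec_index b (inord (w b)).
have iw : (inord (w b) : 'I_r.+1) = w b :> nat by rewrite inordK.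
have main xi : Q_jet xi -> xi ord0 k0 != 0 ->
    forall j, (j < i - w b)%N -> jetc j g xi = 0.
  move=> [Bxi xi0] nz; elim/ltn_ind => j IH ji.
  have jw : (w b + j < i)%N by rewrite -ltn_subRL.
  have := Jg xi (conj Bxi xi0) _ jw.
  rewrite (jetcM _ Bo) //; last exact: smooth_coord.
  have lt : (w b < (w b + j).+1)%N by rewrite ltnS leq_addr.
  (* In the Leibniz sum of order w_b + j the terms with k < w_b vanish since xi is a jet of Q, those
     with k > w_b by induction on j; what is left is the leading coefficient times [jetc j g]. *)
  rewrite (bigD1 (Ordinal lt)) //= addKn big1 => [|k /= kw].
    rewrite addr0 jetc_coord // => /eqP; rewrite mulf_eq0 (negbTE nz) /=.
    by move/eqP.
  have kr : (k <= r)%N.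
    by rewrite (leq_trans _ ir) // (leq_trans _ jw) // ltnW.
  have [kb|bk|kb] := ltngtP k (w b).
  - by rewrite jetc_coord // xi0 ?mul0r // inordK.
  - rewrite [X in _ * X]IH ?mulr0 //.
      by rewrite ltn_subLR ?ltn_add2r // -ltnS.
    apply: leq_ltn_trans ji; rewrite leq_subLR leq_add2r; exact: ltnW.
  - by rewrite -val_eqE /= kb eqxx in kw.
move=> xi Qxi j ji; have [xk0|] := eqVneq (xi ord0 k0) 0; last by move=> ?; exact: main.
have [Bxi xi0] := Qxi.
(* The perturbation changes only the coefficient of index w_b of x_b. It is free on Q, and since w_b
   > 0 the base point is unchanged. *)
have P t : t != 0 -> jetc j g (t *: delta_mx ord0 k0 + xi) = 0.
  move=> t0; apply: main => //; last by rewrite !mxE !eqxx mulr1 xk0 addr0.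
  have K a (l : 'I_r.+1) : (a != b) || (l != w b :> nat) ->
    (t *: delta_mx ord0 k0 + xi) ord0 (mxvec_index a l) =
    xi ord0 (mxvec_index a l).
    move=> al; rewrite !mxE eqxx /=; case: eqP => [E|_]; last by rewrite mulr0 add0r.
    (* Evaluating the indicator matrix of the entry (b, w_b) shows that equal vectorised positions
       come from equal pairs of indices. *)
    pose A : 'M[bool]_(n, r.+1) := \matrix_(a', l') ((a' == b) && (l' == inord (w b))).
    have : mxvec A ord0 (mxvec_index a l) by rewrite E mxvecE mxE !eqxx.
    by rewrite mxvecE mxE => /andP[/eqP ab /eqP lb]; move: al; rewrite ab lb iw !eqxx.
  split.
    suff -> : jet_base (t *: delta_mx ord0 k0 + xi) = jet_base xi by [].
    by apply/rowP => a; rewrite [LHS]mxE [RHS]mxE K //= (ltn_eqF wb) orbT.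
  move=> a l la; rewrite K ?xi0 //.
  have [ab|//] := eqVneq a b; rewrite /= -ab.
  by rewrite ltn_eqF.
have C : (fun t : R => jetc j g (t *: delta_mx ord0 k0 + xi)) @ (0 : R)^' --> jetc j g xi.
  have Cl : (fun t : R => t *: delta_mx ord0 k0 + xi) @ (0 : R)^' --> xi.
    have C0 : (fun t : R => t *: delta_mx ord0 k0 + xi) @ (0 : R) -->
        0 *: delta_mx ord0 k0 + xi.
      by apply: cvgD; [apply: cvgZ; [exact: cvg_id|exact: cvg_cst]|exact: cvg_cst].
    by rewrite scale0r add0r in C0; exact: cvg_within_filter C0.
  apply: cvg_comp_for Cl; apply: (@smooth_cont _ _ (@jet_base R n r @^-1` B)) => //.
  exact: smooth_jetc.
have C' : (fun t : R => jetc j g (t *: delta_mx ord0 k0 + xi)) @ (0 : R)^' --> 0.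
  apply: cvg_trans (_ : (fun=> 0) @ 0^' --> 0); last exact: cvg_cst.
  apply: near_eq_cvg; near=> t; rewrite P //; near: t.
  exact: nbhs_dnbhs_neq.
exact: (cvg_unique _ C C').
Unshelve. all: by end_near. Qed.

(** Once all coordinates of positive weight have been set to 0 nothing remains: constant jets over
    points of N lie in Q, so h vanishes there as soon as i > 0. The induction hypothesis applies to
    each quotient because w_b > 0 makes i - w_b smaller than i. *)
Lemma jet_vanishes_weighted_order i h : (i <= r)%N -> smooth_rV B h ->
  jet_vanishes i h -> weighted_order i h.
Proof.
have Bo : open B := ball_open p e.
elim/ltn_ind: i h => i IH h ir sh Jh; case: (posnP i) => [->|i0].
  exact: weighted_order_smooth.
pose bs := [seq b <- enum 'I_n | (0 < w b)%N].
have H s h1 : all (fun b => (0 < w b)%N) s -> smooth_rV B h1 -> jet_vanishes i h1 ->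
    weighted_order i (fun y => h1 y - h1 (retrs p s y)).
  elim: s h1 => [|b s IHs] h1 /=.
    move=> _ _ _; apply: weighted_order_ext (weighted_order0 i) => y _.
    by rewrite subrr.
  move=> /andP[wb ws] sh1 Jh1.
  pose g := retr_int p b 0 ('D_(delta_mx ord0 b) h1).
  have sg : smooth_rV B g by apply: smooth_retr_int; exact: smooth_D.
  have gE y : B y -> h1 y - h1 (retr p b 1 y) = y ord0 b * g y.
    by move=> By; rewrite (retr_intE _ (sh1 1%N) By) p0 // subr0.
  have sr := smooth_retr1 b sh1.
  have Jr := jet_vanishes_retr wb Jh1.
  have o2 := IHs _ ws sr Jr.
  apply: (weighted_order_ext _ (weighted_orderD (h := fun y => y ord0 b * g y) _ o2)).
    by move=> y By /=; rewrite -gE // addrA subrK.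
  have og : weighted_order (i - w b) g.
    (* If w_b > i the truncated difference is 0: then smoothness of g is enough, as x_b alone has
       sufficient weight. *)
    have [wi|iw] := leqP (w b) i; last first.
      have -> : (i - w b = 0)%N by apply/eqP; rewrite subn_eq0 ltnW.
      exact: weighted_order_smooth.
    apply: IH => //; first by rewrite ltn_subrL wb.
      exact: leq_trans (leq_subr _ _) ir.
    apply: jet_vanishes_divX => //; first by rewrite wi.
    move=> xi [Bxi xi0] j ji.
    have -> : jetc j (fun y => y ord0 b * g y) xi =
        jetc j (fun y => h1 y + (-1) * h1 (retr p b 1 y)) xi.
      by apply: (jetc_local _ Bo) => // y By; rewrite -gE // mulN1r.
    rewrite (jetcD _ Bo) //; last exact: smoothZ.
    rewrite Jh1 // add0r.
    rewrite (@jetcM _ _ _ _ (cst (-1)) _ _ _ Bo) //; last exact: smooth_cst.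
    rewrite big1 // => k _; rewrite Jr ?mulr0 //.
    exact: leq_ltn_trans (leq_subr _ _) ji.
  apply: weighted_order_le (weighted_order_mulX b og).
  by rewrite addnC -leq_subLR.
have abs : all (fun b => (0 < w b)%N) bs by apply/allP => b; rewrite mem_filter => /andP[].
apply: weighted_order_ext (H bs h abs sh Jh) => y By.
(* The constant jet at the projected point: its higher coefficients are 0 and its base has vanishing
   coordinates of positive weight, so it belongs to Q. *)
pose xi : jets := mxvec (\matrix_(a < n, j < r.+1)
  if j == ord0 then retrs p bs y ord0 a else 0).
have bxi : jet_base xi = retrs p bs y.
  by apply/rowP => a; rewrite mxE mxvecE mxE eqxx.
suff Qxi : Q_jet xi by have := Jh xi Qxi 0%N i0; rewrite /= bxi => ->; rewrite subr0.
split.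
  rewrite bxi /retrs; elim: (bs) => [//|b s IHs] /=.
  by apply: retr_ball => //; rewrite lexx ler01.
move=> b j jb; rewrite mxvecE mxE; case: eqP => // j0.
have wb : (0 < w b)%N by apply: leq_ltn_trans jb.
by rewrite retrsE mem_filter wb mem_enum /= p0.
Qed.

End JetDivision.

(** * The graded bundle of a weighting *)

Section LambdaAction.
Variables (R : realType) (n : nat) (M : charted_space R n) (r : nat).
Implicit Types (f : Cinfty M) (u : T_ M r) (x : M) (p : trunc R r).

Lemma scale_eps_coef t p j : (j <= r)%N ->
  (scale_eps t p : {poly R})`_j = t ^+ j * (p : {poly R})`_j.
Proof.
move=> jr; rewrite /scale_eps in_trunc_coef // comp_polyE coef_sum.
under eq_bigr do rewrite exprZn !coefZ coefXn.
have [jp|pj] := ltnP j (size (p : {poly R})); last first.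
  rewrite [in RHS]nth_default // mulr0 big1 // => i _.
  by rewrite gtn_eqF ?mulr0 // (leq_trans (ltn_ord i)).
rewrite (bigD1 (Ordinal jp)) //= eqxx big1 ?addr0 => [|i ij]; first by rewrite mulr1 mulrC.
have -> : (j == i :> nat) = false by apply: negbTE; rewrite eq_sym.
by rewrite !mulr0.
Qed.

Lemma hcoef_kappa t f j u : (j <= r)%N ->
  hcoef f j (kappa t u) = t ^+ j * hcoef f j u.
Proof. by move=> jr; rewrite -scale_eps_coef. Qed.

Lemma kappa0 u x : base_point u x -> kappa 0 u = zero_section r x.
Proof.
move=> ux; apply: ht_ext => f j jr; rewrite hcoef_kappa // hcoef_zero expr0n.
by case: eqP => [->|_]; rewrite ?mul0r // mul1r ux.
Qed.

Lemma Lambda_act_eps_ord (Psi : Lambda R r) f u k :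
  eps_ord k (ht_mor u f) -> eps_ord k (ht_mor (Lambda_act Psi u) f).
Proof. exact: eps_ord_Lambda. Qed.

End LambdaAction.

Section TangentOrder.
Variables (R : realType) (n : nat) (M : charted_space R n).
Variables (x : M) (v : Cinfty M -> R) (i : nat).
Hypothesis tv : tangent_space x v.
Implicit Types (f g : Cinfty M) (k l : nat).

(** f has order at least k under the homomorphism f |-> f(x) + v(f) delta into the dual numbers,
    where delta is given degree i: the counterpart of [eps_ord] for tangent vectors. *)
Definition tangent_ord k f := ((0 < k)%N -> f x = 0) /\ ((i < k)%N -> v f = 0).

Lemma tangent_ord0 f : tangent_ord 0 f.
Proof. by []. Qed.

Lemma tangent_ordM k l f g : tangent_ord k f -> tangent_ord l g ->
  tangent_ord (k + l) (f * g).
Proof.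
move=> [fx vf] [gx vg]; split=> kl; rewrite ?CinftyM ?(tangentM _ _ tv).
  by move: kl; rewrite addn_gt0 => /orP[/fx|/gx] ->; rewrite ?mul0r ?mulr0.
have -> : f x * v g = 0.
  case: (posnP k) => [k0|/fx ->]; last exact: mul0r.
  by rewrite vg ?mulr0 //; move: kl; rewrite k0.
case: (posnP l) => [l0|/gx ->]; last by rewrite mul0r addr0.
by rewrite vf ?mulr0 ?addr0 //; move: kl; rewrite l0 addn0.
Qed.

Lemma tangent_ordX k m f : tangent_ord k f -> tangent_ord (m * k) (f ^+ m).
Proof.
move=> fk; elim: m => [|m IH]; first exact: tangent_ord0.
by rewrite exprS mulSn; exact: tangent_ordM.
Qed.

Lemma tangent_ord_prod (I : Type) (s : seq I) (k : I -> nat) (F : I -> Cinfty M) :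
  (forall a, tangent_ord (k a) (F a)) ->
  tangent_ord (\sum_(a <- s) k a) (\prod_(a <- s) F a).
Proof.
move=> kF; elim: s => [|a s IH]; first by rewrite !big_nil; exact: tangent_ord0.
by rewrite !big_cons; exact: tangent_ordM.
Qed.

End TangentOrder.

Section AdaptedChart.
Variables (R : realType) (n : nat) (M : charted_space R n) (r : nat).
Variables (N : set M) (W : weighting M r).
Hypothesis hM : is_manifold M.
Hypothesis hW : weighting_along W N.
Let gM : good_atlas M := manifold_good_atlas hM.
Variables (c c' : chart R M n) (w : 'I_n -> nat) (Xc : 'I_n -> Cinfty M).
Hypothesis wc : weighted_chart W c w.
Hypothesis sc' : smooth_chart c'.
Hypothesis c'c : chart_dom c' `<=` chart_dom c.
Hypothesis c'E : forall y, c' y = c y.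
Hypothesis XcE : forall y a, chart_dom c' y -> c' y ord0 a = Xc a y.
Hypothesis Xcw : forall a, wfilt W (w a) setT (Xc a).
Notation zs := (@zero_section R n M r).
Notation Q := (Qset W).
Implicit Types (u : T_ M r) (v : Cinfty M -> R) (V L : Cinfty (T_ M r) -> R).

Lemma base_coord y : chart_dom c' y ->
  N y <-> forall a, (0 < w a)%N -> Xc a y = 0.
Proof.
move=> c'y; rewrite (weighted_base hM hW wc (c'c c'y)).
by split=> H a wa; have := H a wa; rewrite -c'E XcE.
Qed.

Lemma Q_base_coord u y : chart_dom c' y -> base_point u y -> Q u -> N y.
Proof.
move=> c'y uy Qu; apply/base_coord => // a wa; rewrite -uy.
by move: Qu; rewrite (Qset_coord hM wc c'c c'E XcE Xcw); [apply|exists y].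
Qed.

Lemma submanifold_at_Q u y : chart_dom c' y -> base_point u y -> Q u ->
  submanifold_at Q u (\sum_(i < r.+1) weight_count w i)%N.
Proof.
move=> c'y uy Qu; rewrite -card_weights.
apply: (submanifold_at_coord (smooth_Tchart hM sc' XcE)); first by exists y.
move=> z Cz; rewrite (Qset_coord hM wc c'c c'E XcE Xcw) //; split=> H.
  by move=> k; case/mxvec_indexP: k => a i; rewrite mxvecE mxE TmapE; exact: H.
move=> a j ja; have [_ [_ wr] _] := wc.
have jr : (j < r.+1)%N by rewrite ltnS (leq_trans (ltnW ja)).
by have := H (mxvec_index a (Ordinal jr)); rewrite mxvecE mxE TmapE; exact.
Qed.

Lemma zero_base_coord u : Tdom c' u -> (zs @` N) u <->
  forall a (i : 'I_r.+1), (0 < i)%N || (0 < w a)%N -> hcoef (Xc a) i u = 0.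
Proof.
move=> Cu; have Ru := range_zero_coord hM sc' XcE Cu; split=> [[y Ny yu]|H].
  have [z c'z uz] := Cu.
  have yz : y = z by apply: (base_point_unique hM _ uz); rewrite -yu; exact: base_zero.
  move=> a i; rewrite -yu hcoef_zero; case: posnP => [i0 /=|//].
  by have c'y : chart_dom c' y; [rewrite yz|exact: (base_coord c'y).1].
have [|y _ yu] := Ru.2; first by move=> a i i0; apply: H; rewrite i0.
have [z c'z uz] := Cu.
have yz : y = z by apply: (base_point_unique hM _ uz); rewrite -yu; exact: base_zero.
exists y => //; apply/base_coord; first by rewrite yz.
by move=> a wa; have := H a ord0; rewrite wa orbT -yu hcoef_zero; exact.
Qed.

Variable x : M.
Hypotheses (c'x : chart_dom c' x) (Nx : N x).

(** A function of filtration degree i+1 is near x a combination of monomials of weight above i; if v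
    kills the coordinates of weight above i, multiplicativity of [tangent_ord] shows that it kills
    these monomials with their coefficients. *)
Lemma Ftilde_coord v i : Ftilde W i x v <->
  tangent_space x v /\ forall a, (i < w a)%N -> v (Xc a) = 0.
Proof.
split=> -[tv H]; split=> //.
  move=> a ia; apply: H; exists setT; split=> //; first exact: openT.
  exact: (wfilt_le openT ia (Xcw a)).
move=> f [U [Uo Ux fU]].
(* Cutting off makes f a member of the filtration over the whole weighted chart and not only over
   U. *)
have [chi [V0 [K [_ [V0o V0x _ V01] [_ Kc KU] chi0]]]] := bump gM Uo Ux.
have cf := wfilt_cutoff Uo Kc KU chi0 fU.
have co := @chart_dom_open _ _ _ c; have [_ _ wI] := wc.
have /wI [m [g [s [gs fE]]]] := wfilt_res openT co (fun _ _ => I) cf.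
have [|G [V [Vo Vx Vc GE]]] := @extension _ _ _ gM _ x _ g co (c'c c'x).
  by move=> k; case: (gs k).
have c'o := @chart_dom_open _ _ _ c'.
have -> : v f = v (\sum_(k < m) G k * \prod_(a < n) Xc a ^+ s k a).
  apply: (tangent_local gM tv (openI (openI Vo c'o) V0o)) => // z [[Vz c'z] V0z].
  rewrite -[LHS]mul1r -(V01 _ V0z) fE; last exact: c'c.
  rewrite Cinfty_sum; apply: eq_bigr => k _; rewrite CinftyM GE //; congr (_ * _).
  rewrite Cinfty_prod; apply: eq_bigr => a _.
  by rewrite Cinfty_exp -c'E XcE.
rewrite (tangent_sum _ _ tv) big1 // => k _.
have : tangent_ord x v i (0 + \sum_a s k a * w a) (G k * \prod_a Xc a ^+ s k a).
  apply: (tangent_ordM tv); first exact: tangent_ord0.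
  apply: (tangent_ord_prod tv) => a; apply: (tangent_ordX tv); split; last exact: H.
  by move=> wa; exact: (base_coord c'x).1.
by case=> _; apply; rewrite add0n; case: (gs k).
Qed.

Lemma zero_section_Q : Q (zs x).
Proof.
apply/(Qset_coord hM wc c'c c'E XcE Xcw); first exact: Tdom_zero.
move=> a j ja; rewrite hcoef_zero; case: eqP => // j0.
by apply: (base_coord c'x).1 => //; rewrite j0 in ja.
Qed.

Lemma tangent_Q_coord V : tangent_subspace Q (zs x) V <->
  tangent_space (zs x) V /\
  forall a (i : 'I_r.+1), (i < w a)%N -> V (Chcoef hM (Xc a) i) = 0.
Proof.
have H u : Tdom c' u -> Q u <->
    forall a (j : 'I_r.+1), (j < w a)%N -> hcoef (Xc a) j u = 0.
  move=> Cu; rewrite (Qset_coord hM wc c'c c'E XcE Xcw) //.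
  split=> H a j ja; first exact: H.
  have [_ [_ wr] _] := wc.
  have jr : (j < r.+1)%N by rewrite ltnS (leq_trans (ltnW ja)).
  exact: (H a (Ordinal jr)).
exact: (tangent_coord_subset hM sc' XcE c'x V zero_section_Q H).
Qed.

Lemma tangent_zero_range_coord V : tangent_subspace (range zs) (zs x) V <->
  tangent_space (zs x) V /\
  forall a (i : 'I_r.+1), (0 < i)%N -> V (Chcoef hM (Xc a) i) = 0.
Proof.
apply: (tangent_coord_subset hM sc' XcE c'x (P := fun _ i => (0 < i)%N)).
  by exists x.
by move=> u Cu; exact: (range_zero_coord hM sc' XcE Cu).
Qed.

Lemma tangent_zero_base_coord V : tangent_subspace (zs @` N) (zs x) V <->
  tangent_space (zs x) V /\
  forall a (i : 'I_r.+1), (0 < i)%N || (0 < w a)%N -> V (Chcoef hM (Xc a) i) = 0.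
Proof.
apply: (tangent_coord_subset hM sc' XcE c'x (P := fun a i => (0 < i)%N || (0 < w a)%N)).
  by exists x.
by move=> u Cu; exact: zero_base_coord.
Qed.

(** The conditions on the base coordinates x_a^(0) are the same for Q and for the zero section over
    N: both ask for vanishing when w_a > 0. *)
Lemma tangent_Q_zero V : tangent_subspace Q (zs x) V ->
  tangent_subspace (range zs) (zs x) V -> tangent_subspace (zs @` N) (zs x) V.
Proof.
move=> /tangent_Q_coord[tV VQ] /tangent_zero_range_coord[_ Vz].
apply/tangent_zero_base_coord; split=> // a i /orP[/Vz//|wa].
by case: (posnP i) => [i0|/Vz//]; apply: VQ; rewrite i0.
Qed.

Lemma lin_fiber_Q : lin_fiber Q x = [set v | forall i : 'I_r, Ftilde W i.+1 x (v i)].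
Proof.
apply/seteqP; split=> v.
  move=> [V [v0 [/tangent_Q_coord[tV VQ] [S [Sl VS]]]]] i.
  (* [lift ord0 i] has value i+1, matching the degree -(i+1) of component i. *)
  have Si := Sl (lift ord0 i); rewrite liftK in Si.
  have [tv _ _] := Si; apply/Ftilde_coord; split=> // a ia.
  have := VQ a (lift ord0 i) ia; rewrite VS fct_sumE (bigD1 (lift ord0 i)) //=.
  rewrite big1 ?addr0 => [|k ki].
    by rewrite (lift_coord hM Xc Si) eqxx.
  by rewrite (lift_coord hM Xc (Sl k)) ifN // eq_sym.
move=> Fv.
pose vv (k : 'I_r.+1) := if unlift ord0 k is Some j then v j else fun=> 0.
have tvv k : tangent_space x (vv k).
  rewrite /vv; case: unliftP => [j _|_]; first by case: (Fv j).
  split=> [a f g|f g]; first by rewrite /= mulr0 addr0.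
  by rewrite !mulr0 addr0.
have /choice[S Sl] (k : 'I_r.+1) : exists L, is_lift x (vv k) k L.
  exact: (lift_exists hM sc' XcE c'x (tvv k) (leq_ord k)).
(* The degree 0 component is divided out in the linear approximation; 0 is tangent to N, as tangency
   to Q requires of it. *)
exists (\sum_k S k), (fun=> 0); split; last by exists S.
apply/tangent_Q_coord; split.
  have -> : \sum_k S k = fun f => \sum_k 1 * S k f.
    by apply/funext => f; rewrite fct_sumE; apply: eq_bigr => k _; rewrite mul1r.
  by apply: tangent_space_comb => k; case: (Sl k).
move=> a i ia; rewrite fct_sumE big1 // => k _; rewrite (lift_coord hM Xc (Sl k)).
case: eqP => // ik; rewrite /vv; case: unliftP => [j kj|//].
have /Ftilde_coord[_] := Fv j; apply.
by move: ia; rewrite ik kj.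
Qed.

Lemma lin_degree_Q i : kappa 0 @` Q = zs @` N -> (0 < i <= r)%N ->
  lin_degree Q i x = Ftilde W i x.
Proof.
move=> Q0 /andP[i0 ir]; have ir' : (i < r.+1)%N by [].
apply/seteqP; split=> v.
  move=> [V [L [/tangent_Q_coord[tV VQ] _ Ll /tangent_zero_range_coord[_ VL]]]].
  have [tv _ _] := Ll; apply/Ftilde_coord; split=> // a ia.
  have := VL a (Ordinal ir') i0; rewrite (lift_coord hM Xc Ll) eqxx VQ // sub0r.
  by move/eqP; rewrite oppr_eq0 => /eqP.
move=> /Ftilde_coord[tv vF].
have [L Ll] := lift_exists hM sc' XcE c'x tv ir; have [_ tL _] := Ll.
(* The lift itself is tangent to Q: its only non-zero values on coordinates are those on x_a^(i),
   and v kills x_a when i < w_a. *)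
exists L, L; split=> //.
- apply/tangent_Q_coord; split=> // a j ja; rewrite (lift_coord hM Xc Ll).
  by case: eqP => // ji; apply: vF; rewrite -ji.
- move=> t V' tV' VV'; rewrite Q0; apply/tangent_zero_base_coord.
  split=> [|a j _]; first exact: tangent_spaceB.
  (* The coordinate x_a^(j) is homogeneous of degree j under kappa_t, and the lift sees only j =
     i. *)
  rewrite (VV' _ (t ^+ j *: Chcoef hM (Xc a) j)) => [|u]; last first.
    by rewrite CinftyZ /= hcoef_kappa // leq_ord.
  rewrite (tangentZ _ _ tL) (lift_coord hM Xc Ll).
  by case: eqP => [->|_]; rewrite ?mulr0 subrr.
- apply/tangent_zero_range_coord; split=> [|a j _]; last exact: subrr.
  have -> : (fun f => L f - L f) = fun f => L f - 1 * L f.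
    by apply/funext => f; rewrite mul1r.
  exact: tangent_spaceB.
Qed.

End AdaptedChart.

(** * Recovery of the filtration from Q *)

Section Recovery.
Variables (R : realType) (n : nat) (M : charted_space R n) (r : nat).
Variables (N : set M) (W : weighting M r).
Hypothesis hM : is_manifold M.
Hypothesis hW : weighting_along W N.
Let gM : good_atlas M := manifold_good_atlas hM.
Implicit Types (f : Cinfty M) (x : M).

(* Off N, some coordinate of positive weight is invertible. *)
Lemma wfilt_off_base f i x : ~ N x ->
  exists V : set M, [/\ open V, V x & wfilt W i V f].
Proof.
move=> nNx; have [c [w [wc cx]]] := wfilt_model W x.
have [b wb xb] : exists2 b, (0 < w b)%N & c x ord0 b != 0.
  apply: contrapT => H; apply: nNx; apply/(weighted_base hM hW wc cx) => a wa.
  by apply/eqP; apply/negP => /negP xa; apply: H; exists a.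
pose D : set M := chart_dom c `&` c @^-1` [set y | y ord0 b != 0].
have Do : open D.
  apply: chart_preimage_open.
  apply: (@open_comp _ _ (fun y : 'rV[R]_n => y ord0 b) [set t | t != 0]).
    by move=> y _; exact: coord_continuous.
  exact: open_neq.
have Dc : D `<=` chart_dom c by move=> y [].
have [sc _ _] := wc; have co := @chart_dom_open _ _ _ c.
exists D; split=> //.
(* As w_b >= 1, the power x_b^i has filtration degree at least i, and f is the product of f x_b^(-i)
   and x_b^i where x_b does not vanish. *)
have iw : (i <= i * w b)%N by rewrite leq_pmulr.
have Xi := wfilt_res co Do Dc (wfilt_le co iw (wfilt_coordX b i wc)).
have sX : smooth_on D (fun y => (c y ord0 b)^-1 ^+ i).
  apply: smooth_onX => //; apply: smooth_onV => // [y [] //|].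
  exact: (smooth_on_mono Dc (smooth_coord_on b sc)).
apply: (wfilt_local Do _ (wfilt_mul Do (smooth_onM Do (Cinfty_smooth_on f D) sX) Xi)).
move=> y [_ yb]; suff: f y * (c y ord0 b)^-1 ^+ i * c y ord0 b ^+ i = f y by [].
by rewrite -mulrA -exprMn mulVf // expr1n mulr1.
Qed.

(** Each jet satisfying [Q_jet] is the coordinate vector of a point of Q, so the hypothesis on Q
    becomes one on jets in coordinates. As x lies in N, the centre of the ball has vanishing
    coordinates of positive weight, which makes the retractions set these coordinates to 0. *)
Lemma wfilt_at_base f i x : N x -> (i <= r)%N ->
  (forall j, (j < i)%N -> forall u : T_ M r, Qset W u -> hcoef f j u = 0) ->
  exists V : set M, [/\ open V, V x & wfilt W i V f].
Proof.
move=> Nx ir Qf; have [c [w [wc cx]]] := wfilt_model W x.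
have [c' [Xc [e [[sc' XcE] [c'x c'c] c'E [e0 c'B] Xcw]]]] := good_weighted_chart hM wc cx.
have p0 := (weighted_base hM hW wc cx).1 Nx.
have c'o := @chart_dom_open _ _ _ c'.
exists (chart_dom c'); split=> //.
have sh : smooth_rV (ball (c x) e) (cpull c' f) by rewrite -c'B; exact: smooth_cpull.
have Jh : @jet_vanishes R n r w (c x) e i (cpull c' f).
  move=> xi [Bxi xi0] j ji; rewrite -c'B in Bxi.
  have [u [Cu uxi uf]] := jet_point_Tmap hM sc' XcE Bxi.
  have jr : (j <= r)%N by rewrite (leq_trans (ltnW ji)).
  rewrite -uf //; apply: Qf => //.
  apply/(Qset_coord hM wc c'c c'E XcE Xcw) => // a k ka.
  have [_ [_ wr] _] := wc.
  have kr : (k < r.+1)%N by rewrite ltnS (leq_trans (ltnW ka)).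
  by rewrite -(TmapE Xc u a (Ordinal kr)) uxi xi0.
have := jet_vanishes_weighted_order wc sc' c'c c'E c'B p0 ir sh Jh (fun=> 0%N).
rewrite big1 // addn0; apply: wfilt_local => // y c'y.
by rewrite /monomial big1 ?mul1r ?cpullE.
Qed.

Lemma wfilt_of_Q f i : (i <= r)%N ->
  (forall j, (j < i)%N -> forall u : T_ M r, Qset W u -> hcoef f j u = 0) ->
  wfilt W i setT f.
Proof.
move=> ir Qf; apply: wfilt_glue => [|x _]; first exact: openT.
have [V [Vo Vx fV]] : exists V : set M, [/\ open V, V x & wfilt W i V f].
  by have [Nx|/wfilt_off_base] := pselect (N x); [exact: wfilt_at_base|exact].
by exists V.
Qed.

End Recovery.

Lemma Q_base (R : realType) (n r : nat) (M : charted_space R n) (N : set M)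
    (W : weighting M r) (hM : is_manifold M) (hW : weighting_along W N) u y :
  base_point u y -> Qset W u -> N y.
Proof.
move=> uy Qu; have [c [w [wc cy]]] := wfilt_model W y.
have [c' [Xc [e [[sc' XcE] [c'y c'c] c'E _ Xcw]]]] := good_weighted_chart hM wc cy.
exact: (Q_base_coord hM hW wc c'c c'E XcE Xcw c'y uy).
Qed.

Theorem theorem7p2 (R : realType) (n r : nat) (M : charted_space R n)
    (N : set M) (W : weighting M r)
    (hM : is_manifold M) (hW : weighting_along W N) :
  (* (a) *)
  [/\ graded_subbundle (Qset W) N,
      (forall c w, weighted_chart W c w ->
         forall x u, N x -> chart_dom c x -> Qset W u -> base_point u x ->
           submanifold_at (Qset W) u (\sum_(i < r.+1) weight_count w i)%N) &
      Lambda_invariant (Qset W)] /\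
  (* (b); the first item says that nu(Q,N) injects into (T_r M)_lin *)
  (forall x, N x ->
     [/\ (forall V, tangent_subspace (Qset W) (zero_section r x) V ->
            tangent_subspace (range (zero_section r)) (zero_section r x) V ->
            tangent_subspace (zero_section r @` N) (zero_section r x) V),
         lin_fiber (Qset W) x =
           [set v | forall i : 'I_r, Ftilde W i.+1 x (v i)],
         (forall i, (0 < i <= r)%N -> lin_degree (Qset W) i x = Ftilde W i x) &
         ((0 < r)%N -> lin_degree (Qset W) r x = tangent_space x)]) /\
  (* (c) *)
  (forall i, (i <= r)%N ->
     [set f : Cinfty M | wfilt W i setT f] =
     [set f : Cinfty M | forall j, (j < i)%N ->
        forall u, Qset W u -> hcoef f j u = 0]).
Proof.
have good x : exists c w, [/\ weighted_chart W c w & chart_dom c x].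
  by have [c [w [wc cx]]] := wfilt_model W x; exists c, w.
have dimQ c w : weighted_chart W c w -> forall x u, chart_dom c x -> Qset W u ->
    base_point u x -> submanifold_at (Qset W) u (\sum_(i < r.+1) weight_count w i)%N.
  move=> wc x u cx Qu ux.
  have [c' [Xc [e [[sc' XcE] [c'x c'c] c'E _ Xcw]]]] := good_weighted_chart hM wc cx.
  exact: (submanifold_at_Q hM wc sc' c'c c'E XcE Xcw c'x ux).
have LQ : Lambda_invariant (Qset W).
  move=> Psi u Qu f i j ji ir fi; apply: (@Lambda_act_eps_ord _ _ _ _ Psi f u i _ j ji).
  by move=> k ki; exact: Qu fi.
have Q0 : kappa 0 @` Qset W = zero_section r @` N.
  apply/seteqP; split=> v [].
    move=> u Qu <-; have [y uy] := base_point_ex hM u.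
    exists y; first exact: (Q_base hM hW uy).
    by rewrite (kappa0 uy).
  move=> y Ny <-; exists (zero_section r y); last exact/kappa0/base_zero.
  have [c [w [wc cy]]] := good y.
  have [c' [Xc [e [[sc' XcE] [c'y c'c] c'E _ Xcw]]]] := good_weighted_chart hM wc cy.
  exact: (zero_section_Q hM hW wc c'c c'E XcE Xcw c'y).
split; [|split].
- split=> //; last by move=> c w wc x u _; exact: dimQ.
  split=> //; last by move=> t u; exact: LQ.
  move=> u Qu; have [y uy] := base_point_ex hM u.
  by have [c [w [wc cy]]] := good y; eexists; exact: (dimQ _ _ wc y).
- move=> x Nx; have [c [w [wc cx]]] := good x.
  have [c' [Xc [e [[sc' XcE] [c'x c'c] c'E _ Xcw]]]] := good_weighted_chart hM wc cx.
  have ld := @lin_degree_Q _ _ _ _ _ _ hM hW _ _ _ _ wc sc' c'c c'E XcE Xcw _ c'x Nx _ Q0.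
  split=> //.
  + exact: (tangent_Q_zero hM hW wc sc' c'c c'E XcE Xcw c'x Nx).
  + exact: (lin_fiber_Q hM hW wc sc' c'c c'E XcE Xcw c'x Nx).
  (* No weight exceeds r, so no condition is imposed in degree -r. *)
  + move=> r0; rewrite ld ?r0 ?leqnn //; apply/seteqP; split=> v; first by case.
    move=> tv; apply/(Ftilde_coord hM hW wc c'c c'E XcE Xcw c'x Nx); split=> // a.
    by have [_ [_ wr] _] := wc; rewrite ltnNge wr.
- move=> i ir; apply/seteqP; split=> f.
    by move=> fi j ji u Qu; exact: (Qu f i j).
  by move=> H; exact: (wfilt_of_Q hM hW ir H).
Qed.
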